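(* Let $\Sigma=\{0,\ldots,b-1\}$ be a finite alphabet and let $\boldsymbol u\in\Sigma^\omega$ be a fixed point of an irreducible Pisot morphism $\varphi:\Sigma^+\to\Sigma^+$. (i) Assuming the Pisot conjecture (every irreducible Pisot morphism has pure discrete spectrum), $\boldsymbol u$ is echoing. (ii) If $\Sigma$ is a binary alphabet ($b=2$), then $\boldsymbol u$ is echoing unconditionally.
   Context: $\mathbb N=\{0,1,2,\ldots\}$. For a finite alphabet $\Sigma=\{0,\ldots,b-1\}$, $\Sigma^+$ is the free semigroup of non-empty finite words and $\Sigma^\omega$ the set of infinite words (product topology, $\Sigma$ discrete), with shift map $\sigma(u_0u_1u_2\cdots)=u_1u_2u_3\cdots$. Morphisms. A morphism is a semigroup homomorphism $\varphi:\Sigma^+\to\Sigma^+$; it extends to $\Sigma^\omega$ by concatenation, and a fixed point is a word $\boldsymbol u\in\Sigma^\omega$ with $\varphi(\boldsymbol u)=\boldsymbol u$. Its incidence matrix $M_\varphi$ has $(i,j)$ entry equal to the number of occurrences of $j$ in $\varphi(i)$. $\varphi$ is primitive if some power of $M_\varphi$ has all entries positive. $\varphi$ is Pisot if the spectral radius $\rho(M_\varphi)$ is a Pisot number, i.e. a real algebraic integer $>1$ all of whose other Galois conjugates have absolute value strictly less than one. $\varphi$ is irreducible if the characteristic polynomial of $M_\varphi$ is irreducible over $\mathbb Q$. Pure discrete spectrum. For a primitive morphism $\varphi$ with fixed point $\boldsymbol u$, let $X_\varphi$ be the topological closure of the orbit of $\boldsymbol u$ under $\sigma$. The system $(X_\varphi,\sigma)$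 has a unique ergodic (invariant probability) measure $\mu$. Let $U_\varphi:L^2(X_\varphi,\mu)\to L^2(X_\varphi,\mu)$, $f\mapsto f\circ\sigma$. Then $\varphi$ has pure discrete spectrum if $L^2(X_\varphi,\mu)$ has a basis of eigenvectors of $U_\varphi$. Echoing words. For non-empty intervals $I,J\subseteq\mathbb N$ (sets of consecutive integers) write $I<J$ if $a<b$ for all $a\in I,b\in J$, and $d(I,J)=\min\{|a-b|:a\in I,b\in J\}$. For a non-empty finite set $S\subseteq\mathbb N$, $\mathrm{den}(S)=|S|/\max(S)$. Write $f\ll g$ (equivalently $g\gg f$) if there are positive constants $n_0,c_1$ with $f(n)\le c_1g(n)$ for all $n\ge n_0$. A word $\boldsymbol u=u_0u_1u_2\ldots\in\Sigma^\omega$ is echoing if, given $\varepsilon>0$, there exist for every $n\in\mathbb N$ integers $0\le r_n<s_n$ and non-empty intervals $\{0\}=I_{n,0}<I_{n,1}<I_{n,2}<\cdots$ such that: 1. (Covering) $\{i\in\mathbb N:u_{i+s_n}\ne u_{i+r_n}\}\subseteq\bigcup_{j=1}^\infty I_{n,j}$; 2. (Density) $\mathrm{den}\big(\bigcup_{j=1}^\delta I_{n,j}\big)\le\varepsilon$ for all sufficiently large $\delta$ and $n$; 3. (Expanding gaps) $s_n<s_{n+1}$ for all $n$, and as $n\to\infty$, $s_n-r_n\gg s_n$ and $d(I_{n,j},I_{n,j+1})\gg s_n$, where the implied constants are independent of $j\in\mathbb N$. *)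

(* Defs.v *)
From HB Require Import structures.
From mathcomp Require Import all_boot all_order all_algebra all_field.
From mathcomp Require Import finmap.
From mathcomp Require Import all_classical all_reals all_analysis.
From mathcomp Require Import complex.

Set Implicit Arguments.
Unset Strict Implicit.
Unset Printing Implicit Defensive.

Import Order.TTheory GRing.Theory Num.Theory.
Import numFieldNormedType.Exports.

Local Open Scope classical_set_scope.
Local Open Scope ring_scope.

(* A semigroup morphism of non-empty words, as a map on all finite words;
   the first clause forces the empty word to be sent to itself. *)
Definition word_morphism (b : nat) (phi : seq 'I_b -> seq 'I_b) : Prop :=
  {morph phi : v w / v ++ w} /\ (forall w, w != [::] -> phi w != [::]).

(* The extension to infinite words by concatenation.  A morphism is
   non-erasing, so phi (u_0 ... u_i) has more than i letters and the default
   value of nth is never used. *)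
Definition infinite_image (b : nat) (phi : seq 'I_b -> seq 'I_b)
    (u : nat -> 'I_b) : nat -> 'I_b :=
  fun i => nth (u 0%N) (phi (mkseq u i.+1)) i.

Definition fixed_point (b : nat) (phi : seq 'I_b -> seq 'I_b)
    (u : nat -> 'I_b) : Prop :=
  infinite_image phi u = u.

Definition incidence_mx (b : nat) (phi : seq 'I_b -> seq 'I_b) : 'M[nat]_b :=
  \matrix_(i, j) count_mem j (phi [:: i]).

Definition spectral_radius (b : nat) (A : 'M[algC]_b) : algC :=
  \big[Num.max/0]_(z <- sval (closed_field_poly_normal (char_poly A))) `|z|.

Definition pisot_number (x : algC) : Prop :=
  [/\ x \is Num.real, x \in Aint, 1 < x &
      forall y, root (minCpoly x) y -> y != x -> `|y| < 1].

Definition pisot_morphism (b : nat) (phi : seq 'I_b -> seq 'I_b) : Prop :=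
  pisot_number
    (spectral_radius (map_mx (fun k : nat => k%:R : algC) (incidence_mx phi))).

Definition irreducible_morphism (b : nat) (phi : seq 'I_b -> seq 'I_b) : Prop :=
  irreducible_poly
    (char_poly (map_mx (fun k : nat => k%:R : rat) (incidence_mx phi))).

Definition irreducible_pisot (b : nat) (phi : seq 'I_b -> seq 'I_b) : Prop :=
  [/\ word_morphism phi, irreducible_morphism phi & pisot_morphism phi].

Definition omega_words (n : nat) : Type :=
  {ptws nat -> discrete_topology 'I_n.+1}.

HB.instance Definition _ (n : nat) := Topological.on (omega_words n).
HB.instance Definition _ (n : nat) :=
  isPointed.Build (omega_words n) (fun=> ord0).

Definition borel_words (n : nat) := g_sigma_algebraType (@open (omega_words n)).

HB.instance Definition _ (n : nat) := Measurable.on (borel_words n).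

Definition shift (n : nat) (x : borel_words n) : borel_words n :=
  fun i => x i.+1.

Definition orbit_closure (n : nat) (u : nat -> 'I_n.+1) :
    set (borel_words n) :=
  closure (range (fun k => (fun i => u (i + k)%N) : omega_words n)).

(* Probability measures on X are represented by those on the full shift that
   give mass 1 to the (closed) set X. *)
Definition invariant_probability (R : realType) (n : nat)
    (X : set (borel_words n)) (mu : probability (borel_words n) R) : Prop :=
  mu X = 1%E /\
  (forall A, measurable A -> mu (@shift n @^-1` A) = mu A).

Section ComplexL2.
Context (R : realType) (d : measure_display) (T : measurableType d).
Context (mu : {measure set T -> \bar R}) (D : set T).
Implicit Types f g : T -> R[i].

Definition sqr_mod (z : R[i]) : R := complex.Re z ^+ 2 + complex.Im z ^+ 2.

Definition L2 f : Prop :=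
  [/\ measurable_fun D (fun x => complex.Re (f x)),
      measurable_fun D (fun x => complex.Im (f x)) &
      (\int[mu]_(x in D) (sqr_mod (f x))%:E < +oo)%E].

Definition L2_inner f g : R[i] :=
  let h := fun x => f x * conjc (g x) in
  Complex (\int[mu]_(x in D) complex.Re (h x))%R
          (\int[mu]_(x in D) complex.Im (h x))%R.

(* An orthonormal family (indexed by itself) whose span is dense in L^2 *)
Definition hilbert_basis (E : set (T -> R[i])) : Prop :=
  [/\ forall f, E f -> L2 f,
      forall f, E f -> L2_inner f f = 1,
      forall f g, E f -> E g -> f <> g -> L2_inner f g = 0 &
      forall f (eps : R), L2 f -> 0 < eps ->
        exists k : nat, exists e : 'I_k -> (T -> R[i]), exists c : 'I_k -> R[i],
          (forall i, E (e i)) /\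
          (\int[mu]_(x in D)
             (sqr_mod (f x - \sum_(i < k) c i * e i x))%:E < eps%:E)%E].

Definition koopman_eigenvector (S : T -> T) f : Prop :=
  [/\ L2 f,
      ~ {ae mu, forall x, D x -> f x = 0} &
      exists lambda : R[i],
        {ae mu, forall x, D x -> f (S x) = lambda * f x}].

End ComplexL2.

(* The quantifier over mu is a definite description: X carries exactly one
   shift-invariant probability measure.  For u a fixed point of a primitive
   morphism, X depends on the morphism only. *)
Definition pure_discrete_spectrum (R : realType) (n : nat)
    (u : nat -> 'I_n.+1) : Prop :=
  let X := orbit_closure u in
  exists mu : probability (borel_words n) R,
    [/\ invariant_probability X mu,
        forall nu : probability (borel_words n) R,
          invariant_probability X nu ->
          forall A, measurable A -> nu A = mu A &
        exists E : set (borel_words n -> R[i]),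
          hilbert_basis mu X E /\
          (forall f, E f -> koopman_eigenvector mu X (@shift n) f)].

Definition pisot_conjecture (R : realType) : Prop :=
  forall (n : nat) (phi : seq 'I_n.+1 -> seq 'I_n.+1) (u : nat -> 'I_n.+1),
    irreducible_pisot phi -> fixed_point phi u -> pure_discrete_spectrum R u.

Definition nat_interval (A : set nat) : Prop :=
  A !=set0 /\ (forall a b c, A a -> A c -> (a <= b <= c)%N -> A b).

Definition set_lt (A B : set nat) : Prop :=
  forall a b, A a -> B b -> (a < b)%N.

(* For non-empty sets of integers the infimum is a minimum. *)
Definition set_dist (R : realType) (A B : set nat) : R :=
  inf [set x | exists a b : nat, [/\ A a, B b & x = `|a%:R - b%:R|]].

(* For finite, non-empty S; fset_set S is S as a finite set. *)
Definition den (R : realType) (S : set nat) : R :=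
  #|` fset_set S|%:R / (\max_(i <- fset_set S) i)%:R.

Definition vino (R : realType) (f g : nat -> R) : Prop :=
  exists (n0 : nat) (c1 : R),
    0 < c1 /\ (forall n, (n0 <= n)%N -> f n <= c1 * g n).

(* The same for families, with constants independent of the index j *)
Definition vino_unif (R : realType) (f g : nat -> nat -> R) : Prop :=
  exists (n0 : nat) (c1 : R),
    0 < c1 /\ (forall n j, (n0 <= n)%N -> f n j <= c1 * g n j).

Definition echoing (R : realType) (b : nat) (u : nat -> 'I_b) : Prop :=
  forall eps : R, 0 < eps ->
  exists (r s : nat -> nat) (I : nat -> nat -> set nat),
  [/\ forall n, (r n < s n)%N,
      forall n, [/\ forall j, nat_interval (I n j),
                    I n 0%N = [set 0%N] &
                    forall j, set_lt (I n j) (I n j.+1)],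
      forall n, [set i | u (i + s n)%N <> u (i + r n)%N]
                  `<=` \bigcup_(j in [set j | (1 <= j)%N]) I n j,
      exists N : nat, forall delta n, (N <= delta)%N -> (N <= n)%N ->
        den R (\bigcup_(j in [set j | (1 <= j <= delta)%N]) I n j) <= eps &
      [/\ forall n, (s n < s n.+1)%N,
          vino (fun n => (s n)%:R : R) (fun n => (s n)%:R - (r n)%:R) &
          vino_unif (fun n _ => (s n)%:R : R)
                    (fun n j => set_dist R (I n j) (I n j.+1))]].

(* Main.v *)
(* Let psi be a power of phi with positive incidence matrix.  Call i a coincidence
   of the pair p < q if u_(p+i) = u_(q+i) and u_p..u_(p+i-1), u_q..u_(q+i-1)
   contain every letter equally often.  Then psi^n maps aligned equal letters to
   aligned equal blocks, so with r_n = |psi^n(u_0..u_(p-1))| and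
   s_n = |psi^n(u_0..u_(q-1))| all mismatches lie in the psi^n-images of the runs of
   non-coincidences.  Hence u is echoing as soon as, for every e > 0, some pair has
   0 as a coincidence and non-coincidences of density at most e.

   Pure discrete spectrum: the Pisot property makes u balanced, so the letter counts
   of windows of length s differ from s times the frequencies by g (shift^s x) - g x
   for bounded measurable functions g.  Approximating g by combinations of
   eigenfunctions and choosing s with all the eigenvalues^s near 1, most windows of
   length s have the same letter counts, and the pair p, p + s works.

   Two letters: if the two letters had no strong coincidence, a maximal family of
   pairwise non-coincident strands (as in the Barge-Diamond argument) would propagate
   deterministically and a nonzero lattice vector would be a period of it,
   contradicting boundedness in the contracting direction together with the
   irrationality of the eigenvalue.  Now compare u with its shift by
   |psi^n(u_0..u_(q-1))| where u_q = u_0: the positions where the prefix counts agree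
   have bounded gaps for large n, since near-maxima of the contracting coordinate are
   relatively dense, and each application of a fixed power of psi turns a fixed
   proportion of every non-coincident block into coincidences. *)
From HB Require Import structures.
Require Import Defs.
From mathcomp Require Import all_boot all_order all_algebra all_field.
From mathcomp Require Import finmap.
From mathcomp Require Import all_classical all_reals all_analysis.
From mathcomp Require Import lebesgue_stieltjes_measure measurable_realfun.
From mathcomp Require Import complex zify ring lra.

Set Implicit Arguments.
Unset Strict Implicit.
Unset Printing Implicit Defensive.

Import Order.TTheory GRing.Theory Num.Theory.
Import numFieldNormedType.Exports.

(** * Words and morphisms *)

Section Words.
Variable b : nat.
Implicit Types (phi psi : seq 'I_b -> seq 'I_b) (u : nat -> 'I_b).
Implicit Types (v w : seq 'I_b) (a c : 'I_b).

(** The spectral hypotheses concern algebraic numbers in [algC], while frequencies, weights and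
    integrals live in an arbitrary complete real field [R]. Only statements about natural numbers
    cross between the two: balance of [u] and, for two letters, the signs of the characteristic
    polynomial at 1 and -1. In [R] the frequencies are rebuilt as suprema and the two eigenvalues by
    the quadratic formula. Primitivity is derived. It rests on Krylov vectors: since the
    characteristic polynomial is irreducible, the rows e_a A^k, k < b, are independent for every
    letter a. The same fact replaces irreducibility of a non-negative matrix in the proof that the
    spectral radius is an eigenvalue. Contraction is recorded as a bound on the partial sums of |A^k
    v|. This form passes from one root of an annihilating polynomial to the next, and it is what the
    expansion of a prefix of [u] into images of short words consumes. *)

Definition subword u i n : seq 'I_b := mkseq (fun k => u (i + k)) n.

Lemma size_subword u i n : size (subword u i n) = n.
Proof. by rewrite size_mkseq. Qed.

Lemma nth_subword u x0 i n k : k < n -> nth x0 (subword u i n) k = u (i + k).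
Proof. by move=> kn; rewrite nth_mkseq. Qed.

Lemma subwordD u i m n : subword u i (m + n) = subword u i m ++ subword u (i + m) n.
Proof.
apply: (@eq_from_nth _ (u 0)); first by rewrite size_cat !size_subword.
move=> k; rewrite size_subword => kmn; rewrite nth_cat size_subword nth_subword//.
case: ltnP => km; first by rewrite nth_subword.
by rewrite nth_subword; [congr u; lia | lia].
Qed.

Lemma subword1 u i : subword u i 1 = [:: u i].
Proof. by rewrite /subword /mkseq /= addn0. Qed.

Lemma subwordS u i n : subword u i n.+1 = rcons (subword u i n) (u (i + n)).
Proof. by rewrite -addn1 subwordD subword1 cats1. Qed.

Lemma take_subword u i m n : m <= n -> take m (subword u i n) = subword u i m.
Proof. by move=> mn; rewrite -(subnKC mn) subwordD take_size_cat ?size_subword. Qed.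

Lemma mem_subwordP u i n a :
  reflect (exists2 k, k < n & u (i + k) = a) (a \in subword u i n).
Proof.
apply: (iffP mapP) => [[k]|[k kn <-]].
  by rewrite mem_iota add0n /= => kn ->; exists k.
by exists k => //; rewrite mem_iota.
Qed.

Section Morphism.
Variable phi : seq 'I_b -> seq 'I_b.
Hypothesis phiM : word_morphism phi.

Lemma morphism_cat v w : phi (v ++ w) = phi v ++ phi w.
Proof. by case: phiM. Qed.

Lemma morphism_nil : phi [::] = [::].
Proof.
have := morphism_cat [::] [::]; rewrite cats0 => /(congr1 size).
by rewrite size_cat => /eqP; rewrite -[X in X == _]addn0 eqn_add2l => /eqP/esym/size0nil.
Qed.

Lemma morphism_flatten w : phi w = flatten [seq phi [:: a] | a <- w].
Proof.
elim: w => [|a w IH] /=; first exact: morphism_nil.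
by rewrite -cat1s morphism_cat IH.
Qed.

Lemma size_morphism w : size (phi w) = \sum_(a <- w) size (phi [:: a]).
Proof. by rewrite morphism_flatten size_flatten /shape -map_comp sumnE big_map. Qed.

Lemma size_morphism_gt0 a : 0 < size (phi [:: a]).
Proof. by case: phiM => _ /(_ [:: a] isT); rewrite lt0n size_eq0. Qed.

Lemma size_morphism_ge w : size w <= size (phi w).
Proof.
rewrite size_morphism -sum1_size; apply: leq_sum => a _; exact: size_morphism_gt0.
Qed.

Lemma perm_morphism v w : perm_eq v w -> perm_eq (phi v) (phi w).
Proof.
by move=> vw; rewrite !morphism_flatten; apply/perm_flatten/perm_map.
Qed.

End Morphism.

Lemma word_morphism_iter phi n : word_morphism phi -> word_morphism (iter n phi).
Proof.
move=> phiM; elim: n => [|n [IHm IHn]]; first by split.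
split; first by move=> v w /=; rewrite IHm morphism_cat.
by move=> w /IHn; case: phiM => _; apply.
Qed.

(** The fixed-point equation on finite prefixes, a form that passes to iterates of [phi] by
    composition. *)
Definition prefix_stable phi u :=
  forall n, phi (subword u 0 n) = subword u 0 (size (phi (subword u 0 n))).

(** Letter [k] is read off [phi] of the prefix of length [k.+1]. Of this prefix and the one of
    length [n], one extends the other, and both images reach beyond [k]. *)
Lemma fixed_point_stable phi u :
  word_morphism phi -> fixed_point phi u -> prefix_stable phi u.
Proof.
move=> phiM fix_u n; set m := size _.
apply: (@eq_from_nth _ (u 0)); first by rewrite size_subword.
move=> k; rewrite -/m => km; rewrite nth_subword// add0n.
have := congr1 (@^~ k) fix_u; rewrite /infinite_image => <-.
have -> : mkseq u k.+1 = subword u 0 k.+1 by [].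
have ks : k < size (phi (subword u 0 k.+1)).
  by apply: leq_trans (size_morphism_ge phiM _); rewrite size_subword.
have [nk|kn] := leqP n k.+1.
  by rewrite -(subnKC nk) subwordD (morphism_cat phiM) nth_cat -/m km.
by rewrite -(subnKC (ltnW kn)) subwordD morphism_cat// nth_cat ks.
Qed.

Lemma prefix_stable_iter phi u n :
  prefix_stable phi u -> prefix_stable (iter n phi) u.
Proof.
move=> st; elim: n => [|n IH] m /=; first by rewrite size_subword.
by rewrite IH; exact: st.
Qed.

Lemma morphism_subword phi u p n : word_morphism phi -> prefix_stable phi u ->
  phi (subword u p n) =
  subword u (size (phi (subword u 0 p))) (size (phi (subword u p n))).
Proof.
move=> phiM st; have := st (p + n).
rewrite subwordD add0n morphism_cat// size_cat subwordD add0n -st.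
by move=> /eqP; rewrite eqseq_cat// eqxx => /eqP.
Qed.

End Words.

(** * Echoes from coincidences *)

Section Lengths.
Variable b : nat.
Implicit Types (phi psi : seq 'I_b -> seq 'I_b) (u : nat -> 'I_b).
Implicit Types (v w : seq 'I_b) (a c : 'I_b).

Lemma size_morphism_le phi w (L : nat) : word_morphism phi ->
  (forall a, size (phi [:: a]) <= L) -> size (phi w) <= L * size w.
Proof.
move=> phiM le_L; rewrite size_morphism// -(sum1_size w) big_distrr /=.
by apply: leq_sum => a _; rewrite muln1.
Qed.

Lemma size_morphism_lb phi w (L : nat) : word_morphism phi ->
  (forall a, L <= size (phi [:: a])) -> L * size w <= size (phi w).
Proof.
move=> phiM le_L; rewrite size_morphism// -(sum1_size w) big_distrr /=.
by apply: leq_sum => a _; rewrite muln1.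
Qed.

Lemma size_morphism_mem phi w a : word_morphism phi -> a \in w ->
  size (phi [:: a]) <= size (phi w).
Proof.
move=> phiM aw; rewrite (size_morphism phiM w) (big_rem a)//=; exact: leq_addr.
Qed.

(** [iter n psi [:: c]] is a block of [iter n psi (psi [:: a])], which is [psi (iter n psi [:: a])],
    and one application of [psi] lengthens a word at most [L] times. This comparison, uniform in
    [n], turns counts of indices into lengths. *)
Lemma bounded_ratio psi : word_morphism psi ->
  (forall a c, c \in psi [:: a]) ->
  exists2 L : nat, 0 < L & forall n a c,
    size (iter n psi [:: c]) <= L * size (iter n psi [:: a]).
Proof.
move=> psiM pos; pose L := maxn 1 (\max_a size (psi [:: a])).
have leL a : size (psi [:: a]) <= L.
  by rewrite leq_max (leq_bigmax (F := fun a => size (psi [:: a])) a) orbT.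
exists L => [|n a c]; first by rewrite leq_max.
apply: (@leq_trans (size (psi (iter n psi [:: a])))); last first.
  exact: size_morphism_le.
rewrite -iterS iterSr; apply: size_morphism_mem (pos a c).
exact: word_morphism_iter.
Qed.

Lemma size_iter_lt psi n w : word_morphism psi ->
  (forall a, 1 < size (psi [:: a])) -> 0 < size w ->
  size (iter n psi w) < size (iter n.+1 psi w).
Proof.
move=> psiM long w0; have iM := word_morphism_iter n psiM.
have := size_morphism_lb (iter n psi w) psiM long.
have := size_morphism_ge iM w; rewrite /=; lia.
Qed.

End Lengths.

Section Runs.
Variable bad : pred nat.
Hypothesis bad_inf : forall m, exists k, (m <= k) && bad k.
Hypothesis good_inf : forall m, exists k, (m <= k) && ~~ bad k.
Hypothesis good0 : ~~ bad 0.

(** From a good index pass to the next bad one, then to the next good one. Each run starts at some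
    [c j.+1] and is closed by the good index [d j.+1]. *)
Lemma bad_runs : exists c d : nat -> nat,
  [/\ d 0 = 0, (forall j, d j < c j.+1 < d j.+1),
      (forall j, ~~ bad (d j)),
      (forall j k, c j.+1 <= k < d j.+1 -> bad k) &
      (forall k, bad k -> exists j, c j.+1 <= k < d j.+1)].
Proof.
pose nb m := ex_minn (bad_inf m); pose ng m := ex_minn (good_inf m).
pose d j := iter j (fun m => ng (nb m)) 0; pose c j := nb (d j.-1).
have dS j : d j.+1 = ng (c j.+1) by [].
have cP j : [/\ d j <= c j.+1, bad (c j.+1) &
    forall k, d j <= k -> bad k -> c j.+1 <= k].
  rewrite /c /nb /=; case: ex_minnP => m /andP[? ?] h; split => // k dk bk.
  by apply: h; rewrite dk.
have dP j : [/\ c j.+1 <= d j.+1, ~~ bad (d j.+1) &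
    forall k, c j.+1 <= k < d j.+1 -> bad k].
  rewrite dS /ng; case: ex_minnP => m /andP[? ?] h; split => // k /andP[ck km].
  by apply: contraLR km => nb_k; rewrite -leqNgt h// ck.
have gd j : ~~ bad (d j) by case: j => [//|j]; case: (dP j).
have lt_dcd j : d j < c j.+1 < d j.+1.
  have [dc bc _] := cP j; have [cd bd _] := dP j.
  rewrite !ltn_neqAle dc cd !andbT; apply/andP; split.
    by apply: contraNneq (gd j) => ->.
  by apply: contraNneq bd => <-.
exists c, d; split => //.
  by move=> j k h; case: (dP j) => _ _; apply.
have le_jd j : j <= d j by elim: j => // j IH; have := lt_dcd j; lia.
move=> k bk; have ex : exists j, k < d j by exists k.+1; exact: le_jd.
case: (ex_minnP ex) => -[//|j] kd h; exists j; rewrite kd andbT.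
have [_ _] := cP j; apply => //; rewrite leqNgt; apply/negP => kdj.
by have := h _ kdj; rewrite ltnn.
Qed.

End Runs.

Lemma count_multiples K N :
  0 < K -> count (fun k => (0 < k) && (K %| k)) (iota 0 N.+1) = N %/ K.
Proof.
move=> K0; elim: N => [|N IH]; first by rewrite div0n.
by rewrite -(addn1 N.+1) iotaD count_cat IH /= add0n addn0 divnS// addnC.
Qed.

Definition coincident b (u : nat -> 'I_b) p q i :=
  (u (p + i) == u (q + i)) && perm_eq (subword u p i) (subword u q i).

Section Echo.
Variables (R : realType) (b : nat) (psi : seq 'I_b -> seq 'I_b).
Variable u : nat -> 'I_b.
Hypothesis psiM : word_morphism psi.
Hypothesis psi_u : prefix_stable psi u.
Hypothesis psi_pos : forall a c, c \in psi [:: a].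
Hypothesis psi_long : forall a, 1 < size (psi [:: a]).

Local Open Scope classical_set_scope.

(** Position [i] falls into the block of one letter [u (p + k)]. If [k] is a coincidence, equal
    counts before it put the two image blocks at the same offset, and equal letters make these
    blocks equal words. *)
Lemma mismatch_in_image p q n i :
  u (i + size (iter n psi (subword u 0 q))) <>
    u (i + size (iter n psi (subword u 0 p))) ->
  exists2 k, ~~ coincident u p q k &
    size (iter n psi (subword u p k)) <= i < size (iter n psi (subword u p k.+1)).
Proof.
have iM := word_morphism_iter n psiM; have ist := prefix_stable_iter n psi_u.
pose o k := size (iter n psi (subword u p k)).
have oS k : o k.+1 = o k + size (iter n psi [:: u (p + k)]).
  by rewrite /o subwordS -cats1 (morphism_cat iM) size_cat.
have ex : exists k, i < o k.
  exists i.+1; apply: leq_trans (size_morphism_ge iM _).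
  by rewrite size_subword.
case: (ex_minnP ex) => -[|k]; first by rewrite /o /subword /= (morphism_nil iM).
move=> ik h ne; have ki : o k <= i.
  by rewrite leqNgt; apply/negP => /h; rewrite ltnn.
exists k; last by rewrite -/(o k) ki.
apply/negP => /andP[/eqP eqk pk]; apply: ne.
have eqo : size (iter n psi (subword u q k)) = o k.
  by apply/esym/perm_size; apply: perm_morphism.
pose t := i - o k; have ti : i = o k + t by rewrite /t subnKC.
have tl : t < size (iter n psi [:: u (p + k)]) by rewrite /t; move: ik; rewrite oS; lia.
have val (x : nat) : u (x + k) = u (p + k) -> size (iter n psi (subword u x k)) = o k ->
    u (i + size (iter n psi (subword u 0 x))) = nth (u 0) (iter n psi [:: u (p + k)]) t.
  move=> ex' ox; have := morphism_subword (x + k) 1 iM ist.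
  rewrite subword1 ex' => ->; rewrite nth_subword// subwordD.
  by rewrite (morphism_cat iM) size_cat add0n ox; congr u; rewrite ti; lia.
by rewrite !val.
Qed.

(** A covering list bounds the cardinal in [den] from above, and any element [m] of [S] bounds the
    maximum from below. *)
Lemma den_bound (S : set nat) (s : seq nat) (m : nat) (e : R) :
  (forall x, S x -> x \in s) -> S m -> (0 < m)%N ->
  ((size s)%:R <= e * m%:R)%R -> (den R S <= e)%R.
Proof.
move=> Ss Sm m0 le_s; rewrite /den.
have finS : finite_set S.
  by apply: (sub_finite_set _ (finite_seq s)) => x; exact: Ss.
have cardS : #|` fset_set S| <= size s.
  apply: (@leq_trans #|` [fset x in s]%fset|).
    apply: fsubset_leq_card; apply/fsubsetP => x.
    by rewrite in_fset_set// inE => /Ss; rewrite inE.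
  by rewrite card_fseq size_undup.
have maxS : m <= \max_(i <- fset_set S) i.
  have mS : m \in (fset_set S : seq nat) by rewrite in_fset_set// inE.
  exact: (@leq_bigmax_seq _ _ xpredT id _ mS isT).
have M0 : (0 < (\max_(i <- fset_set S) i)%:R :> R)%R.
  by rewrite ltr0n; apply: leq_trans maxS.
have e0 : (0 <= e)%R.
  have : (0 <= e * m%:R)%R by apply: le_trans le_s; exact: ler0n.
  by rewrite pmulr_lge0// ltr0n.
rewrite ler_pdivrMr//; apply: (le_trans (y := (size s)%:R)%R).
  by rewrite ler_nat.
by apply: (le_trans le_s); rewrite ler_wpM2l// ler_nat.
Qed.

Lemma echoing_of_coincidences :
  (forall e : R, (0 < e)%R -> exists p q, [/\ p < q, coincident u p q 0 &
     exists N0, forall N, N0 <= N ->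
       ((count (fun i => ~~ coincident u p q i) (iota 0 N))%:R <= e * N%:R)%R]) ->
  echoing R u.
Proof.
move=> H eps eps0; have [L L0 ratio] := bounded_ratio psiM psi_pos.
(* Passing from indices to lengths costs one factor [L] for the total length of the bad blocks and
   another for the length of the prefix; the 2 pays for the maximum being [(o n N).-1]. The cap 1/2
   ensures that good indices never die out. *)
pose e : R := (Num.min (eps / (2 * L%:R ^+ 2)) 2^-1)%R.
have LR0 : (0 < L%:R :> R)%R by rewrite ltr0n.
have e0 : (0 < e)%R.
  by rewrite lt_min invr_gt0 ltr0n andbT divr_gt0// mulr_gt0// exprn_gt0.
have [p [q [pq co0 [N0 dens]]]] := H (e / 2)%R (divr_gt0 e0 (ltr0n _ 2)).
have [K K0 leK] : exists2 K : nat, 0 < K & (1 <= e / 2 * K%:R)%R.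
  have [K hK] : exists K : nat, (2 / e <= K%:R)%R.
    exists (Num.bound (2 / e)); apply/ltW/archi_boundP.
    by rewrite divr_ge0// ltW.
  exists K; first by rewrite -(ltr0n R); apply: lt_le_trans hK; rewrite divr_gt0.
  by move: hK; rewrite ler_pdivrMr// => hK; rewrite mulrAC ler_pdivlMr// mul1r mulrC.
(* The positive multiples of [K], of density at most [e / 2], are declared bad so that there are
   infinitely many runs even if almost all indices are coincidences. Index 0 stays good. *)
pose bad k := (0 < k) && (~~ coincident u p q k || (K %| k)).
have bad_dens N : N0 <= N -> ((count bad (iota 0 N))%:R <= e * N%:R)%R.
  move=> N0N; set y := (count (fun i => ~~ coincident u p q i) (iota 0 N) +
    count (fun k => (0 < k) && (K %| k)) (iota 0 N))%N.
  apply: (@le_trans _ R y%:R%R).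
    rewrite ler_nat /y -count_predUI.
    apply: leq_trans (leq_addr _ _); apply: sub_count => k /andP[k0].
    by rewrite /= k0.
  rewrite {}/y natrD [X in (_ <= X * _)%R](splitr e) mulrDl lerD// ?dens//.
  case: N {N0N} => [|N]; first by rewrite mulr0.
  rewrite count_multiples//; apply: (@le_trans _ R (e / 2 * K%:R * (N %/ K)%:R)%R).
    by rewrite ler_peMl.
  rewrite -mulrA ler_wpM2l ?divr_ge0 ?(ltW e0)// -natrM ler_nat mulnC.
  by apply: leq_trans (leq_trunc_div _ _) _.
have bad_inf m : exists k, (m <= k) && bad k.
  exists (m.+1 * K); rewrite /bad dvdn_mull// orbT andbT muln_gt0 K0 /= andbT.
  by apply: leq_trans (leqnSn m) _; rewrite leq_pmulr.
have good_inf m : exists k, (m <= k) && ~~ bad k.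
  apply: contrapT => /forallNP allbad.
  (* If every index from [m] on were bad, the [N - m] bad ones would be more than half of the first
     [N]. *)
  pose N := (N0 + m.*2.+1)%N.
  have : N - m <= count bad (iota 0 N).
    have -> : iota 0 N = iota 0 m ++ iota m (N - m).
      by rewrite -iotaD subnKC// /N; lia.
    rewrite count_cat; apply: leq_trans (leq_addl _ _).
    rewrite -[X in X <= _](size_iota m) -(@eq_in_count _ predT) ?count_predT//.
    move=> k; rewrite mem_iota => /andP[mk _]; have := allbad k.
    by rewrite mk /= => /negP/negPn ->.
  rewrite -(ler_nat R) => h; have := le_trans h (bad_dens N (leq_addr _ _)).
  apply/negP; rewrite -ltNge.
  have e2 : (e <= 2^-1)%R by rewrite ge_min lexx orbT.
  apply: (@le_lt_trans _ R (2^-1 * N%:R)%R); first by rewrite ler_wpM2r.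
  rewrite natrB; last by rewrite /N; lia.
  rewrite /N natrD -addnn -[(m + m).+1]addn1 !natrD; have : (0 <= N0%:R :> R)%R by [].
  lra.
have [c [d [d0 dcd good_d bad_cd cover]]] := bad_runs bad_inf good_inf isT.
pose l n k := size (iter n psi [:: u (p + k)]).
pose o n k := size (iter n psi (subword u p k)).
have oS n k : o n k.+1 = o n k + l n k.
  by rewrite /o subwordS -cats1 (morphism_cat (word_morphism_iter n psiM)) size_cat.
have l0 n k : 0 < l n k by exact: size_morphism_gt0 (word_morphism_iter n psiM) _.
have o_ge n k : k <= o n k.
  by rewrite -{1}(size_subword u p k); apply: size_morphism_ge (word_morphism_iter n psiM) _.
have o_mono n i j : i <= j -> o n i <= o n j.
  by move=> /subnKC <-; elim: (j - i) => [|m IH]; rewrite ?addn0// addnS oS; lia.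
pose r n := size (iter n psi (subword u 0 p)).
pose s n := size (iter n psi (subword u 0 q)).
have s_ratio n a : s n <= q * L * size (iter n psi [:: a]).
  rewrite -mulnA mulnC -[X in _ <= _ * X](size_subword u 0 q).
  by apply: size_morphism_le => [|a']; [exact: word_morphism_iter|exact: ratio].
have srn n : s n = r n + size (iter n psi (subword u p (q - p))).
  rewrite /s -{1}(subnKC (ltnW pq)) subwordD add0n.
  by rewrite (morphism_cat (word_morphism_iter n psiM)) size_cat.
have srl n : r n + l n 0 <= s n.
  rewrite srn leq_add2l /l addn0; apply: size_morphism_mem.
    exact: word_morphism_iter.
  by apply/mem_subwordP; exists 0; rewrite ?addn0// subn_gt0.
have q0 : 0 < q by apply: leq_ltn_trans pq.
have qL0 : (0 < (q * L)%:R :> R)%R by rewrite ltr0n muln_gt0 q0.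
(* Beyond [{0}], each interval is the union of the image blocks of one run. *)
pose I n j : set nat := if j is 0 then [set 0] else
  [set x | o n (c j) <= x < o n (d j)].
exists r, s, I; split.
- by move=> n; have := srl n; have := l0 n 0; lia.
- move=> n; split => //.
  + move=> [|j]; first by split; [exists 0|move=> ? ? ? -> -> ?; rewrite /=; lia].
    split; last by rewrite /= => x y z; lia.
    have /andP[_ cd] := dcd j; exists (o n (c j.+1)); rewrite /= leqnn /=.
    by have := o_mono n _ _ cd; rewrite oS; have := l0 n (c j.+1); lia.
  + move=> [|j] x y.
      move=> -> /= /andP[+ _]; have := o_ge n (c 1); have := dcd 0.
      by rewrite d0; lia.
    move=> /= /andP[_ h1] /andP[h2 _].
    by have := dcd j.+1 => /andP[h3 _]; have := o_mono n _ _ (ltnW h3); lia.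
- move=> n i /= ne; have [k nk /andP[k1 k2]] := mismatch_in_image ne.
  have badk : bad k.
    rewrite /bad nk /= andbT lt0n; apply/negP => /eqP k0.
    by move: nk; rewrite k0 co0.
  have [j /andP[jk kj]] := cover _ badk; exists j.+1 => //=.
  by have := o_mono n _ _ jk; have := o_mono n _ _ kj; rewrite -/(o n k) -/(o n k.+1) in k1 k2; lia.
- exists (N0 + 2)%N => delta n ledelta _.
  have le_jd j : j <= d j by elim: j => // j IH; have := dcd j; lia.
  have d_mono i j : i <= j -> d i <= d j.
    by move=> /subnKC <-; elim: (j - i) => [|m IH]; rewrite ?addn0// addnS; have := dcd (i + m)%N; lia.
  set N := d delta; have Nd : delta <= N by exact: le_jd.
  have oN2 : 2 <= o n N by apply: leq_trans (o_ge _ _); lia.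
  (* The bad blocks before the index [N = d delta] cover the first [delta] intervals, and the last
     position before [o n N] belongs to the last of these. *)
  pose cov := flatten [seq iota (o n k) (l n k) | k <- iota 0 N & bad k].
  apply: (@den_bound _ cov (o n N).-1).
  + move=> x [[|j] //= jd] /andP[cx xd].
    have ex : exists k, x < o n k by exists (d j.+1).
    case: (ex_minnP ex) => -[|k] xk h; first by move: xk; rewrite /o /subword /= (morphism_nil (word_morphism_iter n psiM)).
    have kx : o n k <= x by rewrite leqNgt; apply/negP => /h; rewrite ltnn.
    have kd : k < d j.+1 by exact: h.
    have ck : c j.+1 <= k by rewrite leqNgt; apply/negP => /(o_mono n); lia.
    apply/flattenP; exists (iota (o n k) (l n k)); last first.
      by rewrite mem_iota kx -oS.
    apply: map_f; rewrite mem_filter mem_iota /= add0n (bad_cd j) ?ck//=.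
    by apply: leq_trans kd (d_mono _ _ jd).
  + exists delta; first by rewrite /= leqnn andbT; lia.
    case: delta @N ledelta Nd oN2 @cov => [|j] N ledelta Nd oN2 cov; first by lia.
    have /andP[_ cd] := dcd j; rewrite /I /=.
    have := o_mono n _ _ cd; rewrite oS -/N; have := l0 n (c j.+1); lia.
  + by lia.
  + have szcov : size cov <= count bad (iota 0 N) * (L * l n 0).
      rewrite size_flatten /shape -map_comp sumnE big_map big_filter.
      rewrite -sum1_count big_distrl /=; apply: leq_sum => k _.
      by rewrite size_iota mul1n; apply: ratio.
    have oN : N * l n 0 <= L * o n N.
      have : forall M, M * l n 0 <= L * o n M.
        elim=> [|M IH]; first by rewrite mul0n.
        by rewrite oS mulnDr mulSn addnC; apply: leq_add => //; exact: ratio.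
      exact.
    apply: (le_trans (y := (count bad (iota 0 N) * (L * l n 0))%:R%R)); first by rewrite ler_nat.
    have hN0 : N0 <= N by lia.
    have := bad_dens N hN0 => hb; rewrite natrM.
    apply: (@le_trans _ R (e * N%:R * (L * l n 0)%:R)%R); first by rewrite ler_wpM2r.
    have -> : (e * N%:R * (L * l n 0)%:R = e * (L * (N * l n 0))%:R)%R.
      by rewrite !natrM; ring.
    apply: (@le_trans _ R (e * (L * (L * o n N))%:R)%R).
      by rewrite ler_wpM2l ?(ltW e0)// ler_nat leq_mul2l oN orbT.
    have ee : (e <= eps / (2 * L%:R ^+ 2))%R by rewrite ge_min lexx.
    apply: (@le_trans _ R (eps / (2 * L%:R ^+ 2) * (L * (L * o n N))%:R)%R).
      by rewrite ler_wpM2r.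
    rewrite !natrM.
    have -> : (eps / (2 * L%:R ^+ 2) * (L%:R * (L%:R * (o n N)%:R)) = eps * ((o n N)%:R / 2))%R.
      by field; rewrite gt_eqF.
    rewrite ler_wpM2l ?(ltW eps0)// ler_pdivrMr// -natrM ler_nat; lia.
- split.
  + by move=> n; apply: size_iter_lt => //; rewrite size_subword.
  + exists 0, (q * L)%:R%R; split => // n _.
    rewrite -natrB; last by have := srl n; lia.
    rewrite -natrM ler_nat; apply: leq_trans (s_ratio n (u (p + 0))) _.
    by rewrite leq_mul2l; apply/orP; right; have := srl n; rewrite /l; lia.
  (* The whole block of the good index [d j] separates two consecutive intervals, and [q * L] times
     the length of any block is at least [s n]. *)
  + exists 0, (q * L)%:R%R; split => // n j _.
    apply: (@le_trans _ R ((q * L)%:R * (l n (d j))%:R)%R).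
      by rewrite -natrM ler_nat; exact: s_ratio.
    rewrite ler_wpM2l//; apply: lb_le_inf.
      have /andP[_ cd] := dcd j.
      have x1 : I n j.+1 (o n (c j.+1)).
        rewrite /I /= leqnn /=; have := o_mono n _ _ cd; rewrite oS.
        by have := l0 n (c j.+1); lia.
      have [x0 x0I] : exists x, I n j x.
        case: j {cd x1} => [|j]; first by exists 0.
        exists (o n (c j.+1)); have /andP[_ cd] := dcd j.
        rewrite /I /= leqnn /=; have := o_mono n _ _ cd; rewrite oS.
        by have := l0 n (c j.+1); lia.
      by eexists; exists x0, (o n (c j.+1)).
    move=> _ [x [y [xI yI ->]]].
    have xd : x <= o n (d j).
      by case: j xI {yI} => [/= ->//|j] /= /andP[_ /ltnW].
    have yd : o n (d j) + l n (d j) <= y.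
      have /andP[dc _] := dcd j; have := o_mono n _ _ dc; rewrite oS.
      by move: yI => /= /andP[]; lia.
    rewrite distrC ger0_norm; last by rewrite subr_ge0 ler_nat; lia.
    by rewrite -natrB ?ler_nat; lia.
Qed.

End Echo.

(** * Balanced words, recurrence and upper densities of windows *)

Definition balanced b (u : nat -> 'I_b) (C : nat) := forall i j m a,
  count_mem a (subword u i m) <= count_mem a (subword u j m) + C.

Section Frequency.
Variables (R : realType) (b : nat) (u : nat -> 'I_b) (C : nat).
Hypothesis bal : balanced u C.

Lemma balanced_blocks a i j m k :
  count_mem a (subword u i (k * m)) <= k * (count_mem a (subword u j m) + C) /\
  k * count_mem a (subword u j m) <= count_mem a (subword u i (k * m)) + k * C.
Proof.
elim: k => [//|k [IH1 IH2]]; rewrite mulSn addnC subwordD count_cat.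
have := bal (i + k * m) j m a; have := bal j (i + k * m) m a; lia.
Qed.

Local Open Scope ring_scope.

(** A window of length m m', cut into blocks of length m or of length m', shows that every (count -
    C) / m is at most every (count + C) / m'. The supremum of the former lies below all of the
    latter, so the constant [C] is kept. *)
Lemma balanced_frequency : exists f : 'I_b -> R, forall a i m,
  `|(count_mem a (subword u i m))%:R - m%:R * f a| <= C%:R.
Proof.
pose c a i m := count_mem a (subword u i m).
pose A a := [set x : R | exists i m, (0 < m)%N /\ x = ((c a i m)%:R - C%:R) / m%:R]%classic.
have ubA a j m : (0 < m)%N -> ubound (A a) (((c a j m)%:R + C%:R) / m%:R).
  move=> m0 _ [i [m' [m'0 ->]]].
  rewrite ler_pdivrMr ?ltr0n// mulrAC ler_pdivlMr ?ltr0n//.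
  have [h1 _] := balanced_blocks a 0 j m m'.
  have [_ h2] := balanced_blocks a 0 i m' m.
  rewrite -natrD mulrBl -!natrM lerBlDr -natrD ler_nat -/(c a j m).
  move: h1 h2; rewrite [(m * m')%N]mulnC -/(c a j m) -/(c a i m'); nia.
have supA a : has_sup (A a).
  split; first by exists (((c a 0 1)%:R - C%:R) / 1%:R), 0%N, 1%N.
  by exists (((c a 0 1)%:R + C%:R) / 1%:R); exact: ubA.
exists (fun a => sup (A a)) => a i m.
have [->|m0] := posnP m.
  by rewrite mul0r subr0 /= normr0 ler0n.
have h1 : ((c a i m)%:R - C%:R) / m%:R <= sup (A a).
  by apply: ub_le_sup; [case: (supA a)|exists i, m].
have h2 : sup (A a) <= ((c a i m)%:R + C%:R) / m%:R.
  by apply: ge_sup; [case: (supA a)|exact: ubA].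
rewrite ler_pdivrMr ?ltr0n// in h1; rewrite ler_pdivlMr ?ltr0n// in h2.
rewrite -/(c a i m) ler_norml; move: h1 h2; rewrite mulrC; lra.
Qed.

End Frequency.

Section Recurrence.
Variables (b : nat) (psi : seq 'I_b -> seq 'I_b) (u : nat -> 'I_b).
Hypothesis psiM : word_morphism psi.
Hypothesis psi_u : prefix_stable psi u.

(** For a word fixed by [psi], the position where the block [iter m psi [:: u j]] begins. *)
Definition image_pos m j := size (iter m psi (subword u 0 j)).

Lemma image_posS m j :
  image_pos m j.+1 = image_pos m j + size (iter m psi [:: u j]).
Proof.
by rewrite /image_pos subwordS -cats1 (morphism_cat (word_morphism_iter m psiM)) size_cat.
Qed.

Lemma image_pos_ge m j : j <= image_pos m j.
Proof.
rewrite -{1}(size_subword u 0 j).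
exact: size_morphism_ge (word_morphism_iter m psiM) _.
Qed.

Lemma image_pos_mono m i j : i <= j -> image_pos m i <= image_pos m j.
Proof.
move=> /subnKC <-; elim: (j - i) => [|k IH]; rewrite ?addn0// addnS image_posS; lia.
Qed.

Lemma image_blockE m j :
  iter m psi [:: u j] = subword u (image_pos m j) (size (iter m psi [:: u j])).
Proof.
have := morphism_subword j 1 (word_morphism_iter m psiM) (prefix_stable_iter m psi_u).
by rewrite subword1.
Qed.

Lemma next_block m k (L : nat) : (forall a, size (iter m psi [:: a]) <= L) ->
  exists j, k <= image_pos m j <= k + L.
Proof.
move=> leL; have ex : exists j, k <= image_pos m j by exists k; exact: image_pos_ge.
case: (ex_minnP ex) => -[|j] kj h.
  exists 0; rewrite kj /=; rewrite /image_pos /subword /=.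
  by rewrite (morphism_nil (word_morphism_iter m psiM)).
exists j.+1; rewrite kj /= image_posS; apply: leq_add (leL _).
by rewrite leqNgt; apply/negP => /ltnW /h; rewrite ltnn.
Qed.

(** Every block [psi [:: u j]] contains all letters; some block starts within distance [L] of [k]
    and ends within another [L]. *)
Lemma uniform_recurrence : (forall a c, c \in psi [:: a]) ->
  exists K, forall k a, exists2 j, k <= j < k + K & u j = a.
Proof.
move=> pos; pose L := \max_a size (psi [:: a]).
have leL a : size (iter 1 psi [:: a]) <= L.
  exact: (leq_bigmax (F := fun a => size (psi [:: a])) a).
exists (L + L) => k a; have [j /andP[kj jk]] := next_block k leL.
have := pos (u j) a; rewrite -[psi _]/(iter 1 psi _) (image_blockE 1 j) => /mem_subwordP[t tl ua].
by exists (image_pos 1 j + t) => //; have := leL (u j); lia.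
Qed.

End Recurrence.

Lemma drop_subword b (u : nat -> 'I_b) i n t :
  drop t (subword u i n) = subword u (i + t) (n - t).
Proof.
have [tn|nt] := leqP t n.
  by rewrite -{1}(subnKC tn) subwordD drop_size_cat ?size_subword.
rewrite drop_oversize ?size_subword 1?ltnW//.
by have -> : n - t = 0 by lia.
Qed.

(** The window of length s + i at p splits as s, i and as i, s; removing parts with equal counts
    leaves parts with equal counts. With the next lemma, this turns equal counts in windows of
    length [s] into coincidences of the pair [p], [p + s]. *)
Lemma perm_subword_shift b (u : nat -> 'I_b) p s i :
  perm_eq (subword u p s) (subword u (p + i) s) ->
  perm_eq (subword u p i) (subword u (p + s) i).
Proof.
move=> /permP e; apply/permP => P; have := congr1 (count P) (subwordD u p s i).
by rewrite (addnC s i) subwordD !count_cat e addnC => /eqP; rewrite eqn_add2l => /eqP.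
Qed.

Lemma letter_subword_shift b (u : nat -> 'I_b) i s :
  perm_eq (subword u i s) (subword u i.+1 s) -> u i = u (i + s).
Proof.
move=> /permP/(_ (pred1 (u i))) e.
have := congr1 (count_mem (u i)) (subwordS u i s).
rewrite -[s.+1]add1n subwordD subword1 addn1 -cats1 !count_cat /= eqxx e addn0 addnC.
by move/eqP; rewrite eqn_add2l addn0; case: (u (i + s) =P u i) => [->|].
Qed.

Section Density.
Variables (R : realType) (b : nat) (psi : seq 'I_b -> seq 'I_b) (u : nat -> 'I_b).
Hypothesis psiM : word_morphism psi.
Hypothesis psi_u : prefix_stable psi u.
Hypothesis psi_pos : forall a c, c \in psi [:: a].
Hypothesis psi_long : forall a, 1 < size (psi [:: a]).

Lemma size_iter_ge m a : m < size (iter m psi [:: a]).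
Proof.
elim: m => // m IH; apply: leq_ltn_trans IH _.
exact: size_iter_lt.
Qed.

(* A factor property that is rare in arbitrarily long windows is rare in every
   image of a letter, hence rare along the whole word. *)
Lemma upper_density_of_windows : exists2 A : nat, 0 < A &
  forall (s : nat) (P : pred (seq 'I_b)) (e : R), (0 < e)%R ->
  (forall N, exists k,
    ((count (fun i => P (subword u i s)) (iota k N))%:R <= e * N%:R)%R) ->
  exists N0, forall N, N0 <= N ->
    ((count (fun i => P (subword u i s)) (iota 0 N))%:R <= A%:R * e * N%:R)%R.
Proof.
have [L L0 ratio] := bounded_ratio psiM psi_pos.
have [K recK] := uniform_recurrence psiM psi_u psi_pos.
(* The product comes from comparing block lengths with the windows of length [N] chosen below. Of
   the two further units, one pays for factors that cross block boundaries and one for the last,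
   incomplete block. *)
exists (L * L * K.+1 + 2) => [|s P e e0 win]; first by lia.
pose off i := P (subword u i s).
(* Blocks of level [m] are so long that the factors crossing their ends, at most [s] for each block,
   have density at most [e]. *)
have [m hm] : exists m : nat, (s%:R * L%:R / e <= m%:R)%R.
  exists (Num.bound (s%:R * L%:R / e)%R); apply/ltW/archi_boundP.
  by rewrite divr_ge0 ?mulr_ge0 ?ler0n// ltW.
pose l a := size (iter m psi [:: a]).
pose lam := l (u 0).
have lam_m : m < lam by exact: size_iter_ge.
have lL a : l a <= L * lam by exact: ratio.
pose pos := image_pos psi u m.
(* A window of length [N] contains a full block of every letter: at most [L * lam] to reach a block
   boundary, then at most [K] blocks of length at most [L * lam]. *)
pose N := K.+1 * (L * lam).
pose c a := count (fun t => P (take s (drop t (iter m psi [:: a])))) (iota 0 (l a - s)).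
have offE j t : t + s <= l (u j) ->
    off (pos j + t) = P (take s (drop t (iter m psi [:: u j]))).
  move=> ts; rewrite (image_blockE psiM psi_u) drop_subword take_subword//.
  by move: ts; rewrite /l; lia.
have cB a : ((c a)%:R <= e * N%:R)%R.
  have [k kN] := win N; apply: le_trans kN; rewrite ler_nat.
  have [j0 /andP[kj jk]] := next_block u psiM k lL.
  have [j /andP[j0j jK] ua] := recK j0 a.
  have jN : pos j.+1 <= k + N.
    have h i : pos (j0 + i) <= pos j0 + i * (L * lam).
      elim: i => [|i IH]; first by rewrite addn0 leq_addr.
      rewrite addnS /pos (image_posS _ psiM) -/pos mulSn.
      by have := lL (u (j0 + i)); rewrite /l; lia.
    have := h (j.+1 - j0); rewrite subnKC; last by lia.
    have h2 : (j.+1 - j0) * (L * lam) <= K * (L * lam) by rewrite leq_mul2r; apply/orP; right; lia.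
    by rewrite /N mulSn -/pos in jk *; lia.
  have kpj : k <= pos j.
    by apply: leq_trans kj _; exact: image_pos_mono.
  have plj : pos j.+1 = pos j + l a by rewrite /pos (image_posS _ psiM) ua.
  have -> : iota k N = iota k (pos j - k) ++ iota (pos j) (l a - s) ++
      iota (pos j + (l a - s)) (N - (pos j - k) - (l a - s)).
    have eN : N = (pos j - k) + ((l a - s) + (N - (pos j - k) - (l a - s))) by lia.
    by rewrite [in LHS]eN !iotaD subnKC.
  rewrite !count_cat; apply: leq_trans (leq_addl _ _); apply: leq_trans (leq_addr _ _).
  rewrite -[pos j]addn0 iotaDl count_map; apply/eq_leq/eq_in_count => t.
  rewrite mem_iota add0n => /andP[_ tl].
  by rewrite /= -/(off _) offE ua//; lia.
have blockB j : ((count off (iota 0 (pos j)))%:R <= j%:R * (e * N%:R + s%:R))%R.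
  elim: j => [|j IH].
    rewrite /pos /image_pos /subword /= (morphism_nil (word_morphism_iter m psiM)) /=.
    by rewrite mul0r.
  have -> : pos j.+1 = pos j + l (u j) by rewrite /pos (image_posS _ psiM).
  rewrite iotaD add0n count_cat natrD -natr1 mulrDl mul1r lerD//.
  have [ls|sl] := leqP (l (u j)) s.
    apply: ler_wpDl; first by rewrite mulr_ge0// ltW.
    by rewrite ler_nat; apply: leq_trans ls; apply: leq_trans (count_size _ _) _; rewrite size_iota.
  rewrite -(subnK (ltnW sl)) iotaD count_cat natrD lerD//; last first.
    by rewrite ler_nat; apply: leq_trans (count_size _ _) _; rewrite size_iota.
  apply: le_trans (cB (u j)); rewrite ler_nat.
  rewrite -[X in iota X _]addn0 iotaDl count_map; apply/eq_leq/eq_in_count => t.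
  rewrite mem_iota add0n => /andP[_ tl].
  by rewrite /= offE//; lia.
pose Q : R := (e * N%:R + s%:R)%R.
have Q0 : (0 <= Q)%R by rewrite addr_ge0// mulr_ge0// ltW.
exists (Num.bound (Q / e)%R) => M hM.
have ex : exists j, M <= pos j by exists M; exact: image_pos_ge.
case: (ex_minnP ex) => J MJ Jmin.
have cJ : ((count off (iota 0 M))%:R <= J%:R * Q)%R.
  by apply: le_trans (blockB J); rewrite ler_nat -(subnKC MJ) iotaD count_cat leq_addr.
have JM : (J.-1 * lam <= L * M)%N.
  case: J {MJ cJ} Jmin => [//|J] Jmin /=.
  apply: (@leq_trans (L * pos J)); last first.
    rewrite leq_mul2l; apply/orP; right; rewrite leqNgt; apply/negP => /ltnW /Jmin.
    by rewrite ltnn.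
  elim: J {Jmin} => [//|J IH]; rewrite mulSn /pos (image_posS _ psiM) -/pos mulnDr addnC.
  by apply: leq_add => //; exact: ratio.
have lam0 : (0 < lam%:R :> R)%R by rewrite ltr0n; lia.
have JR : (J%:R <= L%:R * M%:R / lam%:R + 1 :> R)%R.
  rewrite -lerBlDr ler_pdivlMr// -natrM; apply: (le_trans (y := (J.-1 * lam)%:R%R)); last by rewrite ler_nat.
  by rewrite natrM ler_wpM2r ?(ltW lam0)//; case: J {MJ cJ JM Jmin} => [|J] /=; rewrite -?natr1; lra.
apply: le_trans cJ _; apply: (le_trans (ler_wpM2r Q0 JR)).
have QM : (Q <= e * M%:R)%R.
  have : (Q / e <= M%:R)%R.
    apply: (le_trans (ltW (archi_boundP _))); first by rewrite divr_ge0// ltW.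
    by rewrite ler_nat.
  by rewrite ler_pdivrMr// mulrC.
have sle : (s%:R * L%:R / lam%:R <= e)%R.
  rewrite ler_pdivrMr//; move: hm; rewrite ler_pdivrMr// => hm.
  apply: le_trans hm _; rewrite mulrC ler_pM2l// ler_nat; exact: ltnW.
have -> : ((L%:R * M%:R / lam%:R + 1) * Q = M%:R * (e * (L * L * K.+1)%:R + s%:R * L%:R / lam%:R) + Q)%R.
  by rewrite /Q /N !natrM; field; rewrite gt_eqF.
have : (M%:R * (s%:R * L%:R / lam%:R) <= M%:R * e)%R by rewrite ler_wpM2l.
rewrite natrD mulrDr; move: QM.
have -> : (((L * L * K.+1)%:R + 2%:R) * e * M%:R = M%:R * (e * (L * L * K.+1)%:R) + M%:R * e + e * M%:R :> R)%R.
  by ring.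
lra.
Qed.

End Density.

Lemma count_or_succ (P : pred nat) M :
  count (fun i => P i || P i.+1) (iota 0 M) <= 2 * count P (iota 0 M.+1).
Proof.
have h1 : count P (iota 0 M) <= count P (iota 0 M.+1).
  by rewrite -addn1 iotaD count_cat leq_addr.
have h2 : count (fun i => P i.+1) (iota 0 M) <= count P (iota 0 M.+1).
  have -> : iota 0 M.+1 = 0 :: map succn (iota 0 M).
    by rewrite -[iota 0 M.+1]/(0 :: iota 1 M) -[1]addn0 iotaDl.
  by rewrite /= count_map leq_addl.
apply: (@leq_trans (count P (iota 0 M) + count (fun i => P i.+1) (iota 0 M))).
  by rewrite -count_predUI; apply: leq_trans (leq_addr _ _); exact: sub_count.
by rewrite mul2n -addnn leq_add.
Qed.

Section Coincidences.
Variables (R : realType) (b : nat) (psi : seq 'I_b -> seq 'I_b) (u : nat -> 'I_b).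
Hypothesis psiM : word_morphism psi.
Hypothesis psi_u : prefix_stable psi u.
Hypothesis psi_pos : forall a c, c \in psi [:: a].
Hypothesis psi_long : forall a, 1 < size (psi [:: a]).

Local Open Scope ring_scope.

(** Each count is within 1/4 of the same real number, and integers at distance less than 1 are
    equal. *)
Lemma same_counts (f : 'I_b -> R) (s : nat) (v w : seq 'I_b) :
  \sum_a ((count_mem a v)%:R - s%:R * f a) ^+ 2 < 16^-1 ->
  \sum_a ((count_mem a w)%:R - s%:R * f a) ^+ 2 < 16^-1 -> perm_eq v w.
Proof.
move=> hv hw; apply/allP => a _.
have bnd (x : seq 'I_b) : \sum_a ((count_mem a x)%:R - s%:R * f a) ^+ 2 < 16^-1 ->
    `|(count_mem a x)%:R - s%:R * f a| < 4^-1.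
  move=> h; have h1 : ((count_mem a x)%:R - s%:R * f a) ^+ 2 < 16^-1.
    apply: le_lt_trans h; rewrite (bigD1 a)//= lerDl sumr_ge0// => *.
    exact: sqr_ge0.
  rewrite -real_normK ?num_real// in h1; move: h1.
  have := normr_ge0 ((count_mem a x)%:R - s%:R * f a); nra.
have /andP[v1 v2] : - 4^-1 < (count_mem a v)%:R - s%:R * f a < 4^-1.
  by rewrite -ltr_norml; exact: bnd.
have /andP[w1 w2] : - 4^-1 < (count_mem a w)%:R - s%:R * f a < 4^-1.
  by rewrite -ltr_norml; exact: bnd.
rewrite /= eqn_leq; apply/andP; split; rewrite -ltnS -(ltr_nat R) -natr1; lra.
Qed.

(** By Markov's inequality, windows whose counts deviate from [s%:R * f a] are rare. If the windows
    at [p], [p + i] and [p + i + 1] do not deviate, they have equal counts and [i] is a coincidence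
    of the pair [p], [p + s]. *)
Lemma coincidences_of_counts (f : 'I_b -> R) :
  (forall eps : R, 0 < eps -> exists2 s : nat, (0 < s)%N & forall N, exists k,
    \sum_(i < N) \sum_a
      ((count_mem a (subword u (k + i) s))%:R - s%:R * f a) ^+ 2 <= eps * N%:R) ->
  forall e : R, 0 < e -> exists p q, [/\ (p < q)%N, coincident u p q 0 &
     exists N0, forall N, (N0 <= N)%N ->
       ((count (fun i => ~~ coincident u p q i) (iota 0 N))%:R <= e * N%:R)].
Proof.
move=> AP e e0.
have [A A0 dens] := upper_density_of_windows R psiM psi_u psi_pos psi_long.
have AR : 0 < A%:R :> R by rewrite ltr0n.
(* The 8 leaves room for two doublings, one for pairs of neighbouring windows and one for the offset
   [p]. The cap at 1 makes two good neighbours exist. *)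
pose e1 := Num.min e 1; pose dl := e1 / (8 * A%:R).
have e10 : 0 < e1 by rewrite lt_min e0 ltr01.
have dl0 : 0 < dl by rewrite divr_gt0// mulr_gt0.
have [|s s0 sP] := AP (dl / 16); first by rewrite divr_gt0.
pose P (w : seq 'I_b) := 16^-1 <= \sum_a ((count_mem a w)%:R - s%:R * f a) ^+ 2.
pose off i := P (subword u i s).
have [|N0 hN0] := dens s P dl dl0.
  move=> N; have [k hk] := sP N; exists k.
  have : 16^-1 * (count (fun i => P (subword u i s)) (iota k N))%:R <= dl / 16 * N%:R.
    apply: le_trans hk.
    rewrite -[X in iota X _]addn0 iotaDl count_map -sum1_count big_mkcond.
    rewrite -[N in iota _ N]subn0 -/(index_iota _ _) big_mkord natr_sum big_distrr /=.
    apply: ler_sum => i _; rewrite /P; case: ifPn => /= [h|_]; first by rewrite mulr1; exact: h.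
    by rewrite mulr0 sumr_ge0// => a _; exact: sqr_ge0.
  by rewrite mulrC mulrAC ler_pdivrMr// mulfVK.
have offN N : (N0 <= N)%N -> (count off (iota 0 N))%:R <= e1 / 8 * N%:R.
  move=> /hN0; suff -> : A%:R * dl = e1 / 8 by [].
  by rewrite /dl; field; rewrite gt_eqF.
have e1e : e1 <= e by rewrite ge_min lexx.
have e11 : e1 <= 1 by rewrite ge_min lexx orbT.
have same i j : ~~ off i -> ~~ off j -> perm_eq (subword u i s) (subword u j s).
  by rewrite -!ltNge; exact: same_counts.
have [p /norP[p0 p1]] : exists p, ~~ (off p || off p.+1).
  apply: contrapT => /forallNP allp.
  have := count_or_succ off (N0 + 2)%N.
  rewrite (@eq_count _ _ predT) ?count_predT ?size_iota; last first.
    by move=> i; have := allp i => /negP; rewrite negbK.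
  rewrite -(ler_nat R) natrM => h.
  have := offN (N0 + 2).+1 (leq_trans (leq_addr _ _) (leqnSn _)).
  have : e1 / 8 * (N0 + 2).+1%:R <= 1 / 8 * (N0 + 2).+1%:R.
    by rewrite ler_wpM2r//; lra.
  move: h; rewrite -[(N0 + 2).+1%:R]natr1 natrD.
  have : 0 <= N0%:R :> R by [].
  lra.
have coin i : ~~ off (p + i)%N -> ~~ off (p + i).+1%N -> coincident u p (p + s) i.
  move=> of1 of2; apply/andP; split; last exact/perm_subword_shift/same.
  apply/eqP; rewrite addnAC; exact/letter_subword_shift/same.
exists p, (p + s)%N; split; first by rewrite -[X in (X < _)%N]addn0 ltn_add2l.
  by have := coin 0%N; rewrite addn0; apply.
exists (N0 + p.+1)%N => N hN.
have h1 : (count (fun i => ~~ coincident u p (p + s) i) (iota 0 N) <=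
    2 * count off (iota 0 (p + N).+1))%N.
  apply: leq_trans (count_or_succ off (p + N)).
  rewrite iotaD count_cat; apply: leq_trans (leq_addl _ _).
  have -> : iota (0 + p)%N N = map (addn p) (iota 0 N) by rewrite -iotaDl addnC.
  rewrite count_map.
  apply: sub_count => i /= nco; apply: contraNT nco => /norP[ho1 ho2]; exact: coin.
apply: (@le_trans _ R (2 * count off (iota 0 (p + N).+1))%:R); first by rewrite ler_nat.
rewrite natrM; have := offN (p + N).+1 (leq_trans (leq_addr _ _) (leq_trans hN (leq_trans (leq_addl p N) (leqnSn _)))).
have : e1 / 8 * (p + N).+1%:R <= e1 / 8 * (2 * N)%:R.
  by rewrite ler_wpM2l ?divr_ge0 ?(ltW e10)// ler_nat; lia.
have : e1 * N%:R <= e * N%:R by rewrite ler_wpM2r.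
rewrite natrM; have : 0 <= e1 * N%:R by rewrite mulr_ge0// ltW.
lra.
Qed.

End Coincidences.

(** * The Pisot eigenvalue and balance *)

Local Open Scope ring_scope.

Section ColumnNorm.
Variable n : nat.
Implicit Types (v w : 'cV[algC]_n).

Definition col_norm v := \sum_i `|v i 0|.

Lemma col_norm_ge0 v : 0 <= col_norm v.
Proof. by apply: sumr_ge0. Qed.

Lemma col_normD v w : col_norm (v + w) <= col_norm v + col_norm w.
Proof. by rewrite -big_split /=; apply: ler_sum => i _; rewrite mxE ler_normD. Qed.

Lemma col_normZ a v : col_norm (a *: v) = `|a| * col_norm v.
Proof. by rewrite big_distrr /=; apply: eq_bigr => i _; rewrite mxE normrM. Qed.

Lemma coord_le_col_norm v i : `|v i 0| <= col_norm v.
Proof. by rewrite /col_norm (bigD1 i)//= lerDl sumr_ge0. Qed.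

End ColumnNorm.

Lemma char_poly_tr (R : comNzRingType) m (A : 'M[R]_m) : char_poly A^T = char_poly A.
Proof.
rewrite /char_poly -[RHS]det_tr; congr (\det _).
by apply/matrixP => i j; rewrite !mxE eq_sym.
Qed.

Section Contraction.
Variables (n : nat) (A : 'M[algC]_n.+1).
Implicit Types (v w : 'cV[algC]_n.+1).

(* Peeling off one root r of the annihilator: w = (A - r) v is again of this form,
   and A^(k+1) v = r A^k v + A^k w sums to a geometric estimate. *)
Lemma summable_orbit (t : algC) (rs : seq algC) v : 0 < t ->
  (forall r, r \in rs -> `|r| < t) ->
  horner_mx A (\prod_(r <- rs) ('X - r%:P)) *m v = 0 ->
  exists C, forall N, \sum_(k < N) t ^- k * col_norm (A ^+ k *m v) <= C.
Proof.
move=> t0; elim: rs v => [|r rs IH] v small.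
  rewrite big_nil rmorph1 mul1mx => ->; exists 0 => N.
  rewrite big1// => k _; rewrite mulmx0 /col_norm big1 ?mulr0// => i _.
  by rewrite mxE normr0.
rewrite big_cons mulrC rmorphM /= -mulmxA => h.
pose w := A *m v - r *: v.
have wE : horner_mx A ('X - r%:P) *m v = w.
  by rewrite rmorphB /= horner_mx_X horner_mx_C mulmxBl mul_scalar_mx.
rewrite wE in h.
have [C hC] := IH w (fun r' h' => small r' (mem_behead (s := r :: rs) h')) h.
have rt : `|r| < t by apply: small; rewrite mem_head.
pose a k := t ^- k * col_norm (A ^+ k *m v).
pose c k := t ^- k * col_norm (A ^+ k *m w).
have a0 k : 0 <= a k by rewrite mulr_ge0 ?col_norm_ge0// invr_ge0 exprn_ge0 ?ltW.
have aS k : a k.+1 <= (`|r| / t) * a k + t^-1 * c k.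
  rewrite /a /c; have -> : A ^+ k.+1 *m v = r *: (A ^+ k *m v) + A ^+ k *m w.
    rewrite exprSr -mulmxA /w mulmxBr -scalemxAr.
    by rewrite addrC subrK.
  rewrite [t ^+ k.+1]exprS invfM.
  apply: (le_trans (ler_wpM2l _ (col_normD _ _))).
    by rewrite mulr_ge0// invr_ge0 ?exprn_ge0 ?ltW.
  rewrite col_normZ mulrDr.
  suff -> : t^-1 * t ^- k * (`|r| * col_norm (A ^+ k *m v)) +
    t^-1 * t ^- k * col_norm (A ^+ k *m w) =
    `|r| / t * (t ^- k * col_norm (A ^+ k *m v)) +
    t^-1 * (t ^- k * col_norm (A ^+ k *m w)) by [].
  by ring.
have rt1 : `|r| / t < 1 by rewrite ltr_pdivrMr// mul1r.
pose D := (a 0%N + t^-1 * C) / (1 - `|r| / t).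
have S N : \sum_(k < N.+1) a k <= a 0%N + `|r| / t * (\sum_(k < N) a k) + t^-1 * C.
  rewrite big_ord_recl -addrA lerD2l.
  apply: (le_trans (ler_sum _ (fun (i : 'I_N) _ => aS i))).
  rewrite big_split /= -!big_distrr /= lerD2l.
  by apply: ler_wpM2l; [rewrite invr_ge0 ltW|exact: hC].
exists D => N; rewrite ler_pdivlMr ?subr_gt0// mulrBr mulr1 lerBlDr.
apply: (@le_trans _ _ (\sum_(k < N.+1) a k)).
  by rewrite big_ord_recr /= lerDl.
apply: (le_trans (S N)); rewrite addrAC lerD2l mulrC.
exact: lexx.
Qed.

End Contraction.

(** * The spectral radius as a simple eigenvalue *)

Section Perron.
Variables (n : nat) (A : 'M[algC]_n.+1) (rs : seq algC) (beta : algC).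
Hypothesis A_ge0 : forall i j, 0 <= A i j.
Hypothesis cyclic_coord : forall a (x : 'cV[algC]_n.+1),
  (forall k, (k < n.+1)%N -> (A ^+ k *m x) a 0 = 0) -> x = 0.
Hypothesis rsE : char_poly A = \prod_(r <- rs) ('X - r%:P).
Hypothesis rs_le : forall r, r \in rs -> `|r| <= beta.
Hypothesis beta0 : 0 < beta.

Implicit Types (v x : 'cV[algC]_n.+1).

Lemma mulmx_ge0 v : (forall i, 0 <= v i 0) -> forall i, 0 <= (A *m v) i 0.
Proof. by move=> v0 i; rewrite mxE sumr_ge0// => j _; rewrite mulr_ge0. Qed.

Lemma expmx_ge0 k v : (forall i, 0 <= v i 0) -> forall i, 0 <= (A ^+ k *m v) i 0.
Proof.
move=> v0; elim: k => [|k IH] i; first by rewrite expr0 mul1mx.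
by rewrite exprS -mulmxA; exact: mulmx_ge0.
Qed.

Let T := \sum_(k < n.+1) A ^+ k.

(** If coordinate [i] of the sum vanishes, so does that coordinate of every non-negative summand,
    and [cyclic_coord] forces v = 0. *)
Lemma positive_sum v : (forall i, 0 <= v i 0) -> v != 0 -> forall i, 0 < (T *m v) i 0.
Proof.
move=> v0 vn0 i; rewrite lt_neqAle eq_sym.
have TE : (T *m v) i 0 = \sum_(k < n.+1) (A ^+ k *m v) i 0.
  by rewrite /T mulmx_suml summxE.
rewrite TE sumr_ge0 ?andbT => [|k _]; last exact: expmx_ge0.
apply: contra vn0 => /eqP/psumr_eq0P h; apply/eqP; apply: (cyclic_coord (a := i)) => k kn.
by apply: (h _ (Ordinal kn) isT) => j _; exact: expmx_ge0.
Qed.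

(** By induction A^k x dominates t^k x, so the terms t^-k |A^k x| stay above a positive constant.
    They are summable, because all roots have modulus less than [t]. *)
Lemma growth_contradiction t x : beta < t -> (forall i, 0 < x i 0) ->
  (forall i, t * x i 0 <= (A *m x) i 0) -> False.
Proof.
move=> bt x0 Ax; have t0 : 0 < t by apply: lt_trans bt.
have [C hC] : exists C, forall N, \sum_(k < N) t ^- k * col_norm (A ^+ k *m x) <= C.
  apply: (summable_orbit t0 (rs := rs)) => [r rr|].
    by apply: le_lt_trans bt; exact: rs_le.
  by rewrite -rsE Cayley_Hamilton mul0mx.
have grow k i : t ^+ k * x i 0 <= (A ^+ k *m x) i 0.
  elim: k i => [|k IH] i; first by rewrite !expr0 mul1mx mul1r.
  rewrite exprSr -mulrA; apply: (@le_trans _ _ (t ^+ k * (A *m x) i 0)).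
    by rewrite ler_wpM2l// exprn_ge0// ltW.
  rewrite exprSr -[A ^+ k * A]/(A ^+ k *m A).
  have -> : A ^+ k *m A = A *m A ^+ k by rewrite -[LHS]exprSr -[RHS]exprS.
  rewrite -mulmxA !mxE big_distrr /=; apply: ler_sum => j _.
  by rewrite mulrCA ler_wpM2l.
have one k : x 0 0 <= t ^- k * col_norm (A ^+ k *m x).
  rewrite mulrC ler_pdivlMr ?exprn_gt0// mulrC; apply: (le_trans (grow k 0)).
  apply: le_trans (coord_le_col_norm _ 0); rewrite ger0_norm//.
  by apply: expmx_ge0 => i; exact: ltW.
pose N := Num.bound (C / x 0 0).
have C0 : 0 <= C by have := hC 0%N; rewrite big_ord0.
have : N%:R * x 0 0 <= C.
  apply: le_trans (hC N); rewrite mulr_natl -{1}(card_ord N) -sumr_const.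
  by apply: ler_sum => k _.
rewrite -ler_pdivlMr// => h.
have := archi_boundP (divr_ge0 C0 (ltW (x0 0))); rewrite -/N => h2.
by have := lt_le_trans h2 h; rewrite ltxx.
Qed.

(** For an eigenvector v of [z], the vector |v| satisfies A |v| >= beta |v|. Unless equality holds,
    applying [T] makes the surplus positive in every coordinate and produces a growth rate above
    [beta]. *)
Lemma perron_root z : z \in rs -> `|z| = beta -> root (char_poly A) beta.
Proof.
move=> zrs zb.
have [v Av vn0] : exists2 v : 'cV[algC]_n.+1, A *m v = z *: v & v != 0.
  have : eigenvalue A^T z.
    by rewrite eigenvalue_root_char char_poly_tr rsE root_prod_XsubC.
  case/eigenvalueP => w wA w0; exists w^T; last by rewrite trmx_eq0.
  by rewrite -{1}[A]trmxK -trmx_mul wA linearZ.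
pose x : 'cV[algC]_n.+1 := \col_i `|v i 0|.
have x_ge0 i : 0 <= x i 0 by rewrite mxE.
have x_n0 : x != 0.
  apply: contra vn0 => /eqP/matrixP e; apply/eqP/matrixP => i j.
  by have := e i 0; rewrite !mxE ord1 => /eqP; rewrite normr_eq0 => /eqP.
have Ax i : beta * x i 0 <= (A *m x) i 0.
  rewrite mxE -zb -normrM; have := congr1 (fun M : 'cV_n.+1 => M i 0) Av.
  rewrite [in RHS]mxE /= => <-; rewrite !mxE; apply: (le_trans (ler_norm_sum _ _ _)).
  by apply: ler_sum => j _; rewrite normrM mxE ger0_norm.
pose d := A *m x - beta *: x.
have d_ge0 i : 0 <= d i 0.
  by rewrite /d mxE [X in _ + X]mxE [X in - X]mxE subr_ge0.
have [d0|dn0] := eqVneq d 0.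
  rewrite -char_poly_tr -eigenvalue_root_char; apply/eigenvalueP.
  exists x^T; last by rewrite trmx_eq0.
  by rewrite -trmx_mul -linearZ /=; congr trmx; apply/eqP; rewrite -subr_eq0 -/d d0.
exfalso; pose y := T *m d; pose x' := T *m x.
have y0 := positive_sum d_ge0 dn0; have x'0 := positive_sum x_ge0 x_n0.
have AT : A *m T = T *m A.
  by rewrite /T mulmx_sumr mulmx_suml; apply: eq_bigr => k _; rewrite -[LHS]exprS -[RHS]exprSr.
have yE : A *m x' = beta *: x' + y.
  by rewrite /y /x' /d mulmxA AT -mulmxA mulmxBr -scalemxAr addrC subrK.
(* Each ratio is at most [S], so in every coordinate the surplus [y] is at least [S^-1] times
   [x']. *)
pose S := \sum_i x' i 0 / y i 0.
have S0 : 0 < S.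
  by rewrite /S (bigD1 0)//= ltr_pwDl ?divr_gt0// sumr_ge0// => i _; rewrite divr_ge0// ltW.
apply: (@growth_contradiction (beta + S^-1) x') => //.
  by rewrite ltrDl invr_gt0.
move=> i; rewrite yE mulrDl [leRHS]mxE [X in _ <= X + _]mxE lerD2l.
rewrite mulrC ler_pdivrMr// mulrC -ler_pdivrMr//.
by rewrite /S (bigD1 i)//= lerDl sumr_ge0// => j _; rewrite divr_ge0// ltW.
Qed.

End Perron.

Lemma irreducible_coprimep (F : fieldType) (p q : {poly F}) :
  irreducible_poly p -> q != 0 -> (size q < size p)%N -> coprimep p q.
Proof.
move=> [_ irr] q0 sqp; rewrite /coprimep; apply/negPn/negP => s1.
have := irr _ s1 (dvdp_gcdl p q) => /eqp_size e.
by have := dvdp_leq q0 (dvdp_gcdr p q); rewrite e leqNgt sqp.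
Qed.

(** [algC] is only partially ordered, so the fold of [Num.max] has to be shown real along the way.
    Its starting value 0 is the reason for the positivity assumption in the last clause. *)
Lemma spectral_radiusP m (A : 'M[algC]_m) :
  let rs := sval (closed_field_poly_normal (char_poly A)) in
  [/\ char_poly A = \prod_(r <- rs) ('X - r%:P),
      forall r, r \in rs -> `|r| <= spectral_radius A &
      0 < spectral_radius A -> exists2 z, z \in rs & `|z| = spectral_radius A].
Proof.
rewrite /spectral_radius; case: closed_field_poly_normal => rs /= E; split.
- by rewrite E (monicP (char_poly_monic A)) scale1r.
- have [_] : (\big[Num.max/0]_(z <- rs) `|z| \is Num.real) /\
    (forall r, r \in rs -> `|r| <= \big[Num.max/0]_(z <- rs) `|z|); last by [].
  elim: rs {E} => [|z rs [IHr IH]]; first by rewrite big_nil real0.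
  rewrite big_cons; set M := bigop _ _ _ in IHr IH *; rewrite /Num.max.
  case: ifPn => [lt|]; last rewrite -real_leNgt// => le.
    split=> // r; rewrite inE => /predU1P[->|/IH//]; exact: ltW.
  split=> [|r]; first exact: normr_real.
  by rewrite inE => /predU1P[->//|/IH/le_trans]; apply.
- elim: rs {E} => [|z rs IH]; first by rewrite big_nil ltxx.
  rewrite big_cons; set M := bigop _ _ _ in IH *; rewrite /Num.max.
  case: ifPn => [_ /IH[w wrs wM]|_ _]; first by exists w; rewrite ?inE ?wrs ?orbT.
  by exists z; rewrite ?mem_head.
Qed.

Section Incidence.
Variables (n : nat) (phi : seq 'I_n.+1 -> seq 'I_n.+1).
Hypothesis phiM : word_morphism phi.
Hypothesis irr : irreducible_morphism phi.
Hypothesis pisot : pisot_morphism phi.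

Let Aq : 'M[rat]_n.+1 := map_mx (fun k : nat => k%:R : rat) (incidence_mx phi).
Let A : 'M[algC]_n.+1 := map_mx (fun k : nat => k%:R : algC) (incidence_mx phi).
Let beta := spectral_radius A.

Lemma incidence_ratr : A = map_mx ratr Aq.
Proof. by apply/matrixP => i j; rewrite !mxE ratr_nat. Qed.

Lemma char_poly_ratr : char_poly A = map_poly ratr (char_poly Aq).
Proof. by rewrite incidence_ratr map_char_poly. Qed.

(** A dependency is a nonzero polynomial p of degree at most [n] such that p(Aq) has zero row [a].
    It is coprime to the irreducible characteristic polynomial, so a Bezout relation inverts
    p(Aq). *)
Lemma krylov_free (a : 'I_n.+1) :
  row_free (\matrix_(i < n.+1) row a (Aq ^+ i)).
Proof.
apply: inj_row_free => c cK.
pose p : {poly rat} := \poly_(i < n.+1) c 0 (inord i).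
have pE : row a (horner_mx Aq p) = 0.
  rewrite -cK /p poly_def rmorph_sum /=; apply/rowP => j.
  rewrite mxE summxE [RHS]mxE; apply: eq_bigr => i _.
  by rewrite linearZ /= rmorphXn /= horner_mx_X !mxE inord_val.
have [p0|pn0] := eqVneq p 0.
  apply/rowP => i; have := congr1 (fun q : {poly rat} => q`_i) p0.
  by rewrite coef_poly coef0 ltn_ord inord_val mxE.
have cop : coprimep (char_poly Aq) p.
  apply: irreducible_coprimep => //; rewrite size_char_poly; exact: leq_ltn_trans (size_poly _ _) _.
have /Bezout_coprimepP[[x y] /= /eqpP[[c1 c2] /= /andP[c10 c20] e]] := cop.
have := congr1 (horner_mx Aq) e.
rewrite !linearZ /= rmorph1 rmorphD /= !rmorphM /= Cayley_Hamilton mulr0 add0r => e2.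
have : row a (c1 *: (horner_mx Aq y * horner_mx Aq p)) = 0.
  have -> : horner_mx Aq y * horner_mx Aq p = horner_mx Aq p *m horner_mx Aq y.
    by rewrite -[LHS]rmorphM mulrC rmorphM.
  by rewrite linearZ /= row_mul pE mul0mx scaler0.
rewrite e2 => /rowP/(_ a); rewrite !mxE eqxx mulr1 => /eqP.
by rewrite (negbTE c20).
Qed.

(** The Krylov rows are independent over the rationals, hence over [algC], because invertibility of
    their matrix survives the embedding. *)
Lemma incidence_cyclic (a : 'I_n.+1) (x : 'cV[algC]_n.+1) :
  (forall k, (k < n.+1)%N -> (A ^+ k *m x) a 0 = 0) -> x = 0.
Proof.
move=> h; pose K := \matrix_(i < n.+1) row a (Aq ^+ i).
have Ku : map_mx (ratr : rat -> algC) K \in unitmx.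
  by rewrite map_unitmx -row_free_unit krylov_free.
have K0 : map_mx (ratr : rat -> algC) K *m x = 0.
  apply/matrixP => i j; rewrite ord1 [RHS]mxE -(h i (ltn_ord i)) mxE [RHS]mxE.
  apply: eq_bigr => l _; rewrite incidence_ratr -rmorphXn /=.
  by rewrite !mxE.
by rewrite -[x](mulKmx Ku) K0 mulmx0.
Qed.

Lemma incidence_ge0 i j : 0 <= A i j.
Proof. by rewrite mxE. Qed.

Lemma beta_gt1 : 1 < beta.
Proof. by case: pisot. Qed.

Lemma beta_gt0 : 0 < beta.
Proof. exact: lt_trans ltr01 beta_gt1. Qed.

Lemma beta_root : root (char_poly A) beta.
Proof.
have [rsE le_rs] := spectral_radiusP A; move=> /(_ beta_gt0)[z zrs zb].
exact: (perron_root incidence_ge0 incidence_cyclic rsE le_rs beta_gt0 zrs zb).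
Qed.

Lemma minCpoly_beta : minCpoly beta = char_poly A.
Proof.
have [p [-> monp] divp] := minCpolyP beta.
rewrite char_poly_ratr; congr map_poly; apply/eqP.
rewrite -eqp_monic ?char_poly_monic//.
case: irr => _; apply; last by rewrite -divp -char_poly_ratr beta_root.
apply/negP => /size_poly1P[c c0 pc]; have := divp p; rewrite dvdpp pc map_polyC /= rootC.
by rewrite fmorph_eq0 (negbTE c0).
Qed.

(** By [minCpoly_beta] the other eigenvalues are conjugates of [beta]. The irreducible
    characteristic polynomial is separable in characteristic 0, so [beta] occurs once. *)
Lemma beta_simple : exists rs : seq algC,
  [/\ char_poly A = ('X - beta%:P) * \prod_(r <- rs) ('X - r%:P),
      forall r, r \in rs -> `|r| < 1 & beta \notin rs].
Proof.
have [rsE _ _] := spectral_radiusP A; set rs := sval _ in rsE.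
have brs : beta \in rs by rewrite -root_prod_XsubC -rsE beta_root.
have uniq_rs : uniq rs.
  rewrite -separable_prod_XsubC -rsE char_poly_ratr separable_map separable_poly.unlock.
  have d0 : (char_poly Aq)^`() != 0.
    apply: contraTneq (oner_neq0 rat) => /(congr1 (fun q : {poly rat} => q`_n)).
    rewrite coef_deriv coef0; have := monicP (char_poly_monic Aq).
    rewrite lead_coefE size_char_poly /= => -> /eqP.
    by rewrite pnatr_eq0.
  apply: irreducible_coprimep => //; exact/lt_size_deriv/monic_neq0/char_poly_monic.
exists (rem beta rs); split; first by rewrite rsE (big_rem beta).
  move=> r rr; have rin : r \in rs by exact: mem_rem rr.
  have [_ _ _] := pisot; apply; rewrite -/A -/beta.
    by rewrite minCpoly_beta rsE root_prod_XsubC.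
  by apply: contraTneq rr => ->; rewrite mem_rem_uniqF.
by rewrite mem_rem_uniqF.
Qed.

Lemma incidence_unit : A \in unitmx.
Proof.
rewrite unitmxE unitfE; apply/negP => /eqP d0.
have r0 : root (char_poly Aq) 0.
  have : root (char_poly A) 0 by rewrite rootE horner_coef0 char_poly_det d0 mulr0.
  by rewrite char_poly_ratr -(rmorph0 (ratr : {rmorphism rat -> algC})) fmorph_root.
have e : 'X %= char_poly Aq.
  by case: irr => _; apply; [rewrite size_polyX|rewrite -['X]subr0 -polyC0 dvdp_XsubCl].
have : root (char_poly A) beta by exact: beta_root.
have -> : char_poly A = 'X.
  rewrite char_poly_ratr; move: e; rewrite eqp_monic ?monicX ?char_poly_monic// => /eqP <-.
  by rewrite map_polyX.
by rewrite rootX gt_eqF ?beta_gt0.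
Qed.

End Incidence.

(** * Dominant projection, growth of letters and balance *)

Lemma expr_unbounded (x B : algC) : 1 < x -> 0 <= B ->
  exists k0, forall k, (k0 <= k)%N -> B < x ^+ k.
Proof.
move=> x1 B0; have d0 : 0 < x - 1 by rewrite subr_gt0.
exists (Num.bound (B / (x - 1))) => k hk.
have bern : k%:R * (x - 1) <= x ^+ k.
  elim: k {hk} => [|k IH]; first by rewrite mul0r expr0 ler01.
  rewrite -natr1 mulrDl mul1r exprS -[X in _ <= X * _](subrK 1) mulrDl mul1r [leRHS]addrC.
  apply: lerD => //; apply: ler_peMr; first exact: ltW.
  by apply: exprn_ege1; exact: ltW.
apply: lt_le_trans bern; rewrite -ltr_pdivrMr//.
apply: lt_le_trans (archi_boundP _) _; first by rewrite divr_ge0// ltW.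
by rewrite ler_nat.
Qed.

(** The pairing of the letter counts of [w] with [v]; for it the morphism is adjoint to the
    incidence matrix. *)
Definition word_sum n (w : seq 'I_n) (v : 'cV[algC]_n) : algC := \sum_(a <- w) v a 0.

Section WordSum.
Variable n : nat.
Implicit Types (w : seq 'I_n) (v : 'cV[algC]_n).

Lemma word_sum_cat w1 w2 v : word_sum (w1 ++ w2) v = word_sum w1 v + word_sum w2 v.
Proof. by rewrite /word_sum big_cat. Qed.

Lemma word_sum_le w v : `|word_sum w v| <= (size w)%:R * col_norm v.
Proof.
rewrite /word_sum; elim: w => [|a w IH]; first by rewrite big_nil normr0 mul0r.
rewrite big_cons /= -natr1 mulrDl mul1r [leRHS]addrC; apply: le_trans (ler_normD _ _) _.
by apply: lerD => //; exact: coord_le_col_norm.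
Qed.

Lemma word_sum_delta w c : word_sum w (delta_mx c 0) = (count_mem c w)%:R.
Proof.
rewrite /word_sum -sum1_count natr_sum [RHS]big_mkcond /=; apply: eq_bigr => a _.
by rewrite !mxE andbT; case: (a == c).
Qed.

Lemma word_sumB w v1 v2 : word_sum w (v1 - v2) = word_sum w v1 - word_sum w v2.
Proof. by rewrite /word_sum -sumrB; apply: eq_bigr => a _; rewrite !mxE. Qed.

Lemma word_sum_const w k : word_sum w (const_mx k) = (size w)%:R * k.
Proof.
rewrite /word_sum (eq_bigr (fun=> k)) => [|a _]; last by rewrite mxE.
by rewrite big_const_seq count_predT iter_addr addr0 mulr_natl.
Qed.

End WordSum.

Section Dominant.
Variables (n : nat) (phi : seq 'I_n.+1 -> seq 'I_n.+1).
Hypothesis phiM : word_morphism phi.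
Hypothesis irr : irreducible_morphism phi.
Hypothesis pisot : pisot_morphism phi.

Let A : 'M[algC]_n.+1 := map_mx (fun k : nat => k%:R : algC) (incidence_mx phi).
Let beta := spectral_radius A.
Let beta1 : 1 < beta := beta_gt1 pisot.

Lemma word_sum_morphism w v : word_sum (phi w) v = word_sum w (A *m v).
Proof.
elim: w => [|a w IH]; first by rewrite (morphism_nil phiM) /word_sum !big_nil.
rewrite -cat1s (morphism_cat phiM) !word_sum_cat IH; congr (_ + _).
rewrite /word_sum big_seq1 mxE [RHS](eq_bigr (fun j => \sum_(c <- phi [:: a] | c == j) v j 0)).
  rewrite [RHS](exchange_big_dep xpredT)//=; apply: eq_bigr => c _.
  by rewrite (eq_bigl (pred1 c)) ?big_pred1_eq// => j; rewrite eq_sym.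
move=> j _; rewrite big_const_seq iter_addr addr0 /A !mxE.
by rewrite mulr_natl.
Qed.

Lemma word_sum_iter k w v : word_sum (iter k phi w) v = word_sum w (A ^+ k *m v).
Proof.
elim: k w => [|k IH] w; first by rewrite expr0 mul1mx.
by rewrite iterSr IH word_sum_morphism exprS mulmxA.
Qed.

Lemma incidence_power k v a : (A ^+ k *m v) a 0 = word_sum (iter k phi [:: a]) v.
Proof. by rewrite word_sum_iter /word_sum big_seq1. Qed.

(** With q the product over the contracting roots, Q = q(A) / q(beta). Cayley-Hamilton gives (A -
    beta) q(A) = 0, hence A Q = beta Q. As q - q(beta) is a multiple of X - beta, q(A) kills v - Q
    v, whose orbit is therefore summable. *)
Lemma dominant_projection : exists Q : 'M[algC]_n.+1,
  A *m Q = beta *: Q /\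
  forall v : 'cV[algC]_n.+1, exists C, forall N,
    \sum_(k < N) col_norm (A ^+ k *m (v - Q *m v)) <= C.
Proof.
have [rs [chiE small nrs]] := beta_simple irr pisot; rewrite -/A -/beta in chiE nrs.
set q := \prod_(r <- rs) _ in chiE.
have qb0 : q.[beta] != 0 by rewrite -/(root q beta) root_prod_XsubC.
have [h hE] : exists h, q - q.[beta]%:P = h * ('X - beta%:P).
  by apply/factor_theorem; rewrite /root !hornerE subrr.
have chi0 : horner_mx A ('X - beta%:P) * horner_mx A q = 0.
  by rewrite -rmorphM -chiE /= Cayley_Hamilton.
exists (q.[beta]^-1 *: horner_mx A q); split.
  rewrite -scalemxAr scalerA mulrC -scalerA; congr (_ *: _).
  apply/eqP; rewrite -subr_eq0; apply/eqP.
  move: chi0; rewrite rmorphB /= horner_mx_X horner_mx_C mulrBl => <-.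
  by congr (_ - _); rewrite -mul_scalar_mx.
move=> v; set w := v - _.
have [|C hC] := @summable_orbit n A 1 rs w ltr01 small.
  rewrite -/q /w mulmxBr -scalemxAl -scalemxAr.
  have -> : horner_mx A q *m (horner_mx A q *m v) = q.[beta] *: (horner_mx A q *m v).
    apply/eqP; rewrite -subr_eq0; apply/eqP.
    rewrite -mul_scalar_mx -mulmxBl -(horner_mx_C A) -rmorphB /= hE mulmxA.
    rewrite -[_ *m horner_mx A q]/(_ * _) rmorphM /= -mulrA chi0 mulr0 mul0mx//.
  by rewrite scalerA mulVf// scale1r subrr.
by exists C => N; apply: le_trans (hC N); apply: ler_sum => k _; rewrite expr1n invr1 mul1r.
Qed.

(** [A] is invertible, so the orbit consists of nonzero vectors of natural numbers, each of norm at
    least 1. *)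
Lemma not_decaying (v : 'cV[algC]_n.+1) : (forall i, v i 0 \is a Num.nat) -> v != 0 ->
  ~ exists C, forall N, \sum_(k < N) col_norm (A ^+ k *m v) <= C.
Proof.
move=> vnat vn0 [C hC].
have one k : 1 <= col_norm (A ^+ k *m v).
  have wn0 : A ^+ k *m v != 0.
    have Aku : A ^+ k \in unitmx by apply: (@unitrX _ A k); exact: incidence_unit.
    by apply: contra vn0 => /eqP e; rewrite -[v](mulKmx Aku) e mulmx0.
  have [i wi0] : exists i, (A ^+ k *m v) i 0 != 0.
    apply/existsP; apply: contraNT wn0 => /existsPn h; apply/eqP/matrixP => i j.
    by rewrite ord1 [RHS]mxE; have := h i => /negPn/eqP.
  apply: le_trans (coord_le_col_norm _ i).
  have : (A ^+ k *m v) i 0 \is a Num.nat.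
    by rewrite incidence_power rpred_sum.
  case/natrP => m e; rewrite e normr_nat -[1]/(1%:R) ler_nat lt0n.
  by move: wi0; rewrite e pnatr_eq0.
have C0 : 0 <= C by have := hC 0%N; rewrite big_ord0.
have := hC (Num.bound C); apply/negP; rewrite -real_ltNge ?ger0_real//; last first.
  by rewrite sumr_ge0// => k _; exact: col_norm_ge0.
apply: lt_le_trans (archi_boundP C0) _.
rewrite -[X in X%:R]card_ord -sumr_const; exact: ler_sum.
Qed.

Lemma eigenvector_coord (x : 'cV[algC]_n.+1) a : A *m x = beta *: x -> x a 0 = 0 -> x = 0.
Proof.
move=> Ax xa; apply: (incidence_cyclic irr (a := a)) => k _; rewrite -/A.
have -> : A ^+ k *m x = beta ^+ k *: x.
  elim: k => [|k IH]; first by rewrite expr0 mul1mx scale1r.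
  by rewrite !exprS -mulmxA IH -scalemxAr Ax scalerA mulrC.
by rewrite mxE xa mulr0.
Qed.

Lemma delta_nat (c : 'I_n.+1) i : (delta_mx c 0 : 'cV[algC]_n.+1) i 0 \is a Num.nat.
Proof. by rewrite mxE. Qed.

(** This contains primitivity. The number of letters [c] in phi^k(a) is coordinate [a] of A^k e_c,
    which is beta^k (Q e_c)_a up to a bounded error. Q e_c is nonzero by [not_decaying], and a
    nonzero eigenvector for [beta] has no zero coordinate. *)
Lemma letter_growth m : exists k0, forall k, (k0 <= k)%N -> forall a c,
  (m <= count_mem c (iter k phi [:: a]))%N.
Proof.
have [Q [AQ decay]] := dominant_projection.
suff each (ac : 'I_n.+1 * 'I_n.+1) : exists k0, forall k, (k0 <= k)%N ->
    (m <= count_mem ac.2 (iter k phi [:: ac.1]))%N.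
  have [k0 hk] := fin_all_exists each.
  exists (\max_ac k0 ac) => k lek a c; apply: (hk (a, c)).
  by apply: leq_trans lek; exact: (leq_bigmax (F := k0) (a, c)).
case: ac => a c /=; set e : 'cV[algC]_n.+1 := delta_mx c 0.
have [C hC] := decay e.
have en0 : e != 0.
  by apply/eqP => /matrixP/(_ c 0)/eqP; rewrite !mxE !eqxx oner_eq0.
have Qe0 : Q *m e != 0.
  apply/eqP => Qe; apply: (not_decaying (delta_nat c) en0); exists C => N.
  by apply: le_trans (hC N); rewrite Qe subr0.
have AQe : A *m (Q *m e) = beta *: (Q *m e) by rewrite mulmxA AQ -scalemxAl.
have d0 : 0 < `|(Q *m e) a 0|.
  by rewrite normr_gt0; apply: contra Qe0 => /eqP/(eigenvector_coord AQe)/eqP.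
have C0 : 0 <= C by have := hC 0%N; rewrite big_ord0.
have [|k0 hk0] := expr_unbounded beta1 (B := (m%:R + C) / `|(Q *m e) a 0|).
  by rewrite divr_ge0// addr_ge0.
exists k0 => k /hk0; rewrite ltr_pdivrMr// => hk.
rewrite leqNgt; apply/negP => lt_m.
suff : beta ^+ k * `|(Q *m e) a 0| <= m%:R + C by move=> h; have := lt_le_trans hk h; rewrite ltxx.
have -> : beta ^+ k * `|(Q *m e) a 0| = `|(A ^+ k *m (Q *m e)) a 0|.
  have -> : A ^+ k *m (Q *m e) = beta ^+ k *: (Q *m e).
    elim: k {hk lt_m} => [|k IH]; first by rewrite !expr0 mul1mx scale1r.
    by rewrite !exprS -mulmxA IH -scalemxAr AQe scalerA mulrC.
  by rewrite [in RHS]mxE normrM ger0_norm// exprn_ge0// ltW// (lt_trans ltr01).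
have -> : A ^+ k *m (Q *m e) = A ^+ k *m e - A ^+ k *m (e - Q *m e).
  by rewrite mulmxBr opprB addrC subrK.
rewrite mxE [X in _ + X]mxE; apply: le_trans (ler_normB _ _) _; apply: lerD.
  by rewrite incidence_power word_sum_delta normr_nat ler_nat ltnW.
apply: le_trans (coord_le_col_norm _ a) _; apply: le_trans (hC k.+1).
by rewrite big_ord_recr /= lerDr sumr_ge0// => i _; exact: col_norm_ge0.
Qed.

End Dominant.

Section Balanced.
Variables (n : nat) (phi : seq 'I_n.+1 -> seq 'I_n.+1) (u : nat -> 'I_n.+1).
Hypothesis phiM : word_morphism phi.
Hypothesis phi_u : prefix_stable phi u.

Lemma desubstitute m : exists j, exists2 t, (size t <= \max_a size (phi [:: a]))%N &
  subword u 0 m = phi (subword u 0 j) ++ t.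
Proof.
pose pos j := size (phi (subword u 0 j)).
have posS j : pos j.+1 = (pos j + size (phi [:: u j]))%N.
  by rewrite /pos subwordS -cats1 (morphism_cat phiM) size_cat.
have ex : exists j, (m < pos j)%N.
  exists m.+1; apply: leq_trans (size_morphism_ge phiM _).
  by rewrite size_subword.
case: (ex_minnP ex) => -[|j]; first by rewrite /pos /subword /= (morphism_nil phiM).
move=> mj h; have jm : (pos j <= m)%N.
  by rewrite leqNgt; apply/negP => /h; rewrite ltnn.
exists j, (subword u (pos j) (m - pos j)).
  rewrite size_subword; apply: leq_trans (leq_bigmax (F := fun a => size (phi [:: a])) (u j)).
  by rewrite /= leq_subLR; move: mj; rewrite posS; apply: ltnW.
by rewrite phi_u -/(pos j) -{1}(subnKC jm) subwordD.
Qed.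

Hypothesis irr : irreducible_morphism phi.
Hypothesis pisot : pisot_morphism phi.

Let A : 'M[algC]_n.+1 := map_mx (fun k : nat => k%:R : algC) (incidence_mx phi).
Let beta := spectral_radius A.
Let L := (\max_a size (phi [:: a]))%N.

(** The Dumont-Thomas expansion: a prefix is the image of a shorter prefix followed by a tail of
    length at most [L]. Repeating this [K] times pairs the k-th tail with A^k v. *)
Lemma prefix_word_sum_rec v K m : exists j,
  (size (iter K phi (subword u 0 j)) <= m)%N /\
  `|word_sum (subword u 0 m) v| <= L%:R * (\sum_(k < K) col_norm (A ^+ k *m v))
     + `|word_sum (subword u 0 j) (A ^+ K *m v)|.
Proof.
elim: K => [|K [j [szj hj]]].
  by exists m; rewrite size_subword big_ord0 mulr0 add0r expr0 mul1mx.
have [i [t szt e]] := desubstitute j; exists i; split.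
  apply: leq_trans szj; rewrite iterSr e (morphism_cat (word_morphism_iter K phiM)).
  by rewrite size_cat leq_addr.
apply: (le_trans hj); rewrite big_ord_recr /= mulrDr -addrA lerD2l e word_sum_cat.
rewrite (word_sum_morphism phiM) -/A [A ^+ K.+1]exprS -mulmxA.
apply: le_trans (ler_normD _ _) _; rewrite [leLHS]addrC; apply: lerD => //.
apply: le_trans (word_sum_le _ _) _; rewrite ler_wpM2r ?col_norm_ge0//.
by rewrite ler_nat.
Qed.

Lemma prefix_word_sum v C : (forall N, \sum_(k < N) col_norm (A ^+ k *m v) <= C) ->
  forall m, `|word_sum (subword u 0 m) v| <= L%:R * C.
Proof.
(* For this [K], the image of a single letter is longer than [m], so the remaining prefix is
   empty. *)
move=> hC m; have [K hK] := letter_growth phiM irr pisot m.+1.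
have [[|j] [szj hj]] := prefix_word_sum_rec v K m.
  apply: (le_trans hj); rewrite /word_sum big_nil normr0 addr0.
  by rewrite ler_wpM2l.
exfalso; have := hK K (leqnn K) (u 0) (u 0).
have := count_size (pred1 (u 0)) (iter K phi [:: u 0]).
have : (size (iter K phi [:: u 0]) <= m)%N.
  apply: leq_trans szj; rewrite -[j.+1]add1n subwordD subword1.
  by rewrite (morphism_cat (word_morphism_iter K phiM)) size_cat leq_addr.
by move=> h1 h2 h3; have := leq_trans h3 (leq_trans h2 h1); rewrite ltnn.
Qed.

(** [kappa], which acts as the frequency of [c], makes coordinate 0 of the image under [Q] vanish.
    That image satisfies the eigenvector equation for [beta], so it is zero. *)
Lemma balancing_vector c : exists kappa : algC, exists C : algC, forall N,
  \sum_(k < N) col_norm (A ^+ k *m (delta_mx c 0 - const_mx kappa)) <= C.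
Proof.
have [Q [AQ decay]] := dominant_projection irr pisot; rewrite -/A -/beta in AQ decay.
pose one : 'cV[algC]_n.+1 := const_mx 1; pose e : 'cV[algC]_n.+1 := delta_mx c 0.
have one_n0 : one != 0.
  by apply/eqP => /matrixP/(_ 0 0)/eqP; rewrite !mxE oner_eq0.
have Q1 : Q *m one != 0.
  apply/eqP => Q1; have [C hC] := decay one.
  apply: (@not_decaying _ phi phiM irr pisot one _ one_n0) => [i|].
    by rewrite mxE.
  by exists C => N; apply: le_trans (hC N); rewrite Q1 subr0.
have AQv (v : 'cV[algC]_n.+1) : A *m (Q *m v) = beta *: (Q *m v) by rewrite mulmxA AQ -scalemxAl.
have q0 : (Q *m one) 0 0 != 0.
  by apply: contra Q1 => /eqP/(eigenvector_coord irr (AQv one))/eqP.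
pose kappa := (Q *m e) 0 0 / (Q *m one) 0 0; exists kappa.
have constE : const_mx kappa = kappa *: one.
  by apply/matrixP => i j; rewrite !mxE mulr1.
have Qv : Q *m (e - const_mx kappa) = 0.
  apply: (eigenvector_coord irr (a := 0)); first exact: AQv.
  by rewrite constE mulmxBr -scalemxAr mxE [X in _ + X]mxE [X in - X]mxE divfK// subrr.
have [C hC] := decay (e - const_mx kappa); exists C => N.
by apply: le_trans (hC N); rewrite Qv subr0.
Qed.

Lemma pisot_balanced : exists C, balanced u C.
Proof.
suff each (a : 'I_n.+1) : exists C : nat, forall i j m,
    (count_mem a (subword u i m) <= count_mem a (subword u j m) + C)%N.
  have [C hC] := fin_all_exists each; exists (\max_a C a)%N => i j m a.
  by apply: leq_trans (hC a i j m) _; rewrite leq_add2l (leq_bigmax (F := C) a).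
have [kappa [C hC]] := balancing_vector a.
set v := _ - _ in hC; have pre := prefix_word_sum hC.
have LC0 : 0 <= L%:R * C by apply: le_trans (pre 0%N).
(* A window is a difference of two prefixes and two windows are compared, hence four prefix
   bounds. *)
exists (Num.bound (4 * (L%:R * C))) => i j m.
have sub k : `|word_sum (subword u k m) v| <= 2 * (L%:R * C).
  have -> : word_sum (subword u k m) v = word_sum (subword u 0 (k + m)) v - word_sum (subword u 0 k) v.
    by rewrite subwordD word_sum_cat add0n addrC addKr.
  apply: le_trans (ler_normB _ _) _; rewrite mulr2n mulrDl mul1r; exact: lerD.
have cnt k : (count_mem a (subword u k m))%:R = word_sum (subword u k m) v + m%:R * kappa.
  by rewrite word_sumB word_sum_delta word_sum_const size_subword subrK.
rewrite -(ler_nat algC) natrD -lerBlDl.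
have -> : (count_mem a (subword u i m))%:R - (count_mem a (subword u j m))%:R =
  word_sum (subword u i m) v - word_sum (subword u j m) v :> algC by rewrite !cnt; ring.
have re : word_sum (subword u i m) v - word_sum (subword u j m) v \is Num.real.
  have -> : word_sum (subword u i m) v - word_sum (subword u j m) v =
    (count_mem a (subword u i m))%:R - (count_mem a (subword u j m))%:R by rewrite !cnt; ring.
  by rewrite rpredB// realn.
apply: le_trans (real_ler_norm re) _; apply: le_trans (ler_normB _ _) _.
apply: (@le_trans _ _ (4 * (L%:R * C))).
  have -> : 4 * (L%:R * C) = 2 * (L%:R * C) + 2 * (L%:R * C) by ring.
  exact: lerD.
by apply/ltW/archi_boundP; rewrite mulr_ge0.
Qed.

End Balanced.

(** * Coincidences on two letters *)

(** The counterpart of [word_sum] in [R], used with eigenvectors of the incidence matrix. *)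
Definition weight (R : realType) b (F : 'I_b -> R) (w : seq 'I_b) : R := \sum_(a <- w) F a.

Section Weight.
Variables (R : realType) (b : nat).
Implicit Types (F : 'I_b -> R) (w : seq 'I_b).

Lemma weight_nil F : weight F [::] = 0.
Proof. by rewrite /weight big_nil. Qed.

Lemma weight_cons F a w : weight F (a :: w) = F a + weight F w.
Proof. by rewrite /weight big_cons. Qed.

Lemma weight1 F a : weight F [:: a] = F a.
Proof. by rewrite /weight big_seq1. Qed.

Lemma weight_cat F w1 w2 : weight F (w1 ++ w2) = weight F w1 + weight F w2.
Proof. by rewrite /weight big_cat. Qed.

Variables (psi : seq 'I_b -> seq 'I_b) (lam : R) (E : 'I_b -> R).
Hypothesis psiM : word_morphism psi.
Hypothesis E_eigen : forall a, weight E (psi [:: a]) = lam * E a.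

Lemma weight_morphism w : weight E (psi w) = lam * weight E w.
Proof.
elim: w => [|a w IH]; first by rewrite (morphism_nil psiM) weight_nil mulr0.
by rewrite -cat1s (morphism_cat psiM) !weight_cat IH E_eigen weight1 mulrDr.
Qed.

Lemma weight_iter n w : weight E (iter n psi w) = lam ^+ n * weight E w.
Proof.
elim: n => [|n IH]; first by rewrite mul1r.
by rewrite iterS weight_morphism IH exprS mulrA.
Qed.

Let B : R := \sum_a \sum_(c <- psi [:: a]) `|E c|.

Lemma weight_take_le k w : `|weight E (take k w)| <= \sum_(c <- w) `|E c|.
Proof.
rewrite -{2}(cat_take_drop k w) big_cat /= /weight.
by apply: ler_wpDr; [exact: sumr_ge0|exact: ler_norm_sum].
Qed.

Lemma take_morphism k w : exists i t,
  take k (psi w) = psi (take i w) ++ t /\ `|weight E t| <= B.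
Proof.
have B0 : 0 <= B by apply: sumr_ge0 => a _; exact: sumr_ge0.
elim: w k => [|a w IH] k.
  by exists 0%N, [::]; rewrite /= !(morphism_nil psiM) /= weight_nil normr0.
rewrite -cat1s (morphism_cat psiM) take_cat; case: ltnP => hk.
  exists 0%N, (take k (psi [:: a])); rewrite take0 (morphism_nil psiM); split=> //.
  apply: le_trans (weight_take_le _ _) _; rewrite /B (bigD1 a)//= lerDl.
  by apply: sumr_ge0 => c _; exact: sumr_ge0.
have [i [t [-> tB]]] := IH (k - size (psi [:: a]))%N; exists i.+1, t; split=> //.
by rewrite /= -[a :: take i w]cat1s (morphism_cat psiM) catA.
Qed.

Hypothesis lam1 : `|lam| < 1.

(** A prefix of psi^(n+1)(a) is the image of a prefix of psi^n(a) followed by a tail of weight at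
    most [B]. The bound X = S + B / (1 - |lam|) satisfies |lam| X + B <= X, so it persists. *)
Lemma prefix_weight_bounded : exists2 C : R, 0 <= C &
  forall n a k, `|weight E (take k (iter n psi [:: a]))| <= C.
Proof.
have B0 : 0 <= B by apply: sumr_ge0 => a _; exact: sumr_ge0.
pose S := \sum_a `|E a|; have S0 : 0 <= S by exact: sumr_ge0.
have d0 : 0 < 1 - `|lam| by rewrite subr_gt0.
exists (S + B / (1 - `|lam|)) => [|n a]; first by rewrite addr_ge0// divr_ge0// ltW.
elim: n => [|n IH] k.
  apply: le_trans (weight_take_le _ _) _; rewrite big_seq1 /S (bigD1 a)//= -addrA lerDl.
  by rewrite addr_ge0 ?sumr_ge0// divr_ge0// ltW.
have [i [t [-> tB]]] := take_morphism k (iter n psi [:: a]).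
rewrite weight_cat weight_morphism; apply: le_trans (ler_normD _ _) _; rewrite normrM.
apply: (@le_trans _ _ (`|lam| * (S + B / (1 - `|lam|)) + B)).
  by apply: lerD => //; apply: ler_wpM2l.
have -> : `|lam| * (S + B / (1 - `|lam|)) + B = `|lam| * S + B / (1 - `|lam|).
  by field; rewrite gt_eqF.
by rewrite lerD2r ler_piMl// ltW.
Qed.

End Weight.

(* The edge (v, a) is the step labelled a from the lattice point v to v + parikh [:: a];
   a word read from v is the broken line of its edges. *)
Local Notation vec := 'rV[int]_2.
Local Notation edge := (vec * 'I_2)%type.

Section Edges.
Variables (R : realType) (psi : seq 'I_2 -> seq 'I_2).
Hypothesis psiM : word_morphism psi.

Definition parikh (w : seq 'I_2) : vec := \row_a (count_mem a w)%:Z.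

Lemma parikh_cat w1 w2 : parikh (w1 ++ w2) = parikh w1 + parikh w2.
Proof. by apply/rowP => a; rewrite !mxE count_cat PoszD. Qed.

Lemma parikh_nil : parikh [::] = 0.
Proof. by apply/rowP => a; rewrite !mxE. Qed.

Definition parikh_mx : 'M[int]_2 := \matrix_(a, c) (count_mem c (psi [:: a]))%:Z.

Lemma parikh_morphism w : parikh (psi w) = parikh w *m parikh_mx.
Proof.
elim: w => [|a w IH]; first by rewrite (morphism_nil psiM) parikh_nil mul0mx.
rewrite -cat1s (morphism_cat psiM) !parikh_cat IH mulmxDl; congr (_ + _).
apply/rowP => c; rewrite !mxE (bigD1 a)//= big1 ?addr0.
  by rewrite !mxE /= eqxx mul1r.
by move=> i ia; rewrite !mxE /= eq_sym (negbTE ia) mul0r.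
Qed.

Fixpoint strand (v : vec) (w : seq 'I_2) : seq edge :=
  if w is a :: w' then (v, a) :: strand (v + parikh [:: a]) w' else [::].

Lemma strand_cat v w1 w2 : strand v (w1 ++ w2) = strand v w1 ++ strand (v + parikh w1) w2.
Proof.
elim: w1 v => [|a w1 IH] v; first by rewrite parikh_nil addr0.
by rewrite /= IH -[a :: w1]cat1s parikh_cat addrA.
Qed.

Lemma mem_strandP v w e : reflect
  (exists x y, w = x ++ e.2 :: y /\ e.1 = v + parikh x) (e \in strand v w).
Proof.
apply: (iffP idP) => [|[x [y [-> e1]]]]; last first.
  by rewrite strand_cat mem_cat /= in_cons -e1 -surjective_pairing eqxx orbT.
elim: w v => [//|a w IH] v; rewrite /= in_cons => /predU1P[->|/IH[x [y [-> e1]]]].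
  by exists [::], w; rewrite parikh_nil addr0.
by exists (a :: x), y; rewrite e1 -[a :: x]cat1s parikh_cat addrA.
Qed.

Definition edge_image n (e : edge) : seq edge :=
  strand (e.1 *m parikh_mx ^+ n) (iter n psi [:: e.2]).

Lemma parikh_iter n w : parikh (iter n psi w) = parikh w *m parikh_mx ^+ n.
Proof.
elim: n => [|n IH]; first by rewrite expr0 mulmx1.
by rewrite iterS parikh_morphism IH exprSr mulmxA.
Qed.

Lemma strand_iter m v w : strand (v *m parikh_mx ^+ m) (iter m psi w) =
  flatten [seq edge_image m f | f <- strand v w].
Proof.
have iM := word_morphism_iter m psiM.
elim: w v => [|a w IH] v; first by rewrite (morphism_nil iM).
rewrite -cat1s (morphism_cat iM) strand_cat /=; congr (_ ++ _).
by rewrite -IH parikh_iter mulmxDl.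
Qed.

Lemma edge_image_comp m n e f g : f \in edge_image n e -> g \in edge_image m f -> g \in edge_image (m + n) e.
Proof.
move=> fe gf; rewrite /edge_image iterD addnC exprD.
rewrite -[_ * _]/(_ *m _) mulmxA strand_iter.
by apply/flattenP; exists (edge_image m f) => //; exact: map_f.
Qed.

(** For two edges leaving one vertex, a shared edge of their images is a strong coincidence of their
    letters. *)
Definition noncoincident (e e' : edge) :=
  forall n f, f \in edge_image n e -> f \in edge_image n e' -> False.

Lemma noncoincident_sym e e' : noncoincident e e' -> noncoincident e' e.
Proof. by move=> h n f f1 f2; exact: (h n f). Qed.

Lemma noncoincident_image n e e' f f' : noncoincident e e' ->
  f \in edge_image n e -> f' \in edge_image n e' -> noncoincident f f'.
Proof.
by move=> h fe fe' m g gf gf'; apply: (h (m + n)%N g); exact: edge_image_comp gf || exact: edge_image_comp gf'.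
Qed.

Definition translate (w : vec) (e : edge) : edge := (e.1 + w, e.2).

Lemma translateK w : cancel (translate w) (translate (- w)).
Proof. by case=> v a; rewrite /translate /= addrK. Qed.

Lemma translateNK w : cancel (translate (- w)) (translate w).
Proof. by case=> v a; rewrite /translate /= subrK. Qed.

Lemma mem_image_translate n w e f :
  (f \in edge_image n (translate w e)) = (translate (- (w *m parikh_mx ^+ n)) f \in edge_image n e).
Proof.
apply/mem_strandP/mem_strandP => -[x [y [e2 e1]]]; exists x, y; split=> //=.
  by rewrite e1 /= mulmxDl addrAC addrK.
by rewrite mulmxDl addrAC -e1 /= subrK.
Qed.

Lemma noncoincident_translate w e e' :
  noncoincident e e' -> noncoincident (translate w e) (translate w e').
Proof.
move=> h n f; rewrite !mem_image_translate; exact: h.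
Qed.

End Edges.

Lemma expr_small (R : realType) (l B eps : R) : 0 <= l < 1 -> 0 <= B -> 0 < eps ->
  exists n0, forall n, (n0 <= n)%N -> l ^+ n * B <= eps.
Proof.
move=> /andP[l0 l1] B0 eps0; have d0 : 0 < 1 - l by rewrite subr_gt0.
have key n : l ^+ n * (1 + n%:R * (1 - l)) <= 1.
  elim: n => [|n IH]; first by rewrite expr0 mul0r addr0 mulr1.
  apply: le_trans IH; rewrite exprSr -mulrA ler_wpM2l ?exprn_ge0// -subr_ge0.
  have -> : 1 + n%:R * (1 - l) - l * (1 + n.+1%:R * (1 - l)) = (1 - l) ^+ 2 * n.+1%:R.
    by rewrite -natr1; ring.
  by rewrite mulr_ge0// exprn_ge0// ltW.
exists (Num.bound (B / (eps * (1 - l)))) => n hn.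
have hB : B <= eps * (n%:R * (1 - l)).
  have : B / (eps * (1 - l)) <= n%:R.
    apply: le_trans (ltW (archi_boundP _)) _; last by rewrite ler_nat.
    by rewrite divr_ge0// mulr_ge0// ltW.
  by rewrite ler_pdivrMr ?mulr_gt0// mulrCA.
have pn : 0 < 1 + n%:R * (1 - l) by rewrite ltr_pwDl// mulr_ge0// ltW.
apply: (@le_trans _ _ (l ^+ n * (eps * (1 + n%:R * (1 - l))))).
  rewrite ler_wpM2l ?exprn_ge0//; apply: le_trans hB _.
  by rewrite ler_wpM2l ?(ltW eps0)// lerDr.
by rewrite mulrCA ler_piMr// ltW.
Qed.

Lemma letter2 (a : 'I_2) : a = ord0 \/ a = ord_max.
Proof. by case: a => [[|[|//]] h]; [left|right]; apply/val_inj. Qed.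

Section Functional.
Variable R : realType.
Implicit Types (F : 'I_2 -> R) (v w : vec).

Definition functional F v : R := \sum_a (v 0 a)%:~R * F a.

Lemma functional2 F v :
  functional F v = (v 0 ord0)%:~R * F ord0 + (v 0 ord_max)%:~R * F ord_max.
Proof.
rewrite /functional big_ord_recl big_ord1; congr (_ + _%:~R * F _);
by [congr (v 0 _); apply/val_inj|apply/val_inj].
Qed.

Lemma functionalD F v w : functional F (v + w) = functional F v + functional F w.
Proof. by rewrite !functional2 !mxE !rmorphD /=; ring. Qed.

Lemma functionalN F v : functional F (- v) = - functional F v.
Proof. by rewrite !functional2 !mxE !rmorphN /=; ring. Qed.

Lemma functional0 F : functional F 0 = 0.
Proof. by rewrite functional2 !mxE; ring. Qed.

Lemma functionalMn F v k : functional F (v *+ k) = k%:R * functional F v.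
Proof.
elim: k => [|k IH]; first by rewrite mulr0n functional0 mul0r.
by rewrite mulrS functionalD IH -natr1; ring.
Qed.

Lemma functional_parikh F (w : seq 'I_2) : functional F (parikh w) = weight F w.
Proof.
elim: w => [|a w IH]; first by rewrite parikh_nil functional0 weight_nil.
rewrite -cat1s parikh_cat functionalD IH weight_cat weight1; congr (_ + _).
rewrite functional2 !mxE /=; case: (letter2 a) => ->; rewrite /=; ring.
Qed.

Lemma functional_mx psi lam F v : (forall a, weight F (psi [:: a]) = lam * F a) ->
  functional F (v *m parikh_mx psi) = lam * functional F v.
Proof.
move=> eig; rewrite /functional.
rewrite (eq_bigr (fun c => \sum_a (v 0 a)%:~R * ((parikh_mx psi a c)%:~R * F c))).
  rewrite exchange_big /= big_distrr /=; apply: eq_bigr => a _.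
  rewrite -big_distrr /= mulrCA -eig; congr (_ * _).
  rewrite -functional_parikh /functional; apply: eq_bigr => c _.
  by rewrite !mxE.
move=> c _; rewrite mxE rmorph_sum /= big_distrl /=; apply: eq_bigr => a _.
by rewrite rmorphM /= mulrA.
Qed.

Lemma functional_mxX psi lam F v n : (forall a, weight F (psi [:: a]) = lam * F a) ->
  functional F (v *m parikh_mx psi ^+ n) = lam ^+ n * functional F v.
Proof.
move=> eig; elim: n v => [|n IH] v; first by rewrite !expr0 mulmx1 mul1r.
by rewrite [parikh_mx psi ^+ n.+1]exprS mulmxA IH (functional_mx _ eig) exprSr mulrA.
Qed.

Lemma abszD_bounded (x : int) (N : nat) : (- N%:Z <= x <= N%:Z)%R ->
  (`|(x + N%:Z)%R| < (N + N).+1)%N /\ `|(x + N%:Z)%R|%N%:Z - N%:Z = x.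
Proof. by lia. Qed.

(** The signs of [E] and [T] make the determinant [D] positive, so the two functionals are
    coordinates of the plane, and Cramer's rule bounds both entries of an integer vector. *)
Lemma finite_box (E T : 'I_2 -> R) (C : R) : 0 < E ord0 -> E ord_max < 0 ->
  (forall a, 0 < T a) ->
  exists s : seq vec, forall v, `|functional E v| <= C -> `|functional T v| <= C -> v \in s.
Proof.
move=> E0 E1 T0; pose D := E ord0 * T ord_max - E ord_max * T ord0.
have D0 : 0 < D by rewrite /D; have := T0 ord0; have := T0 ord_max; nra.
pose W := (T ord_max - E ord_max) + (E ord0 + T ord0).
have W0 : 0 < W by rewrite /W; have := T0 ord0; have := T0 ord_max; lra.
pose N := Num.bound (`|C| * W / D).
have hN : `|C| * W / D <= N%:R.
  by apply/ltW/archi_boundP; rewrite divr_ge0 ?mulr_ge0// ltW.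
pose f (i j : nat) : vec := \row_a (if a == ord0 then i%:Z - N%:Z else j%:Z - N%:Z).
exists [seq f i j | i <- iota 0 (N + N).+1, j <- iota 0 (N + N).+1] => v hE hT.
have CC : C <= `|C| by exact: ler_norm.
have bound (x : int) (e t : R) : `|e| + `|t| <= W -> x%:~R * D = e * functional E v + t * functional T v ->
    (- N%:Z <= x <= N%:Z)%R.
  move=> et xD; rewrite -ler_norml -(ler_int R) intr_norm.
  apply: le_trans hN; rewrite ler_pdivlMr//.
  have -> : `|x%:~R| * D = `|x%:~R * D| by rewrite normrM (gtr0_norm D0).
  rewrite xD; apply: (le_trans (ler_normD _ _)); rewrite !normrM.
  apply: (@le_trans _ _ (`|e| * `|C| + `|t| * `|C|)).
    by apply: lerD; apply: ler_wpM2l => //; apply: le_trans CC.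
  by rewrite -mulrDl mulrC ler_wpM2l.
have T0' := T0 ord0; have T1' := T0 ord_max.
have h0 : (- N%:Z <= v 0 ord0 <= N%:Z)%R.
  apply: (@bound _ (T ord_max) (- E ord_max)); last by rewrite !functional2 /D; ring.
  rewrite gtr0_norm// normrN ltr0_norm// /W; lra.
have h1 : (- N%:Z <= v 0 ord_max <= N%:Z)%R.
  apply: (@bound _ (- T ord0) (E ord0)); last by rewrite !functional2 /D; ring.
  rewrite normrN gtr0_norm// gtr0_norm// /W; lra.
apply/allpairsP; exists (`|(v 0 ord0 + N%:Z)%R|%N, `|(v 0 ord_max + N%:Z)%R|%N); split.
- by rewrite mem_iota /=; case: (abszD_bounded h0).
- by rewrite mem_iota /=; case: (abszD_bounded h1).
- apply/rowP => a; rewrite mxE; case: (letter2 a) => -> /=; first by case: (abszD_bounded h0).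
  by case: (abszD_bounded h1).
Qed.

End Functional.

(** * Families of pairwise non-coincident edges *)

Section Families.
Variables (R : realType) (psi : seq 'I_2 -> seq 'I_2).
Hypothesis psiM : word_morphism psi.
Variables (lam beta : R) (E T : 'I_2 -> R).
Hypothesis E_eigen : forall a, weight E (psi [:: a]) = lam * E a.
Hypothesis T_eigen : forall a, weight T (psi [:: a]) = beta * T a.
Hypothesis lam1 : `|lam| < 1.
Hypothesis beta1 : 1 < beta.
Hypothesis E0 : 0 < E ord0.
Hypothesis E1 : E ord_max < 0.
Hypothesis T0 : forall a, 0 < T a.
Hypothesis E_inj : forall v : vec, functional E v = 0 -> v = 0.
Hypothesis T_inj : forall v : vec, functional T v = 0 -> v = 0.

Implicit Types (v w : vec) (e f : edge) (F U : seq edge) (s : R).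

Let ht v := functional E v.
Let tm v := functional T v.

(** [T] serves as time. The interval is half-open so that a strand crosses each level of its time
    range in exactly one edge. *)
Definition cross s e := (functional T e.1 <= s) && (s < functional T e.1 + T e.2).

Lemma weight_ge0 (x : seq 'I_2) : 0 <= weight T x.
Proof. by apply: sumr_ge0 => a _; exact: ltW. Qed.

Lemma strand_start v (x : seq 'I_2) f : f \in strand v x -> tm v <= tm f.1.
Proof.
case/mem_strandP => y [z [_ ->]]; rewrite /tm functionalD functional_parikh lerDl.
exact: weight_ge0.
Qed.

Lemma strand_cross v (x : seq 'I_2) s : tm v <= s -> s < tm v + weight T x ->
  exists2 f, f \in strand v x & cross s f.
Proof.
elim: x v => [|a x IH] v vs; first by rewrite weight_nil addr0 ltNge vs.
rewrite weight_cons addrA => sv; have [sa|as_] := ltP s (tm v + T a).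
  by exists (v, a); rewrite ?mem_head// /cross vs.
have [||f fx fs] := IH (v + parikh [:: a]).
- by rewrite /tm functionalD functional_parikh weight1.
- by rewrite /tm functionalD functional_parikh weight1.
by exists f => //; rewrite in_cons fx orbT.
Qed.

Lemma strand_cross_uniq v (x : seq 'I_2) s e f : e \in strand v x -> f \in strand v x ->
  cross s e -> cross s f -> e = f.
Proof.
elim: x v => [//|a x IH] v; rewrite /= !in_cons.
have tail g : g \in strand (v + parikh [:: a]) x -> cross s g -> cross s (v, a) -> False.
  move=> /strand_start; rewrite /tm functionalD functional_parikh weight1.
  move=> h1 /andP[h2 _] /andP[_ h3]; have := le_lt_trans (le_trans h1 h2) h3.
  by rewrite ltxx.
move=> /predU1P[->|ex] /predU1P[->|fx] //.
- by move=> h1 h2; case: (tail f fx h2 h1).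
- by move=> h1 h2; case: (tail e ex h1 h2).
- exact: IH ex fx.
Qed.

Lemma cross_translate w s e : cross (s + tm w) (translate w e) = cross s e.
Proof. by rewrite /cross /= functionalD -/(tm w) lerD2r addrAC ltrD2r. Qed.

Lemma image_cross n e s : cross s e ->
  exists2 f, f \in edge_image psi n e & cross (beta ^+ n * s) f.
Proof.
move=> /andP[h1 h2]; have b0 : 0 < beta ^+ n by rewrite exprn_gt0// (lt_trans ltr01).
apply: strand_cross; rewrite /tm (functional_mxX _ _ T_eigen) ?ler_pM2l//.
by rewrite (weight_iter psiM T_eigen) weight1 -mulrDr ltr_pM2l.
Qed.

Lemma image_height : exists2 C : R, 0 <= C & forall n e f, f \in edge_image psi n e ->
  `|ht f.1| <= `|lam| ^+ n * `|ht e.1| + C.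
Proof.
have [C C0 hC] := prefix_weight_bounded psiM E_eigen lam1; exists C => // n e f.
case/mem_strandP => x [y [xy ->]]; rewrite /ht functionalD (functional_mxX _ _ E_eigen).
apply: (le_trans (ler_normD _ _)); rewrite normrM normrX lerD2l functional_parikh.
by have := hC n e.2 (size x); rewrite xy take_size_cat.
Qed.

Definition family s F := (forall e, e \in F -> cross s e) /\
  (forall e f, e \in F -> f \in F -> e <> f -> noncoincident psi e f).

Lemma T_bounded : exists2 M : R, 0 < M & forall a, T a <= M.
Proof.
exists (T ord0 + T ord_max); first by rewrite addr_gt0.
move=> a; have := T0 ord0; have := T0 ord_max.
by case: (letter2 a) => ->; lra.
Qed.

(** A high iterate brings all heights below C + 1, while non-coincidence keeps the chosen image
    edges distinct. After one of them is moved to the origin, all lie in a box that depends neither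
    on [F] nor on the iterate. *)
Lemma family_bounded : exists K, forall s F, uniq F -> family s F -> (size F <= K)%N.
Proof.
have [C C0 hC] := image_height; have [M M0 hM] := T_bounded.
pose B := 2 * (C + 1) + M.
have [box hbox] := finite_box B E0 E1 T0.
exists (size [seq (v, a) | v <- box, a <- enum 'I_2]) => s F uF [crF ncF].
have [n hn] : exists n, forall e, e \in F -> `|lam| ^+ n * `|ht e.1| <= 1.
  pose S := \sum_(e <- F) `|ht e.1|; have S0 : 0 <= S by exact: sumr_ge0.
  have [|n0 hn0] := @expr_small R `|lam| S 1 _ S0 ltr01; first by rewrite normr_ge0.
  exists n0 => e eF; apply: le_trans (hn0 n0 (leqnn _)).
  rewrite ler_wpM2l ?exprn_ge0// /S (big_rem e)//= lerDl; exact: sumr_ge0.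
have /choice [g gP] : forall e, exists f, cross s e ->
    f \in edge_image psi n e /\ cross (beta ^+ n * s) f.
  move=> e; have [/(image_cross n)[f f1 f2]|ne] := boolP (cross s e); first by exists f.
  by exists e => h; case/negP: ne.
have gF e : e \in F -> g e \in edge_image psi n e /\ cross (beta ^+ n * s) (g e).
  by move=> /crF/gP.
case: F uF crF ncF hn gF => [//|e0 F0]; set F := e0 :: F0 => uF crF ncF hn gF.
have ug : uniq (map g F).
  rewrite map_inj_in_uniq// => e f eF fF egf; apply: contrapT => nef.
  have := ncF e f eF fF nef; move=> /(_ n (g e)); apply; first by case: (gF e eF).
  by rewrite egf; case: (gF f fF).
have hg e : e \in F -> `|ht (g e).1| <= C + 1.
  move=> eF; have [h1 _] := gF e eF; apply: (le_trans (hC _ _ _ h1)).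
  by rewrite addrC lerD2l hn.
have e0F : e0 \in F by rewrite mem_head.
have ht0 := hg e0 e0F; have [_ /andP[t1 t2]] := gF e0 e0F.
have tr_inj : injective (translate (- (g e0).1)) by exact: (can_inj (translateNK _)).
rewrite -(size_map g F) -(size_map (translate (- (g e0).1)) (map g F)).
apply: uniq_leq_size; first by rewrite map_inj_uniq.
move=> _ /mapP[_ /mapP[e eF ->] ->]; apply/allpairsP.
have [_ /andP[s1 s2]] := gF e eF; have hte := hg e eF.
exists ((g e).1 - (g e0).1, (g e).2); split; rewrite ?mem_enum//=.
apply: hbox; rewrite functionalD functionalN.
- apply: (le_trans (ler_normB _ _)); rewrite -/(ht _) -/(ht _) /B; lra.
- have h1 := hM (g e0).2; have h2 := hM (g e).2.
  have BM : M <= B by rewrite /B; lra.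
  by apply: le_trans BM; rewrite ler_norml; lra.
Qed.

Lemma maximal_family : exists k (F : seq edge) s,
  [/\ (0 < k)%N, uniq F, family s F, size F = k &
      forall s' F', uniq F' -> family s' F' -> (size F' <= k)%N].
Proof.
have [K hK] := family_bounded.
pose P (m : nat) := `[< exists F s, [/\ uniq F, family s F & size F = m] >].
have P1 : P 1%N.
  apply/asboolP; exists [:: (0, ord0)], 0; split=> //; split.
    move=> e; rewrite inE => /eqP ->; rewrite /cross /= functional0 lexx add0r.
    exact: T0.
  by move=> e f; rewrite !inE => /eqP -> /eqP ->.
have PK m : P m -> (m <= K)%N by move=> /asboolP[F [s [uF fF <-]]]; exact: hK fF.
case: (ex_maxnP (ex_intro P _ P1) PK) => k /asboolP[F [s [uF fF sF]]] maxk.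
exists k, F, s; split=> //; first exact: maxk.
by move=> s' F' uF' fF'; apply: maxk; apply/asboolP; exists F', s'.
Qed.

Hypothesis nc01 : noncoincident psi (0, ord0) (0, ord_max).

Lemma noncoincident_vertex e f : e.1 = f.1 -> e <> f -> noncoincident psi e f.
Proof.
case: e f => [v a] [v' c] /= <- ne.
have h := noncoincident_translate (w := v) nc01; rewrite /translate /= add0r in h.
case: (letter2 a) ne => ->; case: (letter2 c) => -> // _.
exact: noncoincident_sym.
Qed.

Lemma family_translate w s F : family s F -> family (s + tm w) (map (translate w) F).
Proof.
move=> [cr nc]; split=> [_ /mapP[e eF ->]|_ _ /mapP[e eF ->] /mapP[f fF ->] ne].
  by rewrite cross_translate; exact: cr.
by apply: noncoincident_translate => //; apply: nc => // ef; apply: ne; rewrite ef.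
Qed.

(** [k] will be the maximal size of a family. Distinct edges are counted, because a concatenation of
    images may list an edge several times. *)
Definition full k U (sa sb : R) := forall s, sa <= s < sb ->
  family s ([seq e <- U | cross s e]) /\ size (undup ([seq e <- U | cross s e])) = k.

Lemma count_lt (S : eqType) (P Q : pred S) (r : seq S) x :
  subpred P Q -> x \in r -> Q x -> ~~ P x -> (count P r < count Q r)%N.
Proof.
move=> PQ xr Qx nPx; apply: (@leq_trans (count (predU P (pred1 x)) r)); last first.
  by apply: sub_count => y /orP[/PQ//|/eqP ->].
have := count_predUI P (pred1 x) r.
have -> : count (predI P (pred1 x)) r = 0%N.
  apply/eqP; rewrite -leqn0 leqNgt -has_count; apply/hasPn => y _ /=.
  by apply/negP => /andP[Py /eqP yx]; rewrite -yx Py in nPx.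
rewrite addn0 => ->; rewrite -addn1 leq_add2l -has_count.
by rewrite has_pred1.
Qed.

(* The edges of a maximal family just after a time t are forced by those before t:
   two different continuations from the same vertex would be noncoincident, and
   adjoining one to the other would produce a larger family. *)
Lemma determinism k U (sa sb t0 : R) w :
  (forall s F, uniq F -> family s F -> (size F <= k)%N) ->
  full k U sa sb -> 0 <= tm w -> sa <= t0 ->
  (forall e, cross t0 e -> (e \in U) = (translate w e \in U)) ->
  forall e, t0 < tm e.1 -> tm e.1 + tm w < sb -> (e \in U) = (translate w e \in U).
Proof.
move=> maxk fullU w0 sat agree e.
(* Times are real, so the induction is on the number of edges of [U] and of its translate that start
   before [e]. *)
pose Z := U ++ map (translate (- w)) U.
have [N] := ubnP (count (fun f => tm f.1 < tm e.1) Z).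
elim: N e => // N IH e; rewrite ltnS => cN te teb; set t := tm e.1 in cN te teb.
have t_in : sa <= t < sb by rewrite (le_trans sat (ltW te)) (le_lt_trans _ teb)// lerDl.
have tw_in : sa <= t + tm w < sb by rewrite teb andbT (le_trans (le_trans sat (ltW te)))// lerDl.
have [fam1 size1] := fullU _ t_in; have [fam2' size2'] := fullU _ tw_in.
set F1 := seq.filter _ _ in fam1 size1.
set F2' := seq.filter _ _ in fam2' size2'; pose F2 := map (translate (- w)) F2'.
have fam2 : family t F2.
  have -> : t = t + tm w + tm (- w) by rewrite /tm functionalN; ring.
  exact: family_translate.
have size2 : size (undup F2) = k.
  by rewrite undup_map_inj ?size_map//; exact: (can_inj (translateNK _)).
have memF1 f : (f \in F1) = cross t f && (f \in U) by rewrite mem_filter.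
have memF2 f : (f \in F2) = cross t f && (translate w f \in U).
  rewrite -{1}[f](translateK w) mem_map; last exact: (can_inj (translateNK _)).
  by rewrite mem_filter cross_translate.
have early f : (f \in F1) || (f \in F2) -> tm f.1 < t -> (f \in F1) && (f \in F2).
  move=> fF ft.
  have crf : cross t f by move: fF; rewrite memF1 memF2 => /orP[] /andP[].
  have fU : (f \in U) || (translate w f \in U).
    by move: fF; rewrite memF1 memF2 crf.
  suff eqf : (f \in U) = (translate w f \in U).
    by rewrite memF1 memF2 crf /=; move: fU; rewrite -eqf orbb => ->.
  have [ft0|tf0] := leP (tm f.1) t0.
    apply: agree; rewrite /cross ft0 /=; move: crf => /andP[_]; exact: lt_trans.
  apply: IH => //; last by apply: lt_trans teb; rewrite ltrD2r.
  apply: leq_trans cN; apply: (count_lt (x := f)); rewrite ?ltxx ?ft//.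
    by move=> g /= gf; exact: lt_trans ft.
  rewrite mem_cat; case/orP: fU => [->//|fU]; apply/orP; right.
  by rewrite -[f](translateK w) map_f.
(* Edges that started before the level lie in both families by induction. The others start exactly
   at the level, so by [T_inj] they share their vertex and distinct ones are noncoincident. The
   union is thus a family, and maximality makes it equal to both. *)
pose G := undup (F1 ++ F2).
have memG f : (f \in G) = (f \in F1) || (f \in F2) by rewrite mem_undup mem_cat.
have famG : family t G.
  split=> [f|f g]; rewrite !memG.
    by case/orP => [/(fam1.1)|/(fam2.1)].
  have main a c : a \in F1 -> c \in F2 -> a <> c -> noncoincident psi a c.
    move=> aF cF ac.
    have [at_|ta] := ltP (tm a.1) t.
      by have := early a; rewrite aF => /(_ isT at_) aF2; apply: fam2.2.
    have [ct|tc] := ltP (tm c.1) t.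
      by have := early c; rewrite cF orbT => /(_ isT ct)/andP[cF1 _]; apply: fam1.2.
    apply: noncoincident_vertex => //.
    have /andP[at' _] := fam1.1 a aF; have /andP[ct' _] := fam2.1 c cF.
    apply/eqP; rewrite -subr_eq0; apply/eqP/T_inj; rewrite functionalD functionalN.
    apply/eqP; rewrite subr_eq0; apply/eqP/le_anti.
    by rewrite (le_trans at' tc) (le_trans ct' ta).
  move=> /orP[fF|fF] /orP[gF|gF] ne.
  - exact: fam1.2.
  - exact: main.
  - by apply/noncoincident_sym/main => // /esym.
  - exact: fam2.2.
have sizeG : (size G <= k)%N by apply: maxk famG; exact: undup_uniq.
have G1 : undup F1 =i G.
  apply: (uniq_min_size (undup_uniq _) _ _).2; last by rewrite size1.
  by move=> f; rewrite mem_undup memG => ->.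
have G2 : undup F2 =i G.
  apply: (uniq_min_size (undup_uniq _) _ _).2; last by rewrite size2.
  by move=> f; rewrite mem_undup memG orbC => ->.
have cre : cross t e by rewrite /cross lexx ltrDl T0.
have := G1 e; rewrite -G2 !mem_undup memF1 memF2 cre /=.
by [].
Qed.

Lemma common_duration (F : seq edge) s : (forall e, e \in F -> cross s e) ->
  exists2 tau : R, 0 < tau & forall e, e \in F -> s + tau <= tm e.1 + T e.2.
Proof.
elim: F => [|e F IH] cr; first by exists 1.
have [|tau tau0 h] := IH; first by move=> f fF; apply: cr; rewrite in_cons fF orbT.
have /andP[_ se] := cr e (mem_head _ _).
exists (Num.min tau (tm e.1 + T e.2 - s)).
  by rewrite lt_min tau0 subr_gt0.
move=> f; rewrite in_cons -lerBrDl => /predU1P[->|fF]; first by rewrite ge_min lexx orbT.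
by rewrite ge_min lerBrDl h.
Qed.

(** Images of distinct edges of the family stay noncoincident and each image strand crosses a level
    once. The maximal size therefore persists over a time window, which [beta ^+ n] stretches at
    will. *)
Lemma full_edge_images k (F0 : seq edge) s0 : uniq F0 -> family s0 F0 -> size F0 = k ->
  (forall s F, uniq F -> family s F -> (size F <= k)%N) ->
  exists2 tau : R, 0 < tau & forall n,
    full k (flatten [seq edge_image psi n e | e <- F0]) (beta ^+ n * s0)
      (beta ^+ n * (s0 + tau)).
Proof.
move=> uF [cr nc] sF maxk; have [tau tau0 htau] := common_duration cr.
exists tau => // n s /andP[sa sb]; have b0 : 0 < beta ^+ n by rewrite exprn_gt0// (lt_trans ltr01).
set U := flatten _; pose s' := s / beta ^+ n.
have sE : beta ^+ n * s' = s by rewrite /s' mulrCA mulfV ?mulr1// gt_eqF.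
have cr' e : e \in F0 -> cross s' e.
  move=> eF; have /andP[h1 _] := cr e eF; apply/andP; split.
    by apply: le_trans h1 _; rewrite ler_pdivlMr// mulrC.
  by apply: lt_le_trans (htau e eF); rewrite ltr_pdivrMr// mulrC.
have memU f : f \in [seq e <- U | cross s e] ->
    cross s f /\ exists2 e, e \in F0 & f \in edge_image psi n e.
  rewrite mem_filter => /andP[crf /flattenP[_ /mapP[e eF ->] fe]]; split=> //.
  by exists e.
have fam : family s ([seq e <- U | cross s e]).
  split=> [f /memU[]//|f g /memU[cf [e eF fe]] /memU[cg [e' eF' ge]] ne].
  have [ee|/eqP ee] := eqVneq e e'; last exact: noncoincident_image (nc _ _ eF eF' ee) fe ge.
  by case: ne; rewrite -ee in ge; exact: strand_cross_uniq fe ge cf cg.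
split=> //; apply/eqP; rewrite eqn_leq; apply/andP; split.
  apply: (maxk s); first exact: undup_uniq.
  by case: fam => h1 h2; split=> [e|e f]; rewrite !mem_undup; [exact: h1|exact: h2].
have /choice [g gP] : forall e, exists f, cross s' e ->
    f \in edge_image psi n e /\ cross s f.
  move=> e; have [/(image_cross n)|ne] := boolP (cross s' e).
    by rewrite sE => -[f f1 f2]; exists f.
  by exists e => h; case/negP: ne.
rewrite -sF -(size_map g); apply: uniq_leq_size.
  rewrite map_inj_in_uniq// => e f eF fF egf; apply: contrapT => nef.
  have [ge _] := gP e (cr' e eF); have [gf _] := gP f (cr' f fF).
  by apply: (nc e f eF fF nef n (g e)) => //; rewrite egf.
move=> _ /mapP[e eF ->]; have [ge ce] := gP e (cr' e eF).
rewrite mem_undup mem_filter ce; apply/flattenP.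
by exists (edge_image psi n e) => //; exact: map_f.
Qed.

Lemma separated_from_zero (F : 'I_2 -> R) (s : seq vec) :
  (forall v, functional F v = 0 -> v = 0) ->
  exists2 d : R, 0 < d & forall v, v \in s -> v != 0 -> d <= `|functional F v|.
Proof.
move=> inj; elim: s => [|v s [d d0 hd]]; first by exists 1.
have [->|v0] := eqVneq v 0.
  by exists d => // w; rewrite in_cons => /predU1P[->|]; [rewrite eqxx|exact: hd].
exists (Num.min d `|functional F v|).
  by rewrite lt_min d0 normr_gt0; apply: contra v0 => /eqP/inj ->.
move=> w; rewrite in_cons => /predU1P[->|ws] w0; first by rewrite ge_min lexx orbT.
by rewrite ge_min hd.
Qed.

(** The order of the choices matters: [q], [delta], [J] and [X] depend on the maximal family but not
    on the iterate [n], which is taken last, large enough to hold [J] successive translations by the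
    period. Their total height then exceeds the bound [2 * H]. *)
Lemma not_noncoincident_letters : False.
Proof.
have [k [F0 [s0 [k0 uF famF sF maxk]]]] := maximal_family.
have [tau tau0 fullF] := full_edge_images uF famF sF maxk.
have [C C0 hC] := image_height; have [M M0 hM] := T_bounded.
pose H := \sum_(e <- F0) `|ht e.1| + C.
have H0 : 0 <= H by rewrite addr_ge0// sumr_ge0.
pose U n := flatten [seq edge_image psi n e | e <- F0].
have heightU n f : f \in U n -> `|ht f.1| <= H.
  move=> /flattenP[_ /mapP[e eF ->] fe]; apply: (le_trans (hC _ _ _ fe)).
  rewrite lerD2r (big_rem e)//= -[leLHS]addr0; apply: lerD; last exact: sumr_ge0.
  by rewrite ler_piMl// exprn_ile1// ltW.
have [box hbox] := finite_box (2 * H + M) E0 E1 T0.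
pose cand := [seq (v, a) | v <- box, a <- enum 'I_2].
(* Relative to a vertex of [U n], the edges of [U n] that cross its level lie in [cand]. So [q]
   bounds the number of local patterns for every [n]. *)
pose q := #|{ffun 'I_(size cand) -> bool}|.
(* The period will have height at most [2 * H] and time at most [q.+1%:R * M]. It lies in a finite
   box, so [E_inj] gives a lower bound for its height before it is known. *)
have [box2 hbox2] := finite_box (2 * H + q.+1%:R * M) E0 E1 T0.
have [delta delta0 hdelta] := separated_from_zero box2 E_inj.
pose J := Num.bound (2 * H / delta).
have hJ : 2 * H < J%:R * delta.
  by rewrite -ltr_pdivrMr//; apply: archi_boundP; rewrite divr_ge0 ?mulr_ge0// ltW.
(* Room for the [q.+1] sampled levels and for [J.+1] translations, each of time at most
   [q.+1%:R * M]. *)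
pose X := (q.+1%:R + J.+1%:R * q.+1%:R) * M.
have X0 : 0 <= X by rewrite mulr_ge0 ?addr_ge0 ?mulr_ge0// ltW.
have bgt0 : 0 < beta by apply: lt_trans beta1.
have [|n0 hn0] := @expr_small R beta^-1 X tau _ X0 tau0.
  by rewrite invr_ge0 ltW// invf_lt1.
pose n := n0; have bn0 : 0 < beta ^+ n by rewrite exprn_gt0.
have hX : X <= beta ^+ n * tau.
  by have := hn0 n (leqnn _); rewrite exprVn mulrC ler_pdivrMr// mulrC.
have := fullF n; rewrite -/(U n); set sa := beta ^+ n * s0; set sb := _ * (s0 + tau) => fullU.
have sbE : sb = sa + beta ^+ n * tau by rewrite /sb mulrDr.
(* Levels are spaced by the maximal duration [M], so edges sampled later start strictly later. The
   index [i.+1] instead of [i] keeps the start of each sampled edge inside the window. *)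
have pick (i : nat) : (i <= q)%N -> exists2 f, f \in U n & cross (sa + i.+1%:R * M) f.
  move=> iq; have in_ab : sa <= sa + i.+1%:R * M < sb.
    rewrite lerDl mulr_ge0 ?(ltW M0)//= sbE ltrD2l; apply: lt_le_trans hX.
    rewrite /X ltr_pM2r//; apply: (@le_lt_trans _ _ q.+1%:R); first by rewrite ler_nat.
    by rewrite ltrDl mulr_gt0.
  have [_ sz] := fullU _ in_ab.
  case eF : [seq e <- U n | cross (sa + i.+1%:R * M) e] sz => [|f r] sz.
    by rewrite -sz in k0.
  have : f \in [seq e <- U n | cross (sa + i.+1%:R * M) e] by rewrite eF mem_head.
  by rewrite mem_filter => /andP[cf fU]; exists f.
have /choice [g gP] : forall i : nat, exists f, (i <= q)%N ->
    f \in U n /\ cross (sa + i.+1%:R * M) f.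
  move=> i; have [/pick[f f1 f2]|qi] := leqP i q; first by exists f.
  by exists (0, ord0).
pose S (v : vec) : {ffun 'I_(size cand) -> bool} :=
  [ffun i => translate v (tnth (in_tuple cand) i) \in U n].
have [i [j [ij jq eS]]] : exists i j : nat, [/\ (i < j)%N, (j <= q)%N & S (g i).1 = S (g j).1].
  have ninj : ~ injective (fun i : 'I_q.+1 => S (g i).1).
    by move=> /leq_card; rewrite card_ord ltnn.
  apply: contrapT => nex; apply: ninj => i j e; apply/val_inj.
  case: (ltngtP i j) => // lt; exfalso; apply: nex.
    by exists i, j; split=> //; rewrite -ltnS.
  by exists j, i; split=> //; rewrite -ltnS.
have [gi ci] := gP i (ltnW (leq_trans ij jq)); have [gj cj] := gP j jq.
set fi := g i in eS gi ci; set fj := g j in eS gj cj.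
pose w := fj.1 - fi.1.
have htw : `|ht w| <= 2 * H.
  rewrite /ht functionalD functionalN; apply: (le_trans (ler_normB _ _)).
  have := heightU _ _ gi; have := heightU _ _ gj; rewrite /ht; lra.
have twE : tm w = tm fj.1 - tm fi.1 by rewrite /tm functionalD functionalN.
move: ci cj => /andP[ci1 ci2] /andP[cj1 cj2]; rewrite -!/(tm _) in ci1 ci2 cj1 cj2.
have Mi := hM fi.2; have Mj := hM fj.2.
have ijR : i.+1%:R + 1 <= j.+1%:R :> R by rewrite natr1 ler_nat.
have jqR : j.+1%:R <= q.+1%:R :> R by rewrite ler_nat.
have ijM : i.+1%:R * M + M <= j.+1%:R * M.
  by rewrite -[X in _ + X <= _]mul1r -mulrDl ler_wpM2r// ltW.
have jqM : j.+1%:R * M <= q.+1%:R * M by rewrite ler_wpM2r// ltW.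
have i0M : M <= i.+1%:R * M by rewrite ler_peMl ?ler1n// ltW.
have tw0 : 0 < tm w by rewrite twE; lra.
have twq : tm w <= q.+1%:R * M by rewrite twE; lra.
have tfi : sa <= tm fi.1 by lra.
have w_n0 : w != 0 by apply: contraTneq tw0 => ->; rewrite /tm functional0 ltxx.
(* Equal patterns mean that [U n] is invariant under [w] at the level of [fi.1]; for an edge outside
   [cand] both memberships fail because of the heights. *)
have agree e : cross (tm fi.1) e -> (e \in U n) = (translate w e \in U n).
  move=> ce; pose x := translate (- fi.1) e.
  have xcand : `|ht x.1| <= 2 * H -> x \in cand.
    move=> hx; apply/allpairsP; exists x; rewrite mem_enum -surjective_pairing; split=> //.
    apply: hbox; first by apply: (le_trans hx); rewrite lerDl ltW.
    rewrite functionalD functionalN; case/andP: ce; rewrite -/(tm _) -/(tm _) => h1 h2.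
    by have := hM e.2; rewrite ler_norml; lra.
  have eqx : x \in cand -> (e \in U n) = (translate w e \in U n).
    move=> xc; have xi : (index x cand < size cand)%N by rewrite index_mem.
    have := congr1 (fun f : {ffun 'I_(size cand) -> bool} => f (Ordinal xi)) eS.
    rewrite !ffunE (tnth_nth x) /= nth_index// /x translateNK => ->.
    suff -> : translate fj.1 (translate (- fi.1) e) = translate w e by [].
    rewrite /translate /=; congr (_, _).
    by rewrite /w addrA addrAC.
  have [eU|neU] := boolP (e \in U n).
    rewrite -eqx// xcand// /ht functionalD functionalN; apply: (le_trans (ler_normB _ _)).
    have := heightU _ _ gi; have := heightU _ _ eU; rewrite /ht; lra.
  have [wU|//] := boolP (translate w e \in U n).
  have := heightU _ _ wU; rewrite /translate /= /ht functionalD => h1.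
  have xc : x \in cand.
    apply: xcand; rewrite /ht /x /= functionalD functionalN.
    have -> : functional E e.1 - functional E fi.1 =
      (functional E e.1 + functional E w) - functional E fj.1.
      by rewrite /w functionalD functionalN; ring.
    apply: (le_trans (ler_normB _ _)); have := heightU _ _ gj; rewrite /ht; lra.
  by move: neU; rewrite eqx// wU.
have iterU m : (m <= J)%N -> translate (w *+ m) fj \in U n.
  elim: m => [_|m IH mJ]; first by rewrite mulr0n /translate addr0 -surjective_pairing.
  have mJR : m%:R + 1 <= J%:R :> R by rewrite natr1 ler_nat.
  have mw : (m%:R + 1) * tm w <= J%:R * (q.+1%:R * M).
    by apply: ler_pM; rewrite ?addr_ge0 ?(ltW tw0).
  have mw0 : 0 <= m%:R * tm w by rewrite mulr_ge0// ltW.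
  have -> : translate (w *+ m.+1) fj = translate w (translate (w *+ m) fj).
    by rewrite /translate /= mulrSr addrA.
  set f := translate (w *+ m) fj in IH *.
  have tf : tm f.1 = tm fj.1 + m%:R * tm w by rewrite /tm /f /= functionalD functionalMn.
  have qM0 : 0 < q.+1%:R * M by rewrite mulr_gt0.
  have d1 : tm fi.1 < tm f.1 by rewrite tf; lra.
  have d2 : tm f.1 + tm w < sb.
    rewrite tf sbE; have h1 : X <= beta ^+ n * tau := hX.
    have XE : X = q.+1%:R * M + J%:R * (q.+1%:R * M) + q.+1%:R * M.
      by rewrite /X -[J.+1%:R]natr1; ring.
    move: mw; rewrite mulrDl mul1r; lra.
  have det := determinism maxk fullU (ltW tw0) tfi agree d1 d2.
  by rewrite -det; apply: IH; exact: ltnW.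
have := heightU _ _ (iterU J (leqnn _)); rewrite /translate /= /ht functionalD functionalMn => hJ1.
have hJ2 := heightU _ _ gj; rewrite /ht in hJ2.
have : J%:R * `|functional E w| <= 2 * H.
  have -> : J%:R * `|functional E w| = `|functional E fj.1 + J%:R * functional E w - functional E fj.1|.
    by rewrite addrAC subrr add0r normrM normr_nat.
  by apply: (le_trans (ler_normB _ _)); lra.
have dw : delta <= `|functional E w|.
  apply: hdelta => //; apply: hbox2.
    by apply: (le_trans htw); rewrite lerDl mulr_ge0// ltW.
  by rewrite -/(tm w) gtr0_norm//; apply: (le_trans twq); rewrite lerDr mulr_ge0.
have : J%:R * delta <= J%:R * `|functional E w| by rewrite ler_wpM2l.
lra.
Qed.

End Families.

(** * Decay of non-coincidences under iteration *)

(** A discrete intermediate value theorem: the difference of two counters with steps 0 or 1 changes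
    by at most 1. *)
Lemma count_crossing (a b : nat -> nat) (i j : nat) :
  (forall k, (a k <= a k.+1 <= (a k).+1)%N) -> (forall k, (b k <= b k.+1 <= (b k).+1)%N) ->
  (i <= j)%N -> (a i <= b i)%N -> (b j <= a j)%N ->
  exists k, (i <= k <= j)%N /\ a k = b k.
Proof.
move=> ha hb /subnKC <-; elim: (j - i)%N => [|d IH] h1 h2.
  by exists i; rewrite addn0 in h2 *; lia.
have [h3|h3] := leqP (b (i + d)%N) (a (i + d)%N).
  by have [k [k1 k2]] := IH h1 h3; exists k; split=> //; lia.
exists (i + d.+1)%N; have := ha (i + d)%N; have := hb (i + d)%N.
by rewrite addnS in h2 *; split; lia.
Qed.

Lemma perm_eq2 (v w : seq 'I_2) : size v = size w ->
  perm_eq v w = (count_mem ord0 v == count_mem ord0 w).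
Proof.
move=> svw; apply/idP/eqP => [/permP/(_ (pred1 ord0))//|e].
have e2 (x : seq 'I_2) : (count_mem ord0 x + count_mem ord_max x)%N = size x.
  elim: x => //= a x <-; case: (letter2 a) => -> /=; lia.
apply/allP => a _ /=; case: (letter2 a) => ->; first by rewrite e.
have := e2 v; have := e2 w; rewrite -svw e => h1 h2.
by rewrite -(eqn_add2l (count_mem ord0 w)) h2 h1.
Qed.

Lemma weight2 (R : realType) (E : 'I_2 -> R) (w : seq 'I_2) :
  weight E w = (size w)%:R * E ord_max + (count_mem ord0 w)%:R * (E ord0 - E ord_max).
Proof.
elim: w => [|a w IH]; first by rewrite weight_nil !mul0r addr0.
rewrite weight_cons IH /= natrD -[(size w).+1%:R]natr1.
by case: (letter2 a) => -> /=; ring.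
Qed.

Section Decay.
Variables (R : realType) (psi : seq 'I_2 -> seq 'I_2) (u : nat -> 'I_2).
Hypothesis psiM : word_morphism psi.
Hypothesis psi_u : prefix_stable psi u.
Hypothesis psi_pos : forall a c, c \in psi [:: a].
Hypothesis psi_long : forall a, (1 < size (psi [:: a]))%N.
Variables (lam beta : R) (E T : 'I_2 -> R).
Hypothesis E_eigen : forall a, weight E (psi [:: a]) = lam * E a.
Hypothesis T_eigen : forall a, weight T (psi [:: a]) = beta * T a.
Hypothesis lam1 : `|lam| < 1.
Hypothesis beta1 : 1 < beta.
Hypothesis E0 : 0 < E ord0.
Hypothesis E1 : E ord_max < 0.
Hypothesis T0 : forall a, 0 < T a.
Hypothesis E_inj : forall v : vec, functional E v = 0 -> v = 0.
Hypothesis T_inj : forall v : vec, functional T v = 0 -> v = 0.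

(** An edge shared by the images of the two edges at the origin is exactly such a decomposition,
    since its vertex records the counts of the prefix before it. *)
Lemma strong_coincidence : exists m x y x' y' c,
  [/\ iter m psi [:: ord0] = x ++ c :: y, iter m psi [:: ord_max] = x' ++ c :: y' &
      perm_eq x x'].
Proof.
apply: contrapT => none.
apply: (not_noncoincident_letters psiM E_eigen T_eigen lam1 beta1 E0 E1 T0 E_inj T_inj).
move=> m f /mem_strandP[x [y [e1 f1]]] /mem_strandP[x' [y' [e2 f2]]]; apply: none.
exists m, x, y, x', y', f.2; split=> //.
apply/allP => a _ /=; move: f1; rewrite f2 => /addrI/rowP/(_ a).
by rewrite !mxE => -[->].
Qed.

Let prefE i := weight E (subword u 0 i).

Lemma prefix_E_bounded : exists2 C : R, 0 <= C & forall i, `|prefE i| <= C.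
Proof.
have [C C0 hC] := prefix_weight_bounded psiM E_eigen lam1; exists C => // i.
have ii := size_iter_ge psiM psi_long i (u 0%N).
have := prefix_stable_iter i psi_u 1; rewrite subword1 => e.
by have := hC i (u 0%N) i; rewrite e take_subword// ltnW.
Qed.

Lemma near_supremum (eps : R) : 0 < eps ->
  exists j, forall i, prefE i <= prefE j + eps.
Proof.
move=> eps0; have [C C0 hC] := prefix_E_bounded.
pose S := [set prefE i | i in setT]%classic.
have supS : has_sup S.
  split; first by exists (prefE 0), 0%N.
  by exists C => _ [i _ <-]; apply: le_trans (ler_norm _) (hC i).
have [_ [j _ <-] hj] := sup_adherent eps0 supS.
exists j => i; have : prefE i <= sup S by apply: ub_le_sup; [case: supS|exists i].
by rewrite ltrBlDr in hj; move=> /le_trans; apply; exact: ltW.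
Qed.

(** A near-maximum [j0] is copied into every block psi^m(u_j) with u_j = u_0. Its weight changes by
    lam^m [prefE j] only, negligible for large [m], and such blocks recur with bounded gaps. *)
Lemma recurrent_high (eps : R) : 0 < eps -> exists N, forall k,
  exists2 i, (k <= i <= k + N)%N & forall j, prefE j <= prefE i + eps.
Proof.
move=> eps0; have e2 : 0 < eps / 2 by rewrite divr_gt0.
have [j0 hj0] := near_supremum e2; have [C C0 hC] := prefix_E_bounded.
have [|n0 hn0] := @expr_small R `|lam| C (eps / 2) _ C0 e2; first by rewrite normr_ge0.
pose m := (n0 + j0)%N.
have mj0 : (j0 < size (iter m psi [:: u 0%N]))%N.
  by apply: leq_ltn_trans (size_iter_ge psiM psi_long _ _); rewrite /m leq_addl.
pose L := (\max_a size (iter m psi [:: a]))%N.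
have leL a : (size (iter m psi [:: a]) <= L)%N.
  exact: (leq_bigmax (F := fun a => size (iter m psi [:: a])) a).
have [K recK] := uniform_recurrence psiM psi_u psi_pos.
exists (L + K * L + j0)%N => k.
have [t /andP[kt tk]] := next_block u psiM k leL.
have [j /andP[tj jK] uj] := recK t (u 0%N).
have grow d : (image_pos psi u m (t + d) <= image_pos psi u m t + d * L)%N.
  elim: d => [|d IH]; first by rewrite addn0 leq_addr.
  by rewrite addnS (image_posS _ psiM) mulSn [(L + _)%N]addnC addnA leq_add.
have pj : (image_pos psi u m t <= image_pos psi u m j <= image_pos psi u m t + K * L)%N.
  rewrite image_pos_mono//=; have := grow (j - t)%N; rewrite subnKC//.
  have : ((j - t) * L <= K * L)%N by rewrite leq_mul2r leq_subLR (ltnW jK) orbT.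
  by clear; lia.
exists (image_pos psi u m j + j0)%N; first by clear - kt tk pj; lia.
have valE : prefE (image_pos psi u m j + j0)%N = lam ^+ m * prefE j + prefE j0.
  rewrite /prefE subwordD weight_cat add0n; congr (_ + _).
    rewrite -(weight_iter psiM E_eigen); congr (weight _ _).
    by have := prefix_stable_iter m psi_u j.
  congr (weight _ _); have := image_blockE psiM psi_u m j; rewrite uj => e.
  rewrite -(take_subword u _ (ltnW mj0)) -e.
  have := prefix_stable_iter m psi_u 1; rewrite subword1 => ->.
  by rewrite take_subword// ltnW.
move=> i; rewrite valE; apply: (le_trans (hj0 i)).
set X := lam ^+ m * prefE j; have h : `|X| <= eps / 2.
  rewrite normrM normrX; apply: le_trans (hn0 m (leq_addr _ _)).
  by rewrite ler_wpM2l ?exprn_ge0.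
by move: h; rewrite ler_norml => /andP[h _]; clearbody X; lra.
Qed.

Variable q : nat.
Hypothesis q0 : (0 < q)%N.
Hypothesis uq : u q = u 0%N.

Definition shift_at n := size (iter n psi (subword u 0 q)).

(** The strand of [u] and that of its shift share the vertex reached after [i] letters. *)
Let zero n i := perm_eq (subword u 0 i) (subword u (shift_at n) i).

(** The difference of the two counts of one letter, times [g], is the difference of the contracting
    weights. At a near-maximum of the first weight the count difference exceeds -1, at one of the
    second it is below 1. As an integer it is non-negative at one place and non-positive at the
    other, and it vanishes in between. *)
Lemma zero_gaps : exists N n0, forall n, (n0 <= n)%N -> forall k,
  exists2 i, (k <= i <= k + N)%N & zero n i.
Proof.
pose g := E ord0 - E ord_max; have g0 : 0 < g by rewrite subr_gt0 (lt_trans E1).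
(* A quarter for the near-maximum and a quarter for [prefE (shift_at n)] stay below one unit [g]. *)
have g4 : 0 < g / 4 by rewrite divr_gt0.
have [N hN] := recurrent_high g4.
have [|n0 hn0] := @expr_small R `|lam| `|prefE q| (g / 4) _ (normr_ge0 _) g4; first by rewrite normr_ge0.
exists N, n0 => n /hn0 small k.
have shE : `|prefE (shift_at n)| <= g / 4.
  apply: le_trans small; rewrite -normrX -normrM -(weight_iter psiM E_eigen).
  by rewrite /prefE /shift_at -(prefix_stable_iter n psi_u q).
pose a i := count_mem ord0 (subword u 0 i).
pose b i := count_mem ord0 (subword u (shift_at n) i).
have step x i : (count_mem ord0 (subword u x i) <= count_mem ord0 (subword u x i.+1) <=
    (count_mem ord0 (subword u x i)).+1)%N.
  by rewrite subwordS -cats1 count_cat /=; rewrite addn0 leq_addr; case: (_ == _) => /=; rewrite ?addn0 ?addn1 ?leqnSn ?leqnn.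
have diffE i : prefE i - (prefE (shift_at n + i) - prefE (shift_at n)) =
    ((a i)%:R - (b i)%:R) * g.
  rewrite /prefE subwordD weight_cat add0n !weight2 !size_subword /a /b /g.
  ring.
have [i iK hi] := hN k; have [i' iK' hi'] := hN (shift_at n + k)%N.
have bai : (b i <= a i)%N.
  rewrite -ltnS -(ltr_nat R) -natr1 -ltrBlDl -(ltr_pM2r g0) mul1r.
  have := hi (shift_at n + i)%N; have := diffE i; move: shE; rewrite ler_norml => /andP[].
  move: (a i)%:R (b i)%:R (prefE i) (prefE (shift_at n + i)%N) (prefE (shift_at n)).
  by clearbody g => A B p1 p2 p3; lra.
pose j := (i' - shift_at n)%N; have ij : i' = (shift_at n + j)%N by rewrite /j subnKC// (leq_trans (leq_addr k _))//; case/andP: iK'.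
have abj : (a j <= b j)%N.
  rewrite -ltnS -(ltr_nat R) -natr1 -ltrBlDl -(ltr_pM2r g0) mul1r.
  have := hi' j; rewrite ij; have := diffE j; move: shE; rewrite ler_norml => /andP[].
  move: (a j)%:R (b j)%:R (prefE j) (prefE (shift_at n + j)%N) (prefE (shift_at n)).
  by clearbody g => A B p1 p2 p3; lra.
have [t [tK abt]] : exists t, (k <= t <= k + N)%N /\ a t = b t.
  have [ji|ji] := leqP j i.
    have [t [h1 h2]] := count_crossing (step 0%N) (step (shift_at n)) ji abj bai.
    by exists t; split=> //; clear - iK iK' ij h1; lia.
  have [t [h1 h2]] := count_crossing (step (shift_at n)) (step 0%N) (ltnW ji) bai abj.
  by exists t; split=> //; clear - iK iK' ij h1; lia.
exists t => //; rewrite /zero perm_eq2 ?size_subword//; exact/eqP.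
Qed.

Let bad n i := ~~ coincident u 0 (shift_at n) i.
(** Non-coincidences are measured by [T] because psi^m multiplies [T]-length by exactly beta^m. *)
Let bad_weight n x y : R := \sum_(x <= i < y | bad n i) T (u i).

Lemma bad_weight_ge0 n x y : 0 <= bad_weight n x y.
Proof. by apply: sumr_ge0 => i _; exact: ltW. Qed.

Lemma bad_weight_cat n x y z : (x <= y)%N -> (y <= z)%N ->
  bad_weight n x z = bad_weight n x y + bad_weight n y z.
Proof. by move=> xy yz; rewrite /bad_weight (big_cat_nat _ yz). Qed.

Lemma bad_weight_mono n x y : (x <= y)%N -> bad_weight n 0 x <= bad_weight n 0 y.
Proof. by move=> xy; rewrite (bad_weight_cat n (leq0n x) xy) lerDl bad_weight_ge0. Qed.

Lemma weight_subword x y : (x <= y)%N ->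
  weight T (subword u x (y - x)) = \sum_(x <= i < y) T (u i).
Proof.
move=> /subnKC <-; rewrite addKn; elim: (y - x)%N => [|d IH].
  by rewrite addn0 big_geq// weight_nil.
by rewrite addnS big_nat_recr ?leq_addr//= subwordS -cats1 weight_cat weight1 IH.
Qed.

Lemma bad_weight_le n x y : (x <= y)%N -> bad_weight n x y <= weight T (subword u x (y - x)).
Proof.
move=> xy; rewrite weight_subword// /bad_weight big_mkcond /=; apply: ler_sum => i _.
by case: ifP => // _; exact: ltW.
Qed.

Section OneStep.
Variables (n m : nat).
Let o := image_pos psi u m.

Lemma shift_at_add : shift_at (m + n) = o (shift_at n).
Proof.
rewrite /shift_at /o /image_pos iterD; congr (size (iter m psi _)).
exact: (prefix_stable_iter n psi_u q).
Qed.

Lemma zero_image z : zero n z ->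
  perm_eq (iter m psi (subword u 0 z)) (iter m psi (subword u (shift_at n) z)).
Proof. exact: (perm_morphism (word_morphism_iter m psiM)). Qed.

Lemma image_zero_pos z : zero n z -> o (shift_at n + z)%N = (shift_at (m + n) + o z)%N.
Proof.
move=> zz; rewrite shift_at_add /o /image_pos subwordD add0n.
rewrite (morphism_cat (word_morphism_iter m psiM)) size_cat; congr (_ + _)%N.
by apply/esym/perm_size; exact: zero_image.
Qed.

Lemma image_zero_perm z : zero n z ->
  perm_eq (subword u 0 (o z)) (subword u (shift_at (m + n)) (o z)).
Proof.
move=> zz; have := zero_image zz.
have iM := word_morphism_iter m psiM; have ist := prefix_stable_iter m psi_u.
rewrite (ist z) (morphism_subword (shift_at n) z iM ist) -(perm_size (zero_image zz)).
by rewrite -/(image_pos psi u m z) -/(image_pos psi u m (shift_at n)) -/o shift_at_add.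
Qed.

(** A common vertex goes to a common vertex. From there, a strong coincidence of the two letters
    read at [z] becomes a coincidence of the image pair. *)
Lemma coincident_image z x y x' y' c c' : zero n z ->
  iter m psi [:: u z] = x ++ c :: y -> iter m psi [:: u (shift_at n + z)%N] = x' ++ c' :: y' ->
  c = c' -> perm_eq x x' -> coincident u 0 (shift_at (m + n)) (o z + size x).
Proof.
move=> zz e1 e2 cc xx'.
have h1 := image_blockE psiM psi_u m z; have h2 := image_blockE psiM psi_u m (shift_at n + z)%N.
rewrite -/o (image_zero_pos zz) in h2; rewrite -/o in h1.
have s1 : (size x < size (iter m psi [:: u z]))%N by rewrite e1 size_cat /= addnS ltnS leq_addr.
have s2 : (size x < size (iter m psi [:: u (shift_at n + z)%N]))%N.
  by rewrite e2 size_cat /= (perm_size xx') addnS ltnS leq_addr.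
apply/andP; split.
  have n1 : u (o z + size x)%N = c.
    by have := congr1 (nth c ^~ (size x)) h1; rewrite nth_subword// e1 nth_cat ltnn subnn.
  have n2 : u (shift_at (m + n) + o z + size x)%N = c'.
    have := congr1 (nth c' ^~ (size x)) h2; rewrite nth_subword// e2 nth_cat.
    by rewrite (perm_size xx') ltnn subnn.
  by rewrite add0n addnA n1 n2 cc.
rewrite !subwordD add0n; apply: perm_cat; first exact: image_zero_perm.
rewrite -(take_subword u _ (ltnW s1)) -h1 -(take_subword u _ (ltnW s2)) -h2 e1 e2.
by rewrite take_size_cat// take_size_cat// (perm_size xx').
Qed.

Lemma coincident_step z t : zero n z -> u z = u (shift_at n + z)%N ->
  (t < size (iter m psi [:: u z]))%N -> coincident u 0 (shift_at (m + n)) (o z + t).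
Proof.
move=> zz uz tl; set w := iter m psi [:: u z] in tl.
have e : w = take t w ++ nth (u 0%N) w t :: drop t.+1 w by rewrite -drop_nth// cat_take_drop.
have st : size (take t w) = t by rewrite size_takel// ltnW.
have e' : iter m psi [:: u (shift_at n + z)%N] = take t w ++ nth (u 0%N) w t :: drop t.+1 w.
  by rewrite -uz -/w -e.
by rewrite -[X in (o z + X)%N]st; exact: (coincident_image zz e e' erefl (perm_refl _)).
Qed.

Lemma image_weight x y : (x <= y)%N ->
  weight T (subword u (o x) (o y - o x)) = beta ^+ m * weight T (subword u x (y - x)).
Proof.
move=> xy; rewrite -(weight_iter psiM T_eigen); congr (weight _ _).
rewrite (morphism_subword _ _ (word_morphism_iter m psiM) (prefix_stable_iter m psi_u)).
congr (subword _ _ _); rewrite /o /image_pos -{1}(subnKC xy) subwordD add0n.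
by rewrite (morphism_cat (word_morphism_iter m psiM)) size_cat addKn.
Qed.

End OneStep.

Lemma T_min : exists2 t : R, 0 < t & forall a, t <= T a.
Proof.
exists (Num.min (T ord0) (T ord_max)); first by rewrite lt_min !T0.
by move=> a; case: (letter2 a) => ->; rewrite ge_min lexx ?orbT.
Qed.

Lemma zero0 n : zero n 0.
Proof. by rewrite /zero /subword. Qed.

Lemma zeroS n z : zero n z -> u z = u (shift_at n + z)%N -> zero n z.+1.
Proof.
move=> zz uz; rewrite /zero !subwordS -!cats1 add0n -uz.
by rewrite perm_cat2r.
Qed.

Lemma weight_le_size M w : (forall a, T a <= M) -> weight T w <= (size w)%:R * M.
Proof.
move=> hM; rewrite /weight; elim: w => [|a w IH]; first by rewrite big_nil mul0r.
by rewrite big_cons /= -natr1 mulrDl mul1r addrC lerD.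
Qed.

(* A block between consecutive common vertices is either one coincidence or starts
   with two different letters, and then strong coincidence produces a coincidence
   inside its m-th image. *)
Lemma bad_weight_contraction : exists m theta,
  [/\ 0 < theta, theta <= 1 & exists n0, forall n, (n0 <= n)%N -> forall z, zero n z ->
     bad_weight (m + n) 0 (image_pos psi u m z) <=
     (1 - theta) * beta ^+ m * bad_weight n 0 z].
Proof.
have [m [x [y [x' [y' [c [e1 e2 xx']]]]]]] := strong_coincidence.
have [N [n0 gaps]] := zero_gaps; have [M M0 hM] := T_bounded T0; have [t t0 ht] := T_min.
have b0 : 0 < beta ^+ m by rewrite exprn_gt0// (lt_trans ltr01).
(* A coincidence saves at least [t], while the image of a non-coincident block, which has at most
   [N.+1] letters, has [T]-length at most [beta ^+ m * (N.+1%:R * M)]. *)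
pose theta := Num.min (t / (beta ^+ m * (N.+1%:R * M))) 1.
have th0 : 0 < theta by rewrite lt_min ltr01 andbT divr_gt0// !mulr_gt0.
exists m, theta; split=> //; first by rewrite ge_min lexx orbT.
exists n0 => n /gaps gap; pose o := image_pos psi u m.
have o_mono i j : (i <= j)%N -> (o i <= o j)%N by exact: image_pos_mono.
have key z z' : zero n z -> zero n z' -> (z < z')%N ->
    (forall i, (z < i < z')%N -> ~~ zero n i) ->
    bad_weight (m + n) (o z) (o z') <= (1 - theta) * beta ^+ m * bad_weight n z z'.
  move=> zz zz' lt_zz' nz.
  have [uz|/eqP uz] := eqVneq (u z) (u (shift_at n + z)%N).
    have z'E : z' = z.+1.
      apply/eqP; rewrite eqn_leq lt_zz' andbT leqNgt; apply/negP => lt.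
      have := nz z.+1; rewrite ltnSn lt => /(_ isT); rewrite zeroS//.
    have -> : bad_weight (m + n) (o z) (o z') = 0.
      rewrite /bad_weight big_nat_cond big_pred0// => i; apply/negP => /andP[/andP[h1 h2]].
      rewrite /bad; suff -> : coincident u 0 (shift_at (m + n)) i by [].
      rewrite -(subnKC h1); apply: coincident_step => //.
      by move: h2; rewrite z'E /o (image_posS _ psiM) -/(o z) => h2; rewrite -(ltn_add2l (o z)) subnKC.
    by rewrite !mulr_ge0 ?bad_weight_ge0 ?(ltW b0)// subr_ge0 ge_min lexx orbT.
  (* The letters at the first index differ, and no later index of the block has equal prefix
     counts. *)
  have allbad : bad_weight n z z' = weight T (subword u z (z' - z)).
    rewrite weight_subword ?(ltnW lt_zz')// /bad_weight [LHS]big_nat_cond [RHS]big_nat.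
    apply: eq_bigl => i; apply/andb_idr => /andP[h1 h2].
    apply/negP => /andP[/eqP ui zi]; move: h1; rewrite leq_eqVlt => /predU1P[zi'|zi'].
      by apply: uz; rewrite zi' -ui.
    by have := nz i; rewrite zi' h2 => /(_ isT)/negP; apply.
  have [p [pz pz' cop]] : exists p, [/\ (o z <= p)%N, (p < o z')%N &
      coincident u 0 (shift_at (m + n)) p].
    have lim w w1 w2 : iter m psi [:: u z] = w -> w = w1 ++ c :: w2 ->
        (o z <= o z + size w1)%N /\ (o z + size w1 < o z')%N.
      move=> e3 e4; rewrite leq_addr; split=> //.
      apply: leq_trans (o_mono _ _ lt_zz'); rewrite /o (image_posS _ psiM) e3 e4 size_cat /=.
      by rewrite -/(o z) ltn_add2l -addSnnS leq_addr.
    case: (letter2 (u z)) => u1; case: (letter2 (u (shift_at n + z)%N)) => u2;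
      rewrite ?u1 ?u2 in uz *; try by case: uz.
      have e3 : iter m psi [:: u z] = x ++ c :: y by rewrite u1.
      have e4 : iter m psi [:: u (shift_at n + z)%N] = x' ++ c :: y' by rewrite u2.
      exists (o z + size x)%N; have [l1 l2] := lim _ _ _ e3 erefl; split=> //.
      exact: coincident_image zz e3 e4 erefl xx'.
    have e3 : iter m psi [:: u z] = x' ++ c :: y' by rewrite u1.
    have e4 : iter m psi [:: u (shift_at n + z)%N] = x ++ c :: y by rewrite u2.
    exists (o z + size x')%N; have [l1 l2] := lim _ _ _ e3 erefl; split=> //.
    by apply: (coincident_image zz e3 e4 erefl); rewrite perm_sym.
  have lenz : (z' - z <= N.+1)%N.
    have [i /andP[i1 i2] zi] := gap z.+1.
    rewrite leqNgt; apply/negP => lt; have := nz i; rewrite zi.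
    have -> : (z < i < z')%N by clear - i1 i2 lt; lia.
    by move/(_ isT).
  have wle : weight T (subword u z (z' - z)) <= N.+1%:R * M.
    apply: (@le_trans _ _ ((z' - z)%:R * M)); last by rewrite ler_wpM2r ?(ltW M0)// ler_nat.
    by rewrite -{2}(size_subword u z (z' - z)); exact: weight_le_size.
  apply: (@le_trans _ _ (weight T (subword u (o z) (o z' - o z)) - t)).
    rewrite weight_subword ?o_mono ?(ltnW lt_zz')// lerBrDr.
    rewrite (big_cat_nat pz (ltnW pz')) /= (bad_weight_cat _ pz (ltnW pz')) -addrA.
    apply: lerD.
      by rewrite -weight_subword//; exact: bad_weight_le.
    rewrite (big_ltn pz') /bad_weight (big_ltn_cond pz') /bad cop /= addrC.
    apply: lerD; first exact: ht.
    by rewrite -weight_subword//; exact: bad_weight_le.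
  rewrite (image_weight _ (ltnW lt_zz')) allbad; set W := weight _ _ in wle *.
  have W0 : 0 <= W by exact: weight_ge0.
  have h1 : theta * (beta ^+ m * W) <= t.
    apply: (@le_trans _ _ (t / (beta ^+ m * (N.+1%:R * M)) * (beta ^+ m * (N.+1%:R * M)))); last first.
      by rewrite divfK// gt_eqF// !mulr_gt0.
    apply: ler_pM; rewrite ?(ltW th0) ?mulr_ge0 ?(ltW b0)//; first by rewrite ge_min lexx.
    by rewrite ler_wpM2l// ltW.
  by rewrite -mulrA mulrBl mul1r lerD2l lerN2.
elim/ltn_ind => z IH zz; have [->|z0] := posnP z.
  rewrite /bad_weight /image_pos /subword /= (morphism_nil (word_morphism_iter m psiM)).
  by rewrite !big_geq// mulr0.
have [z1 [z1z zz1 nz]] : exists z1, [/\ (z1 < z)%N, zero n z1 &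
    forall i, (z1 < i < z)%N -> ~~ zero n i].
  have ex : exists i, (i < z)%N && zero n i by exists 0%N; rewrite z0 zero0.
  have ub i : (i < z)%N && zero n i -> (i <= z)%N by move=> /andP[/ltnW].
  case: (ex_maxnP ex ub) => i /andP[iz zi] hmax; exists i; split=> // j /andP[ij jz].
  by apply/negP => zj; have := hmax j; rewrite jz zj => /(_ isT); rewrite leqNgt ij.
rewrite (bad_weight_cat n (leq0n z1) (ltnW z1z)) mulrDr.
rewrite -/(o z) (bad_weight_cat (m + n) (leq0n (o z1)) (o_mono _ _ (ltnW z1z))).
by apply: lerD; [exact: IH|exact: key].
Qed.

(** Each application of the contraction multiplies the bad share by [1 - theta]. The error [c] comes
    from replacing [x] by the image of a nearby common vertex and does not depend on [x]. *)
Lemma bad_weight_density rho : 0 < rho -> exists n c, 0 <= c /\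
  forall x, bad_weight n 0 x <= rho * weight T (subword u 0 x) + c.
Proof.
move=> rho0; have [m [theta [th0 th1 [n1 contr]]]] := bad_weight_contraction.
have [N [n2 gaps]] := zero_gaps; have [M M0 hM] := T_bounded T0.
have b0 : 0 < beta ^+ m by rewrite exprn_gt0// (lt_trans ltr01).
pose r := 1 - theta; have r0 : 0 <= r by rewrite subr_ge0.
pose n0 := (n1 + n2)%N; pose o := image_pos psi u m.
pose L := (\max_a size (iter m psi [:: a]))%N.
have leL a : (size (iter m psi [:: a]) <= L)%N.
  exact: (leq_bigmax (F := fun a => size (iter m psi [:: a])) a).
have iterate j : exists c, 0 <= c /\
    forall x, bad_weight (j * m + n0) 0 x <= r ^+ j * weight T (subword u 0 x) + c.
  elim: j => [|j [c [c0 hc]]].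
    exists 0; split=> // x; rewrite expr0 mul1r addr0.
    by have := @bad_weight_le (0 * m + n0)%N 0%N x isT; rewrite subn0.
  set n := (j * m + n0)%N in hc.
  exists (r ^+ j.+1 * ((N.+1 * L)%:R * M) + r * beta ^+ m * c); split.
    by rewrite addr_ge0 ?mulr_ge0 ?(exprn_ge0 _ r0) ?(ltW b0) ?(ltW M0) ?ler0n.
  (* [x] is rounded up to a block boundary within [L], then to the image of a common vertex at most
     [N] letters later, each with an image of length at most [L]. *)
  move=> x; have [z0 /andP[xz zx]] := next_block u psiM x leL.
  have n2n : (n2 <= n)%N by rewrite /n /n0 addnA leq_addl.
  have n1n : (n1 <= n)%N by rewrite /n /n0 [(n1 + n2)%N]addnC addnA leq_addl.
  have [z /andP[z0z zN] zz] := gaps n n2n z0.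
  have grow d : (o (z0 + d) <= o z0 + d * L)%N.
    elim: d => [|d IH]; first by rewrite addn0 leq_addr.
    by rewrite addnS /o (image_posS _ psiM) -/o mulSn [(L + _)%N]addnC addnA leq_add.
  have xoz : (x <= o z)%N by apply: leq_trans xz _; exact: image_pos_mono.
  have ozx : (o z <= x + N.+1 * L)%N.
    have := grow (z - z0)%N; rewrite subnKC//.
    have : ((z - z0) * L <= N * L)%N by rewrite leq_mul2r leq_subLR zN orbT.
    by rewrite mulSn -/(o z0) in zx *; clear - zx; lia.
  have -> : (j.+1 * m + n0 = m + n)%N by rewrite mulSn -addnA.
  apply: le_trans (bad_weight_mono _ xoz) _; apply: (le_trans (contr n n1n z zz)).
  apply: (@le_trans _ _ (r * beta ^+ m * (r ^+ j * weight T (subword u 0 z) + c))).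
    by rewrite ler_wpM2l ?hc ?mulr_ge0 ?(ltW b0).
  have := image_weight m (leq0n z); rewrite -/o.
  have -> : o 0%N = 0%N.
    by rewrite /o /image_pos /subword /= (morphism_nil (word_morphism_iter m psiM)).
  rewrite !subn0 => wz.
  have -> : r * beta ^+ m * (r ^+ j * weight T (subword u 0 z) + c) =
      r ^+ j.+1 * (beta ^+ m * weight T (subword u 0 z)) + r * beta ^+ m * c.
    by rewrite exprS; ring.
  rewrite -wz addrA lerD2r -mulrDr ler_wpM2l ?exprn_ge0//.
  rewrite -(subnKC xoz) subwordD weight_cat lerD2l.
  apply: le_trans (weight_le_size _ hM) _; rewrite size_subword ler_wpM2r ?(ltW M0)//.
  by rewrite ler_nat leq_subLR.
have r1 : 0 <= r < 1 by rewrite r0 /r ltrBlDr ltrDl.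
have [j0 hj] := expr_small r1 ler01 rho0.
have [c [c0 hc]] := iterate j0; exists (j0 * m + n0)%N, c; split=> // x.
apply: le_trans (hc x) _; rewrite lerD2r ler_wpM2r ?weight_ge0//.
by have := hj j0 (leqnn _); rewrite mulr1.
Qed.

Lemma binary_coincidences (e : R) : 0 < e -> exists p q', [/\ (p < q')%N, coincident u p q' 0 &
  exists N0, forall N, (N0 <= N)%N ->
    (count (fun i => ~~ coincident u p q' i) (iota 0 N))%:R <= e * N%:R].
Proof.
move=> e0; have [M M0 hM] := T_bounded T0; have [t t0 ht] := T_min.
(* The ratio [t / M] converts between numbers of indices and [T]-lengths; the other half of [e]
   absorbs the constant [c]. *)
have rho0 : 0 < e / 2 * (t / M) by rewrite mulr_gt0 ?divr_gt0.
have [n [c [c0 hc]]] := bad_weight_density rho0.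
exists 0%N, (shift_at n); split.
- rewrite /shift_at; apply: leq_trans (size_morphism_ge (word_morphism_iter n psiM) _).
  by rewrite size_subword.
(* Both letters are the first letter of psi^n(u_0), because u_q = u_0. *)
- apply/andP; split=> //; rewrite addn0; apply/eqP.
  have s0 := size_morphism_gt0 (word_morphism_iter n psiM) (u 0%N).
  have := image_blockE psiM psi_u n q; rewrite uq => h1.
  have := prefix_stable_iter n psi_u 1; rewrite subword1 => h2.
  have := congr1 (nth (u 0%N) ^~ 0%N) (etrans (esym h2) h1).
  by rewrite !nth_subword// addn0.
exists (Num.bound (2 * c / (e * t))) => N hN.
have : t * (count (fun i => ~~ coincident u 0 (shift_at n) i) (iota 0 N))%:R <= bad_weight n 0 N.
  rewrite /bad_weight -[X in iota 0 X]subn0 -/(index_iota 0 N) -sum1_count natr_sum big_distrr /=.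
  by apply: ler_sum => i _; rewrite mulr1.
have hw : weight T (subword u 0 N) <= N%:R * M.
  by have := weight_le_size (subword u 0 N) hM; rewrite size_subword.
have hcN : c <= e / 2 * t * N%:R.
  have : 2 * c / (e * t) <= N%:R.
    apply: le_trans (ltW (archi_boundP _)) _; last by rewrite ler_nat.
    by rewrite divr_ge0 ?mulr_ge0// ltW.
  rewrite ler_pdivrMr ?mulr_gt0// => h.
  have -> : e / 2 * t * N%:R = N%:R * (e * t) / 2 by field.
  lra.
move=> /le_trans/(_ (hc N)) h; rewrite -(ler_pM2l t0); apply: (le_trans h).
apply: (@le_trans _ _ (e / 2 * (t / M) * (N%:R * M) + e / 2 * t * N%:R)).
  by apply: lerD => //; rewrite ler_wpM2l// ltW.
suff -> : e / 2 * (t / M) * (N%:R * M) + e / 2 * t * N%:R = t * (e * N%:R) by [].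
by field; rewrite gt_eqF.
Qed.

End Decay.

(** * Real eigenvalues and eigenvectors for two letters *)

Lemma char_poly2 (F : comNzRingType) (A : 'M[F]_2) :
  char_poly A = 'X^2 - (A 0 0 + A 1 1) *: 'X + (A 0 0 * A 1 1 - A 0 1 * A 1 0)%:P.
Proof.
rewrite /char_poly (expand_det_row _ 0) !big_ord_recl big_ord0 /cofactor !det_mx11 !mxE /= -!mul_polyC !rmorphD !rmorphN !rmorphM /=.
have e1 : lift 0 0 = 1 :> 'I_2 by exact/val_inj.
have -> : lift (lift ord0 ord0) 0 = 0 :> 'I_2 by exact/val_inj.
by rewrite !e1 !mulr1n !mulr0n /bump /=; ring.
Qed.

Lemma weight_count2 (R : realType) (F : 'I_2 -> R) w :
  weight F w = (count_mem ord0 w)%:R * F ord0 + (count_mem ord_max w)%:R * F ord_max.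
Proof.
elim: w => [|a w IH]; first by rewrite weight_nil !mul0r addr0.
by rewrite weight_cons IH /= !natrD; case: (letter2 a) => -> /=; ring.
Qed.

Section BinaryWeights.
Variable phi : seq 'I_2 -> seq 'I_2.
Hypothesis irr : irreducible_morphism phi.
Hypothesis pisot : pisot_morphism phi.

Let a := count_mem ord0 (phi [:: ord0]).
Let b := count_mem ord_max (phi [:: ord0]).
Let c := count_mem ord0 (phi [:: ord_max]).
Let e := count_mem ord_max (phi [:: ord_max]).

Lemma char_poly_incidence2 (F : comNzRingType) :
  char_poly (map_mx (fun k : nat => k%:R : F) (incidence_mx phi)) =
  'X^2 - (a%:R + e%:R) *: 'X + (a%:R * e%:R - b%:R * c%:R)%:P.
Proof.
rewrite char_poly2 !mxE.
have -> : 1 = ord_max :> 'I_2 by apply/val_inj.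
by have -> : 0 = ord0 :> 'I_2 by apply/val_inj.
Qed.

Lemma no_rational_eigenvalue (x : rat) :
  x ^+ 2 - (a%:R + e%:R) * x + (a%:R * e%:R - b%:R * c%:R) != 0.
Proof.
apply/eqP => x0; have [_ h] := irr.
have /h/(_ _)/eqp_size : size ('X - x%:P) != 1%N by rewrite size_XsubC.
rewrite size_XsubC size_char_poly => e3; suff : 2%N = 3%N by [].
apply: e3; rewrite dvdp_XsubCl /root char_poly_incidence2.
by apply/eqP; rewrite -[RHS]x0 !hornerE; ring.
Qed.

(** The characteristic polynomial (x - beta)(x - l), with beta > 1 and |l| < 1, is negative at 1 and
    positive at -1. Stated for natural numbers, this carries over to [R]. *)
Lemma pisot_inequalities : (1 + a * e < a + e + b * c)%N /\ (b * c < (1 + a) * (1 + e))%N.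
Proof.
have [rs [chiE small nrs]] := beta_simple irr pisot.
have breal : spectral_radius (map_mx (fun k : nat => k%:R : algC) (incidence_mx phi)) \is Num.real.
  by case: pisot.
have b1 := beta_gt1 pisot.
set beta := spectral_radius _ in chiE breal b1 nrs.
have := congr1 (size \o polyseq) chiE; rewrite /= size_char_poly.
rewrite size_Mmonic ?monic_prod_XsubC ?polyXsubC_eq0// size_XsubC size_prod_XsubC /=.
case: rs small chiE nrs => [|l [|]]//= small chiE nrs _.
rewrite big_seq1 char_poly_incidence2 in chiE.
have l1 : `|l| < 1 by apply: small; rewrite mem_head.
have chi x : x ^+ 2 - (a%:R + e%:R) * x + (a%:R * e%:R - b%:R * c%:R) = (x - beta) * (x - l).
  by have := congr1 (horner ^~ x) chiE; rewrite !hornerE.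
have lreal : l \is Num.real.
  have -> : l = (a%:R + e%:R) - beta.
    have h : 1 ^+ 2 - (a%:R + e%:R) * 1 - (0 ^+ 2 - (a%:R + e%:R) * 0) =
      (1 - beta) * (1 - l) - (0 - beta) * (0 - l).
      by rewrite -(chi 1) -(chi 0); ring.
    have -> : l = 1 - beta - ((1 - beta) * (1 - l) - (0 - beta) * (0 - l)) by ring.
    by rewrite -h; ring.
  by rewrite rpredB// rpredD// realn.
have /andP[ll lr] : -1 < l < 1 by rewrite -real_lter_norml.
split.
  have := chi 1; have : (1 - beta) * (1 - l) < 0.
    by rewrite nmulr_rlt0 ?subr_gt0 ?subr_lt0.
  rewrite -(ltr_nat algC) !natrD !natrM -subr_lt0 => h1 h2; rewrite -h2 in h1.
  suff -> : 1 + a%:R * e%:R - (a%:R + e%:R + b%:R * c%:R) =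
    1 ^+ 2 - (a%:R + e%:R) * 1 + (a%:R * e%:R - b%:R * c%:R) :> algC by [].
  by ring.
have := chi (-1); have : 0 < (-1 - beta) * (-1 - l).
  have -> : (-1 - beta) * (-1 - l) = (1 + beta) * (1 + l) by ring.
  apply: mulr_gt0; first by rewrite addr_gt0// (lt_trans ltr01).
  by rewrite -ltrBlDl sub0r.
move=> h1 h2; rewrite -h2 in h1.
rewrite -(ltr_nat algC) -subr_gt0 !natrM !natrD.
suff -> : (1 + a%:R) * (1 + e%:R) - b%:R * c%:R =
  (-1) ^+ 2 - (a%:R + e%:R) * -1 + (a%:R * e%:R - b%:R * c%:R) :> algC by [].
by ring.
Qed.

Lemma counts_gt0 : (0 < b * c)%N.
Proof.
rewrite lt0n; apply/negP => /eqP bc; have /eqP := no_rational_eigenvalue a%:R.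
by apply; rewrite -(natrM _ b c) bc; ring.
Qed.

Variable R : realType.

(** If [y] were nonzero, the relation would make [m] rational, contradicting
    [no_rational_eigenvalue]. With y = 0, the nonzero [b] forces x = 0. *)
Lemma irrational_functional (m : R) (x y : int) :
  m ^+ 2 - (a%:R + e%:R) * m + (a%:R * e%:R - b%:R * c%:R) = 0 ->
  x%:~R * b%:R + y%:~R * (m - a%:R) = 0 -> x = 0 /\ y = 0.
Proof.
move=> chim h; have b0 : b%:R != 0 :> R.
  by rewrite pnatr_eq0 -lt0n; move: counts_gt0; rewrite muln_gt0 => /andP[].
have [y0|y0] := eqVneq y 0.
  split=> //; apply/eqP; move: h; rewrite y0 mul0r addr0 => /eqP.
  by rewrite mulf_eq0 (negbTE b0) orbF intr_eq0.
have yR : y%:~R != 0 :> R by rewrite intr_eq0.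
pose r : rat := a%:R - x%:~R * b%:R / y%:~R.
have mr : m = ratr r.
  rewrite /r rmorphB rmorphM rmorphM fmorphV /= !ratr_nat !ratr_int.
  apply/eqP; rewrite -subr_eq0 -(mulIr_eq0 _ (mulIf yR)).
  by apply/eqP; rewrite -h; field.
have /eqP := no_rational_eigenvalue r; case; apply: (fmorph_inj (ratr : {rmorphism rat -> R})).
clearbody r; rewrite rmorph0 -[RHS]chim mr !rmorphD !rmorphN rmorphXn !rmorphM rmorphD /=.
by rewrite !ratr_nat.
Qed.

(** The discriminant (a - e)^2 + 4 b c exceeds (a - e)^2, which puts [a] strictly between the roots;
    the two integer inequalities place the roots relative to 1 and -1. *)
Lemma binary_eigenvalues : exists lam beta : R,
  [/\ lam ^+ 2 - (a%:R + e%:R) * lam + (a%:R * e%:R - b%:R * c%:R) = 0,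
      beta ^+ 2 - (a%:R + e%:R) * beta + (a%:R * e%:R - b%:R * c%:R) = 0,
      `|lam| < 1, 1 < beta & lam < a%:R < beta].
Proof.
have [chi1 chiN1] := pisot_inequalities.
have := counts_gt0; rewrite -(ltr_nat R) natrM => bc0.
move: chi1 chiN1; rewrite -!(ltr_nat R) !natrD !natrM !natrD.
have a0 : 0 <= a%:R :> R by []; have e0 : 0 <= e%:R :> R by [].
move: a%:R e%:R b%:R c%:R a0 e0 bc0 => A B C D A0 B0 CD0 chi1 chiN1.
have D0 : (A - B) ^+ 2 + 4 * (C * D) > 0.
  by rewrite ltr_wpDl ?sqr_ge0// mulr_gt0.
pose s := Num.sqrt ((A - B) ^+ 2 + 4 * (C * D)).
have s2 : s ^+ 2 = (A - B) ^+ 2 + 4 * (C * D) by rewrite sqr_sqrtr// ltW.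
have s0 : 0 < s by rewrite sqrtr_gt0.
clearbody s; exists ((A + B - s) / 2), ((A + B + s) / 2).
have dAB : `|A - B| < s.
  rewrite -(ltr_pXn2r (n := 2)) ?nnegrE ?normr_ge0 ?(ltW s0)// real_normK ?num_real//.
  by rewrite s2 ltrDl mulr_gt0.
move: dAB; rewrite ltr_norml => /andP[d1 d2].
have prod1 : (A + B + s - 2) * (A + B - s - 2) < 0.
  have -> : (A + B + s - 2) * (A + B - s - 2) = (A + B - 2) ^+ 2 - s ^+ 2 by ring.
  by rewrite s2; nra.
have prodN1 : 0 < (A + B + s + 2) * (A + B - s + 2).
  have -> : (A + B + s + 2) * (A + B - s + 2) = (A + B + 2) ^+ 2 - s ^+ 2 by ring.
  by rewrite s2; nra.
have big : 0 < A + B + s - 2.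
  rewrite ltNge; apply/negP => le0; move: prod1; rewrite ltNge => /negP; apply.
  by apply: mulr_le0 => //; lra.
have small : A + B - s - 2 < 0 by rewrite -(pmulr_rlt0 _ big).
have smallN : 0 < A + B - s + 2 by rewrite -(pmulr_rgt0 (x := A + B + s + 2))//; lra.
have chi x : x = s \/ x = - s ->
    ((A + B + x) / 2) ^+ 2 - (A + B) * ((A + B + x) / 2) + (A * B - C * D) = 0.
  move=> hx; have x2 : x ^+ 2 = (A - B) ^+ 2 + 4 * (C * D).
    by case: hx => ->; rewrite ?sqrrN.
  have -> : ((A + B + x) / 2) ^+ 2 - (A + B) * ((A + B + x) / 2) + (A * B - C * D) =
    (x ^+ 2 - ((A - B) ^+ 2 + 4 * (C * D))) / 4 by field.
  by rewrite x2 subrr mul0r.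
split.
- by apply: chi; right.
- by apply: chi; left.
- by rewrite ltr_norml; apply/andP; split; lra.
- by lra.
by apply/andP; split; lra.
Qed.

Lemma binary_weights : exists (lam beta : R) (E T : 'I_2 -> R),
  [/\ forall x, weight E (phi [:: x]) = lam * E x,
      forall x, weight T (phi [:: x]) = beta * T x &
      `|lam| < 1 /\ 1 < beta] /\
  [/\ 0 < E ord0, E ord_max < 0, forall x, 0 < T x,
      forall v : vec, functional E v = 0 -> v = 0 &
      forall v : vec, functional T v = 0 -> v = 0].
Proof.
have [lam [beta [chil chib l1 b1 /andP[la ab]]]] := binary_eigenvalues.
(* (b, m - a) is a right eigenvector of the incidence matrix for the root [m]. Since lam < a < beta,
   its signs are mixed for [lam] and positive for [beta]. *)
pose F (m : R) (x : 'I_2) := if x == ord0 then b%:R else m - a%:R.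
have F_eigen m : m ^+ 2 - (a%:R + e%:R) * m + (a%:R * e%:R - b%:R * c%:R) = 0 ->
    forall x, weight (F m) (phi [:: x]) = m * F m x.
  move=> chim x; rewrite weight_count2 /F /=; case: (letter2 x) => -> /=.
    by rewrite -/a -/b; ring.
  rewrite -/c -/e; apply/eqP; rewrite -subr_eq0 -oppr_eq0; apply/eqP; rewrite -[RHS]chim; ring.
have F_inj m : m ^+ 2 - (a%:R + e%:R) * m + (a%:R * e%:R - b%:R * c%:R) = 0 ->
    forall v : vec, functional (F m) v = 0 -> v = 0.
  move=> chim v; rewrite functional2 /F /= => /(irrational_functional chim)[h0 h1].
  by apply/rowP => x; rewrite mxE; case: (letter2 x) => ->.
have b0 : 0 < b%:R :> R.
  by rewrite ltr0n; move: counts_gt0; rewrite muln_gt0 => /andP[].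
exists lam, beta, (F lam), (F beta); split; split=> //; try exact: F_eigen; try exact: F_inj.
  by rewrite /F /= subr_lt0.
by move=> x; rewrite /F; case: ifP => _ //; rewrite subr_gt0.
Qed.

End BinaryWeights.

(** * Almost periodicity from pure discrete spectrum *)

Local Open Scope classical_set_scope.
Local Open Scope ring_scope.

Section SqrMod.
Variable R : realType.
Implicit Types z w : R[i].

Lemma sqr_mod_ge0 z : 0 <= sqr_mod z.
Proof. by rewrite addr_ge0// sqr_ge0. Qed.

Lemma sqr_modM z w : sqr_mod (z * w) = sqr_mod z * sqr_mod w.
Proof. by case: z w => [a b] [c d]; rewrite /sqr_mod /=; ring. Qed.

Lemma sqr_modX z n : sqr_mod (z ^+ n) = sqr_mod z ^+ n.
Proof.
elim: n => [|n IH]; first by rewrite !expr0 /sqr_mod /=; ring.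
by rewrite !exprS sqr_modM IH.
Qed.

Lemma sqr_modN z : sqr_mod (- z) = sqr_mod z.
Proof. by case: z => [a b]; rewrite /sqr_mod /=; ring. Qed.

Lemma sqr_mod_add3 z w v :
  sqr_mod (z + w + v) <= 3 * (sqr_mod z + sqr_mod w + sqr_mod v).
Proof.
case: z w v => [a b] [c d] [e f]; rewrite /sqr_mod /= -subr_ge0.
have -> : 3 * (a ^+ 2 + b ^+ 2 + (c ^+ 2 + d ^+ 2) + (e ^+ 2 + f ^+ 2)) -
    ((a + c + e) ^+ 2 + (b + d + f) ^+ 2) =
  (a - c) ^+ 2 + (b - d) ^+ 2 + (c - e) ^+ 2 + (d - f) ^+ 2 + (a - e) ^+ 2
    + (b - f) ^+ 2 by ring.
by rewrite !addr_ge0// sqr_ge0.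
Qed.

Lemma sqr_mod_add2 z w : sqr_mod (z + w) <= 2 * (sqr_mod z + sqr_mod w).
Proof.
case: z w => [a b] [c d]; rewrite /sqr_mod /= -subr_ge0.
have -> : 2 * (a ^+ 2 + b ^+ 2 + (c ^+ 2 + d ^+ 2)) -
  ((a + c) ^+ 2 + (b + d) ^+ 2) = (a - c) ^+ 2 + (b - d) ^+ 2 by ring.
by rewrite addr_ge0// sqr_ge0.
Qed.

Lemma sqr_mod_sum (I : Type) (r : seq I) (F : I -> R[i]) :
  sqr_mod (\sum_(i <- r) F i) <= 2 ^+ size r * \sum_(i <- r) sqr_mod (F i).
Proof.
elim: r => [|i r IH]; first by rewrite !big_nil /sqr_mod /= mulr0 expr0n addr0.
rewrite !big_cons; apply: (le_trans (sqr_mod_add2 _ _)).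
rewrite /= exprS -mulrA ler_wpM2l// mulrDr lerD//.
by rewrite ler_peMl ?sqr_mod_ge0// exprn_ege1// ler1n.
Qed.

Lemma near_of_truncn (Q : nat) (x y : R) : (0 < Q)%N -> 0 <= x -> 0 <= y ->
  Num.truncn (x * Q%:R) = Num.truncn (y * Q%:R) -> (y - x) ^+ 2 <= (Q%:R^-1) ^+ 2.
Proof.
move=> Q0 x0 y0 e; have QR : 0 < Q%:R :> R by rewrite ltr0n.
have /andP[x1 x2] := truncn_itv (mulr_ge0 x0 (ltW QR)).
have /andP[y1 y2] := truncn_itv (mulr_ge0 y0 (ltW QR)).
rewrite -ler_sqrt ?exprn_ge0// ?invr_ge0// !sqrtr_sqr [X in _ <= X]ger0_norm ?invr_ge0//.
rewrite -[Q%:R^-1]mul1r ler_pdivlMr// -[X in _ * X](gtr0_norm QR) -normrM mulrBl.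
by rewrite -e -natr1 in y1 y2; rewrite -natr1 in x2; rewrite ler_norml; lra.
Qed.

(** Dirichlet's pigeonhole argument: for two exponents m < n the powers of all the numbers share
    their cells of side 1 / Q. As the numbers have modulus 1, s = n - m works. *)
Lemma simultaneous_return (ls : seq R[i]) (eps : R) : 0 < eps ->
  (forall z, z \in ls -> sqr_mod z = 1) ->
  exists2 s : nat, (0 < s)%N & forall z, z \in ls -> sqr_mod (z ^+ s - 1) <= eps.
Proof.
move=> eps0 unit_ls.
have [Q Q0 hQ] : exists2 Q : nat, (0 < Q)%N & 2 * (Q%:R^-1) ^+ 2 <= eps.
  pose Q := (Num.bound (2 / eps)).+1; exists Q => //.
  have Q1 : 1 <= Q%:R :> R by rewrite ler1n.
  have hb : 2 / eps <= Q%:R.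
    rewrite /Q -[(Num.bound _).+1%:R]natr1; apply: ler_wpDr => //; apply/ltW/archi_boundP.
    by rewrite divr_ge0// ltW.
  rewrite exprVn ler_pdivrMr ?exprn_gt0 ?ltr0n//.
  move: hb; rewrite ler_pdivrMr// => hb; apply: (le_trans hb).
  by rewrite mulrC ler_pM2l// expr2 ler_peMl// ler0n.
pose cell (x : R) : 'I_(2 * Q).+1 := inord (Num.truncn ((x + 1) * Q%:R)).
pose T := {ffun 'I_(size ls) -> 'I_(2 * Q).+1 * 'I_(2 * Q).+1}.
pose F (n : nat) : T := [ffun i : 'I_(size ls) => (cell (complex.Re ((ls`_i) ^+ n)),
  cell (complex.Im ((ls`_i) ^+ n)))].
have [m [n [mn eF]]] : exists m n : nat, (m < n)%N /\ F m = F n.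
  have ninj : ~ injective (fun i : 'I_#|T|.+1 => F i).
    by move=> /leq_card; rewrite card_ord ltnn.
  apply: contrapT => H; apply: ninj => i j e; apply/val_inj.
  case: (ltngtP i j) => // ij; exfalso; apply: H.
    by exists i, j.
  by exists j, i.
exists (n - m)%N; first by rewrite subn_gt0.
move=> z zl; have z1 := unit_ls _ zl.
have zi : (index z ls < size ls)%N by rewrite index_mem.
have zE : ls`_(Ordinal zi) = z by rewrite nth_index.
move: (congr1 (fun f : T => f (Ordinal zi)) eF); rewrite !ffunE zE => -[e1 e2].
have bnd k : [/\ -1 <= complex.Re (z ^+ k) <= 1 & -1 <= complex.Im (z ^+ k) <= 1].
  have : sqr_mod (z ^+ k) = 1 by rewrite sqr_modX z1 expr1n.
  by rewrite /sqr_mod => h; split; nra.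
have inj_cell x y : -1 <= x <= 1 -> -1 <= y <= 1 -> cell x = cell y ->
    (y - x) ^+ 2 <= (Q%:R^-1) ^+ 2.
  move=> hx hy /(congr1 val); rewrite /= !inordK.
  - have -> : y - x = (y + 1) - (x + 1) by ring.
    by apply: near_of_truncn => //; lra.
  - rewrite ltnS -(ler_nat R); have y0 : 0 <= y + 1 by lra.
    have /andP[+ _] := truncn_itv (mulr_ge0 y0 (ler0n R Q)); move=> h.
    by apply: (le_trans h); rewrite natrM ler_wpM2r//; lra.
  - rewrite ltnS -(ler_nat R); have x0 : 0 <= x + 1 by lra.
    have /andP[+ _] := truncn_itv (mulr_ge0 x0 (ler0n R Q)); move=> h.
    by apply: (le_trans h); rewrite natrM ler_wpM2r//; lra.
have [bm1 bm2] := bnd m; have [bn1 bn2] := bnd n.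
have -> : sqr_mod (z ^+ (n - m) - 1) = sqr_mod (z ^+ n - z ^+ m).
  rewrite -[in RHS](subnK (ltnW mn)) exprD -[X in _ = sqr_mod (_ - X)]mul1r -mulrBl.
  by rewrite sqr_modM sqr_modX z1 expr1n mulr1.
apply: le_trans hQ; rewrite /sqr_mod !raddfB /= mulr2n mulrDl !mul1r.
by apply: lerD; apply: inj_cell.
Qed.

End SqrMod.

Section LimnSup.
Variable R : realType.

(** This makes the limit superior of partial sums a transfer function: dropping the first term [c]
    subtracts exactly [c] from it. *)
Lemma limn_sup_cocycle (u v : R^o^nat) (C c : R) : (forall n, `|u n| <= C) ->
  (forall n, v n = u n.+1 - c) -> limn_sup v = limn_sup u - c.
Proof.
move=> uC vE.
have ubu : has_ubound (range u).
  by exists C => _ [n _ <-]; apply: le_trans (ler_norm _) (uC n).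
have lbu : has_lbound (range u).
  by exists (- C) => _ [n _ <-]; have := uC n; rewrite ler_norml => /andP[].
have cu := cvg_sups_inf ubu lbu.
have supsE n : sups v n = sups u n.+1 - c.
  apply/eqP; rewrite eq_le; apply/andP; split.
    apply: ge_sup; first by exists (v n), n => /=.
    move=> _ [k /= nk <-]; rewrite vE lerD2r; apply: ub_le_sup.
      exact: has_ubound_sdrop.
    by exists k.+1.
  rewrite lerBlDr; apply: ge_sup; first by exists (u n.+1), n.+1 => /=.
  move=> _ [[//|k] /= nk <-]; rewrite -lerBlDr -vE; apply: ub_le_sup.
    apply: has_ubound_sdrop; exists (C - c) => _ [m _ <-].
    by rewrite vE lerD2r; apply: le_trans (ler_norm _) (uC _).
  by exists k.
have -> : limn_sup u = inf (range (sups u)) by exact/cvg_lim.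
apply/cvg_lim => //.
have -> : sups v = (fun n => sups u n.+1 - c) by apply/funext.
apply: cvgB; last exact: cvg_cst.
by rewrite (cvg_shiftS (sups u)).
Qed.

Lemma limn_sup_bounded (u : R^o^nat) (C : R) : (forall n, `|u n| <= C) ->
  `|limn_sup u| <= C.
Proof.
move=> uC.
have ubu : has_ubound (range u).
  by exists C => _ [n _ <-]; apply: le_trans (ler_norm _) (uC n).
have lbu : has_lbound (range u).
  by exists (- C) => _ [n _ <-]; have := uC n; rewrite ler_norml => /andP[].
have -> : limn_sup u = inf (range (sups u)) by exact/cvg_lim/cvg_sups_inf.
have supsb n : - C <= sups u n <= C.
  apply/andP; split.
    apply: (@le_trans _ _ (u n)); first by have := uC n; rewrite ler_norml => /andP[].
    by apply: ub_le_sup; [exact: has_ubound_sdrop|exists n => /=].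
  apply: ge_sup; first by exists (u n), n => /=.
  by move=> _ [k _ <-]; apply: le_trans (ler_norm _) (uC k).
rewrite ler_norml; apply/andP; split.
  apply: lb_le_inf; first by exists (sups u 0%N), 0%N.
  by move=> _ [n _ <-]; have /andP[] := supsb n.
apply: (@le_trans _ _ (sups u 0%N)); last by have /andP[] := supsb 0%N.
apply: ge_inf; last by exists 0%N.
by exists (- C) => _ [n _ <-]; have /andP[] := supsb n.
Qed.

End LimnSup.

(** * Almost periods of the Koopman operator *)

Section Koopman.
Context (R : realType) (d : measure_display) (T : measurableType d).
Variables (mu : {measure set T -> \bar R}) (D : set T) (S : T -> T).
Hypothesis mD : measurable D.
Hypothesis mS : measurable_fun setT S.
Hypothesis muD : (mu D < +oo)%E.
Hypothesis muS : forall A, measurable A -> mu (S @^-1` A) = mu A.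
Hypothesis SD : forall x, D x -> D (S x).

Lemma measurable_preimage_shift A : measurable A -> measurable (S @^-1` A).
Proof. by move=> mA; rewrite -[S @^-1` A]setTI; exact: mS. Qed.

(** [D] is only known to be forward invariant, but its preimage has the same finite measure, so
    integrals do not see the difference. *)
Lemma measure_preimageD : mu (S @^-1` D `\` D) = 0%E.
Proof.
have mSD := measurable_preimage_shift mD.
have fin : (mu (S @^-1` D) < +oo)%E by rewrite muS.
rewrite measureD//.
have -> : S @^-1` D `&` D = D by apply/seteqP; split => [x []//|x Dx]; split => //; exact: SD.
transitivity (mu D - mu D)%E; first by congr (_ - _)%E; exact: muS.
by rewrite subee// ge0_fin_numE.
Qed.

Lemma integral_shift (F : T -> \bar R) : measurable_fun D F ->
  (forall x, D x -> (0 <= F x)%E) ->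
  (\int[mu]_(x in D) F (S x) = \int[mu]_(x in D) F x)%E.
Proof.
move=> mF F0; have mSD := measurable_preimage_shift mD.
pose pS : {mfun T >-> T} := HB.pack S (isMeasurableFun.Build _ _ _ _ S mS).
have <- : (\int[pushforward mu pS]_(x in D) F x = \int[mu]_(x in D) F x)%E.
  by apply: eq_measure_integral => A mA _; exact: muS.
rewrite (ge0_integral_pushforward mS)//; last by move=> y; rewrite inE; exact: F0.
rewrite [RHS](ge0_negligible_integral (N := S @^-1` D `\` D))//.
- congr (integral _ _ _); apply/seteqP; split => [x Dx|x [SDx nx]].
    by split; [exact: SD|move=> []].
  by apply: contrapT => nDx; apply: nx.
- exact: measurableD.
- by apply: (measurable_comp mD) mF (measurable_funTS mS) => _ [x Dx <-].
- by move=> x Dx; exact: F0.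
- exact: measure_preimageD.
Qed.

Lemma measurable_fun_iter s : measurable_fun setT (iter s S).
Proof.
by elim: s => [|s IH]; [exact: measurable_id|exact: (measurableT_comp mS IH)].
Qed.

Lemma iter_stable s x : D x -> D (iter s S x).
Proof. by move=> Dx; elim: s => //= s; exact: SD. Qed.

Lemma measurable_fun_shift d' (U : measurableType d') (F : T -> U) s :
  measurable_fun D F -> measurable_fun D (fun x => F (iter s S x)).
Proof.
move=> mF; apply: (measurable_comp mD) mF (measurable_funTS (measurable_fun_iter s)).
by move=> _ [x Dx <-]; exact: iter_stable.
Qed.

Lemma integral_iter s (F : T -> \bar R) : measurable_fun D F ->
  (forall x, D x -> (0 <= F x)%E) ->
  (\int[mu]_(x in D) F (iter s S x) = \int[mu]_(x in D) F x)%E.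
Proof.
move=> mF F0; elim: s => // s IH; rewrite -{}IH.
under eq_integral do rewrite iterSr.
rewrite (integral_shift (F := fun x => F (iter s S x)))//.
  exact: measurable_fun_shift.
by move=> x Dx; apply/F0/iter_stable.
Qed.

Lemma ae_shift (P : T -> Prop) s : {ae mu, forall x, D x -> P x} ->
  {ae mu, forall x, D x -> P (iter s S x)}.
Proof.
move=> [N [mN N0 subN]]; exists (iter s S @^-1` N); split.
- by rewrite -[X in measurable X]setTI; exact: measurable_fun_iter.
- rewrite -N0; elim: s => // s <-.
  have -> : iter s.+1 S @^-1` N = S @^-1` (iter s S @^-1` N).
    by apply/funext => x; rewrite /preimage /= -iterS iterSr.
  by apply: muS; rewrite -[X in measurable X]setTI; exact: measurable_fun_iter.
- move=> x /= nP; apply: subN => /= PD; apply: nP => Dx; apply: PD; exact: iter_stable.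
Qed.

Lemma measurable_sqr_mod (f : T -> R[i]) :
  measurable_fun D (fun x => complex.Re (f x)) ->
  measurable_fun D (fun x => complex.Im (f x)) ->
  measurable_fun D (fun x => (sqr_mod (f x))%:E).
Proof.
move=> mr mi; apply/measurable_EFinP.
by apply: measurable_funD; apply: measurable_funX.
Qed.

Lemma L2_norm1 f : L2 mu D f -> L2_inner mu D f f = 1 ->
  (\int[mu]_(x in D) (sqr_mod (f x))%:E = 1)%E.
Proof.
move=> [mr mi fin] /(congr1 (@complex.Re R)) /=; rewrite /Rintegral.
under eq_integral.
  move=> x _; have -> : complex.Re (f x * conjc (f x)) = sqr_mod (f x).
    by case: (f x) => [a c]; rewrite /sqr_mod /=; ring.
  over.
move=> e; rewrite -[LHS]fineK ?e// ge0_fin_numE//.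
by apply: integral_ge0 => x _; rewrite lee_fin sqr_mod_ge0.
Qed.

(** Composition with [S] preserves the norm of [f], which is 1, and multiplies its square by
    [sqr_mod lambda]. *)
Lemma eigenvalue_unit f (lambda : R[i]) : L2 mu D f -> L2_inner mu D f f = 1 ->
  {ae mu, forall x, D x -> f (S x) = lambda * f x} -> sqr_mod lambda = 1.
Proof.
move=> fL2 f1 eig; have i1 := L2_norm1 fL2 f1; have [mr mi _] := fL2.
have mf := measurable_sqr_mod mr mi.
have f0 x : D x -> (0 <= (sqr_mod (f x))%:E)%E by rewrite lee_fin sqr_mod_ge0.
have := integral_iter 1 mf f0; rewrite /= i1.
rewrite (ge0_ae_eq_integral (g := fun x => ((sqr_mod lambda)%:E * (sqr_mod (f x))%:E)%E))//.
- rewrite ge0_integralZl// ?lee_fin ?sqr_mod_ge0// i1 mule1.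
  by move=> [].
- exact: (measurable_fun_shift 1 mf).
- exact: measurable_funeM.
- by move=> x _; rewrite lee_fin sqr_mod_ge0.
- by move=> x _; rewrite mule_ge0// lee_fin sqr_mod_ge0.
- by apply: filterS eig => x /[apply] ->; rewrite sqr_modM EFinM.
Qed.

Lemma measurable_comb k (c : 'I_k -> R[i]) (e : 'I_k -> T -> R[i]) :
  (forall i, L2 mu D (e i)) ->
  measurable_fun D (fun x => complex.Re (\sum_(i < k) c i * e i x)) /\
  measurable_fun D (fun x => complex.Im (\sum_(i < k) c i * e i x)).
Proof.
move=> eL2; split.
  rewrite (_ : (fun x => _) = (fun x => \sum_(i < k)
    (complex.Re (c i) * complex.Re (e i x) - complex.Im (c i) * complex.Im (e i x)))).
    apply: measurable_sum => i; have [mr mi _] := eL2 i.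
    by apply: measurable_funB; apply: measurable_funM.
  apply/funext => x; rewrite raddf_sum; apply: eq_bigr => i _.
  by case: (c i) (e i x) => [a b] [p q].
rewrite (_ : (fun x => _) = (fun x => \sum_(i < k)
  (complex.Re (c i) * complex.Im (e i x) + complex.Im (c i) * complex.Re (e i x)))).
  apply: measurable_sum => i; have [mr mi _] := eL2 i.
  by apply: measurable_funD; apply: measurable_funM.
apply/funext => x; rewrite raddf_sum; apply: eq_bigr => i _.
by case: (c i) (e i x) => [a b] [p q].
Qed.

(** With h the combination of eigenfunctions, split the difference into G - h at the shifted point,
    minus G - h at x, plus the increment of h. By invariance the first two have square norm below
    [eta], and splitting a square into three costs a factor 3, hence [6 * eta]. The increment of h
    has small coefficients. *)
Lemma shift_near_identity k (c : 'I_k -> R[i]) (e : 'I_k -> T -> R[i])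
    (lambda : 'I_k -> R[i]) (G : T -> R) (s : nat) (eta eps : R) :
  measurable_fun D G ->
  (forall i, L2 mu D (e i)) -> (forall i, L2_inner mu D (e i) (e i) = 1) ->
  (forall i, {ae mu, forall x, D x -> e i (S x) = lambda i * e i x}) ->
  (\int[mu]_(x in D) (sqr_mod ((G x)%:C%C - \sum_(i < k) c i * e i x))%:E
     < eta%:E)%E ->
  0 <= eps -> (forall i, sqr_mod (lambda i ^+ s - 1) <= eps) ->
  (\int[mu]_(x in D) ((G (iter s S x) - G x) ^+ 2)%:E <=
   (6 * eta + 3 * 2 ^+ k * eps * \sum_(i < k) sqr_mod (c i))%:E)%E.
Proof.
move=> mG eL2 e1 eig appr eps0 small.
have [mr mi] := measurable_comb c eL2.
pose h x := \sum_(i < k) c i * e i x.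
pose q x := sqr_mod ((G x)%:C%C - h x).
have mq : measurable_fun D (fun x => (q x)%:E).
  apply: measurable_sqr_mod.
    rewrite (_ : (fun x => _) = (fun x => G x - complex.Re (h x))).
      exact: measurable_funB.
    by apply/funext => x; rewrite raddfB.
  rewrite (_ : (fun x => _) = (fun x => 0 - complex.Im (h x))).
    exact: measurable_funB.
  by apply/funext => x; rewrite raddfB.
have q0 x : 0 <= q x by exact: sqr_mod_ge0.
(* The crude factor [2 ^+ k] for the square of a sum of [k] terms is harmless, since [k] and [c]
   will be fixed before [eps]. *)
pose w i := 3 * 2 ^+ k * eps * sqr_mod (c i).
have w0 i : 0 <= w i by rewrite !mulr_ge0// ?exprn_ge0// sqr_mod_ge0.
have me i : measurable_fun D (fun x => (sqr_mod (e i x))%:E).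
  by have [? ? _] := eL2 i; exact: measurable_sqr_mod.
have eigs i : {ae mu, forall x, D x -> e i (iter s S x) = lambda i ^+ s * e i x}.
  elim: s {small} => [|s IH]; first by apply: nearW => x _; rewrite expr0 mul1r.
  have := ae_shift s (eig i); apply: filterS2 IH => x h1 h2 Dx.
  by rewrite iterS h2// h1// exprS mulrA.
have eigA : {ae mu, forall x i, D x -> e i (iter s S x) = lambda i ^+ s * e i x}.
  by apply: filter_forall.
pose Phi x := (3%:E * (q (iter s S x))%:E + (3%:E * (q x)%:E +
   \sum_(i <- enum 'I_k) (w i)%:E * (sqr_mod (e i x))%:E))%E.
have mPhi : measurable_fun D Phi.
  apply: emeasurable_funD; first by apply: measurable_funeM; exact: (measurable_fun_shift s mq).
  apply: emeasurable_funD; first exact: measurable_funeM.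
  by apply: emeasurable_sum => i; exact: measurable_funeM.
have sum0 x : (0 <= \sum_(i <- enum 'I_k) (w i)%:E * (sqr_mod (e i x))%:E)%E.
  by apply: sume_ge0 => i _; rewrite -EFinM lee_fin mulr_ge0// sqr_mod_ge0.
apply: (@le_trans _ _ (\int[mu]_(x in D) Phi x)%E).
  apply: ae_ge0_le_integral => //.
  - by move=> x _; rewrite lee_fin sqr_ge0.
  - apply/measurable_EFinP; apply: measurable_funX; apply: measurable_funB => //.
    exact: (measurable_fun_shift s mG).
  - move=> x _; rewrite !adde_ge0// -EFinM lee_fin mulr_ge0//.
  - apply: filterS eigA => x ex Dx.
    rewrite /Phi; under eq_bigr do rewrite -EFinM.
    rewrite sumEFin -!EFinM -!EFinD lee_fin.
    have -> : (G (iter s S x) - G x) ^+ 2 =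
        sqr_mod (((G (iter s S x))%:C%C - h (iter s S x)) +
                 (- ((G x)%:C%C - h x)) + (h (iter s S x) - h x)).
      set z := (X in sqr_mod X); have -> : z = (G (iter s S x) - G x)%:C%C.
        by rewrite /z rmorphB /=; ring.
      by rewrite /sqr_mod /= expr0n addr0.
    apply: (le_trans (sqr_mod_add3 _ _ _)); rewrite sqr_modN -/(q _) -/(q _).
    rewrite 2!mulrDr -addrA lerD2l lerD2l.
    have -> : h (iter s S x) - h x = \sum_(i <- enum 'I_k) (c i * (lambda i ^+ s - 1)) * e i x.
      rewrite /h -sumrB big_enum /=; apply: eq_bigr => i _.
      by rewrite ex//; ring.
    apply: (@le_trans _ _ (3 * (2 ^+ k * \sum_(i <- enum 'I_k)
        sqr_mod (c i * (lambda i ^+ s - 1) * e i x)))).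
      have := sqr_mod_sum (enum 'I_k) (fun i => c i * (lambda i ^+ s - 1) * e i x).
      by rewrite size_enum_ord => le_sum; rewrite ler_wpM2l.
    rewrite mulrA big_distrr /=; apply: ler_sum => i _.
    rewrite /w !sqr_modM -!mulrA ler_wpM2l// ler_wpM2l ?exprn_ge0//.
    rewrite mulrCA ler_wpM2r ?small//.
    by rewrite mulr_ge0// sqr_mod_ge0.
rewrite /Phi ge0_integralD//; last 4 first.
- by move=> x _; rewrite -EFinM lee_fin mulr_ge0.
- by apply: measurable_funeM; exact: (measurable_fun_shift s mq).
- by move=> x _; rewrite adde_ge0// -EFinM lee_fin mulr_ge0.
- apply: emeasurable_funD; first exact: measurable_funeM.
  by apply: emeasurable_sum => i; exact: measurable_funeM.
rewrite ge0_integralD//; last 3 first.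
- by move=> x _; rewrite -EFinM lee_fin mulr_ge0.
- exact: measurable_funeM.
- by apply: emeasurable_sum => i; exact: measurable_funeM.
have mq' : measurable_fun D (fun x => (q (iter s S x))%:E) := measurable_fun_shift s mq.
rewrite (ge0_integralZl mu mD mq')//; last by move=> x _; rewrite lee_fin.
rewrite (ge0_integralZl mu mD mq)//; last by move=> x _; rewrite lee_fin.
have -> : (\int[mu]_(x in D) (q (iter s S x))%:E = \int[mu]_(x in D) (q x)%:E)%E.
  by apply: (integral_iter s (F := fun x => (q x)%:E)) => // x _; rewrite lee_fin.
rewrite ge0_integral_sum//; last 2 first.
- by move=> i; exact: measurable_funeM.
- by move=> i x _; rewrite -EFinM lee_fin mulr_ge0// sqr_mod_ge0.
rewrite (eq_bigr (fun i => (w i)%:E)); last first.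
  move=> i _; rewrite (ge0_integralZl mu mD (me i)) ?lee_fin//.
    by rewrite (L2_norm1 (eL2 i) (e1 i)) mule1.
  by move=> x _; rewrite lee_fin sqr_mod_ge0.
have -> : 6 * eta + 3 * 2 ^+ k * eps * \sum_(i < k) sqr_mod (c i) =
   3 * eta + (3 * eta + \sum_(i <- enum 'I_k) w i).
  rewrite big_enum /= /w -big_distrr /=; ring.
rewrite sumEFin 2!(EFinD (3 * eta)) (EFinM 3 eta); have := ltW appr; rewrite -/h -/q => le_eta.
apply: leeD; first exact: lee_wpmul2l.
apply: leeD; first exact: lee_wpmul2l.
by [].
Qed.

End Koopman.

Section KoopmanAlmostPeriod.
Context (R : realType) (d : measure_display) (T : measurableType d).
Variables (mu : {measure set T -> \bar R}) (D : set T) (S : T -> T).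
Hypothesis mD : measurable D.
Hypothesis mS : measurable_fun setT S.
Hypothesis muD : (mu D < +oo)%E.
Hypothesis muS : forall A, measurable A -> mu (S @^-1` A) = mu A.
Hypothesis SD : forall x, D x -> D (S x).

(** One [s] serves all [G a]: the eigenvalues in the finitely many approximations are collected in a
    single list before [simultaneous_return] is applied. *)
Lemma koopman_almost_period (E : set (T -> R[i])) (m : nat) (G : 'I_m -> T -> R)
    (C : R) :
  hilbert_basis mu D E -> (forall f, E f -> koopman_eigenvector mu D S f) ->
  (forall a, measurable_fun D (G a)) ->
  (forall a x, D x -> `|G a x| <= C) ->
  forall eta : R, 0 < eta -> exists2 s : nat, (0 < s)%N & forall a,
    (\int[mu]_(x in D) ((G a (iter s S x) - G a x) ^+ 2)%:E <= eta%:E)%E.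
Proof.
move=> [EL2 E1 _ Edense] Eeig mG GC eta eta0.
have [lam lamP] : exists lam : (T -> R[i]) -> R[i], forall f, E f ->
    {ae mu, forall x, D x -> f (S x) = lam f * f x}.
  suff /choice [lam lamP] : forall f, exists l : R[i], E f ->
      {ae mu, forall x, D x -> f (S x) = l * f x} by exists lam.
  move=> f; have [Ef|nEf] := pselect (E f); last by exists 0.
  by have [_ _ [l lP]] := Eeig f Ef; exists l.
pose data := {k : nat & (('I_k -> T -> R[i]) * ('I_k -> R[i]))%type}.
have /choice [F FP] : forall a, exists X : data,
    (forall i, E ((projT2 X).1 i)) /\
    (\int[mu]_(x in D) (sqr_mod ((G a x)%:C%C -
      \sum_(i < projT1 X) (projT2 X).2 i * (projT2 X).1 i x))%:E < (eta / 12)%:E)%E.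
  move=> a; have L2G : L2 mu D (fun x => (G a x)%:C%C).
    split => //=.
    apply: (@le_lt_trans _ _ (\int[mu]_(x in D) (C ^+ 2)%:E)%E).
      apply: ge0_le_integral => //.
      - by move=> x _; rewrite lee_fin sqr_mod_ge0.
      - by apply: measurable_sqr_mod => //=.
      - move=> x Dx; rewrite lee_fin /sqr_mod /= expr0n addr0.
        have h := GC a x Dx; rewrite -[G a x ^+ 2]real_normK ?num_real//.
        by rewrite lerXn2r ?nnegrE// (le_trans _ h).
    by rewrite integral_cst// lte_mul_pinfty// lee_fin sqr_ge0.
  have [|k [e [c [eE ec]]]] := Edense _ (eta / 12) L2G; first by rewrite divr_gt0.
  by exists (existT _ k (e, c)).
pose B a := 3 * 2 ^+ projT1 (F a) * \sum_(i < projT1 (F a)) sqr_mod ((projT2 (F a)).2 i).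
have B0 a : 0 <= B a.
  by rewrite !mulr_ge0// ?exprn_ge0// sumr_ge0// => i _; exact: sqr_mod_ge0.
pose BB := 1 + \sum_a B a.
have BB0 : 0 < BB by rewrite ltr_pwDl// sumr_ge0.
have BBa a : B a <= BB.
  by rewrite /BB (bigD1 a)//= addrCA lerDl addr_ge0// sumr_ge0.
(* The approximation error [6 * (eta / 12)] takes half of [eta], this choice the other half. The
   summand 1 in [BB] keeps the quotient meaningful if all coefficients vanish. *)
pose eps := eta / (2 * BB).
have eps0 : 0 < eps by rewrite divr_gt0// mulr_gt0.
pose ls := flatten [seq [seq lam ((projT2 (F a)).1 i) | i <- enum 'I_(projT1 (F a))]
   | a <- enum 'I_m].
have [|s s0 sP] := @simultaneous_return R ls eps eps0.
  move=> z /flatten_mapP [a _ /mapP [i _ ->]].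
  have Ef := (FP a).1 i; have := lamP _ Ef.
  by apply: (eigenvalue_unit mD mS muD muS SD); [exact: EL2|exact: E1].
exists s => // a; have [eE eta12] := FP a.
apply: le_trans.
  apply: (shift_near_identity mD mS muD muS SD (mG a) _ _ _ eta12 (ltW eps0)).
  - by move=> i; exact: EL2.
  - by move=> i; exact: E1.
  - by move=> i; exact: lamP (eE i).
  - move=> i; apply: sP; apply/flatten_mapP; exists a; first by rewrite mem_enum.
    by apply: map_f; rewrite mem_enum.
rewrite lee_fin mulrAC -/(B a).
have : B a * eps <= eta / 2.
  rewrite /eps mulrA ler_pdivrMr ?mulr_gt0//.
  have -> : eta / 2 * (2 * BB) = BB * eta by field.
  by rewrite ler_wpM2r// ltW.
lra.
Qed.

End KoopmanAlmostPeriod.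

(** * The shift on the orbit closure *)

Section Reindex.
Import ArrowAsProduct.
Lemma reindex_continuous (I : eqType) (T : topologicalType) (h : I -> I) :
  continuous (fun x : {ptws I -> T} => (fun i => x (h i)) : {ptws I -> T}).
Proof.
set f := (X in continuous X).
have ct i : continuous (fun x : {ptws I -> T} => x i).
  exact: (@proj_continuous I (fun _ => T) i).
move=> x; apply/cvg_sup; first exact/fmap_filter/(nbhs_filter (x : {ptws I -> T})).
move=> i; move: x; apply/(@continuousP _ (initial_topology (@^~ i))) => A [B oB <-].
have -> : f @^-1` ((@^~ i) @^-1` B) = (fun x : {ptws I -> T} => x (h i)) @^-1` B by [].
by apply: open_comp => // + _; exact: ct.
Qed.
End Reindex.

Section Shift.
Variable n : nat.

Lemma proj_cont i : continuous (fun x : omega_words n => x i : discrete_topology 'I_n.+1).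
Proof. exact: (@proj_continuous nat (fun _ => discrete_topology 'I_n.+1) i). Qed.

Lemma shift_cont : continuous (fun x : omega_words n => (fun i => x i.+1) : omega_words n).
Proof.
exact: (@reindex_continuous nat (discrete_topology 'I_n.+1) S).
Qed.

Lemma measurable_shift : measurable_fun setT (@Defs.shift n).
Proof.
apply: (@measurability _ _ (borel_words n) (borel_words n) setT (@Defs.shift n) (@open (omega_words n))) => //.
move=> _ [A oA <-]; rewrite setTI; apply: sub_sigma_algebra.
by apply: open_comp => // x _; exact: shift_cont.
Qed.

Lemma open_cylinder i (a : 'I_n.+1) : open [set x : omega_words n | x i = a].
Proof.
apply: (open_comp (f := fun x : omega_words n => x i : discrete_topology 'I_n.+1)
  (D := [set a])); last exact: discrete_open.
by move=> x _; exact: proj_cont.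
Qed.

Lemma measurable_cylinder i (a : 'I_n.+1) :
  measurable ([set x : borel_words n | x i = a]).
Proof. by apply: sub_sigma_algebra; exact: open_cylinder. Qed.

Lemma orbit_closure_measurable u : measurable (@orbit_closure n u).
Proof.
rewrite -[orbit_closure u]setCK; apply: measurableC; apply: sub_sigma_algebra.
by rewrite openC; exact: closed_closure.
Qed.

(** Agreement with [x] on [k] letters is an open condition, hence met by some shift of [u]. Bounds
    valid for all factors of [u] thus extend to the orbit closure. *)
Lemma orbit_closure_prefix u x k : @orbit_closure n u x ->
  exists i, forall j, (j < k)%N -> x j = u (i + j)%N.
Proof.
move=> Xx; have nx : nbhs (x : omega_words n)
    [set y : omega_words n | forall j, (j < k)%N -> y j = x j].
  elim: k => [|k IH]; first exact: filterS filterT.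
  have nk : nbhs (x : omega_words n) [set y : omega_words n | y k = x k].
    by apply: open_nbhs_nbhs; split => //; exact: open_cylinder.
  apply: filterS2 IH nk => y yk ykk j; rewrite ltnS leq_eqVlt.
  by move=> /predU1P[->|]; [exact: ykk|exact: yk].
have [y [[i _ <-] yx]] := Xx _ nx; exists i => j jk.
by rewrite -yx// addnC.
Qed.

Lemma orbit_closure_shift u x : @orbit_closure n u x -> orbit_closure u (Defs.shift x).
Proof.
move=> Xx B nB; have [y [[k _ <-] yB]] := Xx _ (shift_cont nB).
exists (fun i => u (i + k.+1)%N); split; first by exists k.+1.
by move: yB; rewrite /=; under eq_fun do rewrite addSnnS.
Qed.

End Shift.

Section AlmostPeriod.
Variables (R : realType) (n : nat) (u : nat -> 'I_n.+1) (C : nat).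
Variable f : 'I_n.+1 -> R.
Hypothesis fP : forall a i m,
  `|(count_mem a (subword u i m))%:R - m%:R * f a| <= C%:R.

Let dev (x : borel_words n) a k : R := \sum_(i < k) ((x i == a)%:R - f a).

Lemma devE (x : borel_words n) a k :
  dev x a k = (count_mem a (subword x 0 k))%:R - k%:R * f a.
Proof.
rewrite /dev sumrB sumr_const card_ord mulr_natl; congr (_ - _).
rewrite /subword /mkseq count_map -sum1_count.
rewrite -[k in RHS]subn0 -/(index_iota _ _) big_mkord natr_sum [RHS]big_mkcond.
by apply: eq_bigr => i _; rewrite /= add0n; case: (_ == _).
Qed.

Lemma dev_bounded (x : borel_words n) a k : orbit_closure u x -> `|dev x a k| <= C%:R.
Proof.
move=> /(orbit_closure_prefix k)[i xi]; rewrite devE.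
have -> : subword x 0 k = subword u i k; last exact: fP.
by apply/eq_in_map => j; rewrite mem_iota add0n => /xi.
Qed.

Lemma iter_shiftE (x : borel_words n) s i : iter s (@Defs.shift n) x i = x (i + s)%N.
Proof. by elim: s i => [|s IH] i; rewrite ?addn0//= /Defs.shift IH addSnnS. Qed.

Lemma measurable_dev D a k : measurable_fun D (fun x : borel_words n => dev x a k).
Proof.
apply: measurable_sum => i; apply: measurable_funB; last exact: measurable_cst.
rewrite (_ : (fun x => _) = \1_[set x : borel_words n | x i = a]).
  by apply: measurable_indic; exact: measurable_cylinder.
apply/funext => x; rewrite indicE; congr ((nat_of_bool _)%:R).
apply/idP/idP => [/eqP xa|/set_mem /= ->]; last exact: eqxx.
by rewrite inE.
Qed.

(** The transfer function. Bounded partial sums make it bounded and measurable on the orbit closure,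
    and [dev x a s] is [G a x] minus its value at the shifted point, everywhere there and not only
    almost everywhere. *)
Let G a (x : borel_words n) : R := limn_sup ((fun k => dev x a k) : R^o^nat).

Lemma transfer_shift a (x : borel_words n) s : orbit_closure u x ->
  G a (iter s (@Defs.shift n) x) = G a x - dev x a s.
Proof.
move=> Xx; elim: s => [|s IH]; first by rewrite /dev big_ord0 subr0.
have Xs : orbit_closure u (iter s (@Defs.shift n) x).
  refine (@iter_stable _ (borel_words n) _ _ (@orbit_closure_shift n u) s x Xx).
rewrite /= {1}/G.
rewrite (limn_sup_cocycle (u := fun k => dev (iter s (@Defs.shift n) x) a k)
  (C := C%:R) (c := (x s == a)%:R - f a)).
- by rewrite -/(G a _) IH /dev [in RHS]big_ord_recr /=; ring.
- by move=> k; exact: dev_bounded.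
- move=> k; rewrite /dev [in RHS]big_ord_recl iter_shiftE add0n addrAC subrr add0r.
  by apply: eq_bigr => i _; rewrite -[Defs.shift _]/(iter s.+1 (@Defs.shift n) x) !iter_shiftE /bump /= addSnnS.
Qed.

(** The square deviation of a window of length [s] is the square of an increment of [G a], summed
    over the letters, and has small integral. Averaging over [N] shifts yields a point with a small
    sum, and its prefix of length [N + s] occurs in [u]. *)
Lemma almost_periodic_counts : pure_discrete_spectrum R u ->
  forall eps : R, 0 < eps -> exists2 s : nat, (0 < s)%N & forall N, exists k,
    \sum_(i < N) \sum_a
      ((count_mem a (subword u (k + i) s))%:R - s%:R * f a) ^+ 2 <= eps * N%:R.
Proof.
move=> [mu [[muX inv] _ [E [Eb Eeig]]]] eps eps0.
set X := orbit_closure u in muX Eb Eeig.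
have mX : measurable X by exact: orbit_closure_measurable.
have muXfin : (mu X < +oo)%E by rewrite muX ltry.
have SX (x : borel_words n) : X x -> X (Defs.shift x) by exact: orbit_closure_shift.
have GC a x : X x -> `|G a x| <= C%:R.
  by move=> Xx; apply: limn_sup_bounded => k; exact: dev_bounded.
have mG a : measurable_fun X (G a).
  apply: measurable_fun_limn_sup => [x Xx|x Xx|k]; last exact: measurable_dev.
    exists C%:R => _ [k _ <-]; apply: le_trans (ler_norm _) _; exact: dev_bounded.
  by exists (- C%:R) => _ [k _ <-]; have := dev_bounded a k Xx; rewrite ler_norml => /andP[].
(* The [n.+1] letters share [eps / 2]; the other half makes the averaging contradiction strict. *)
pose eta := eps / (2 * n.+1%:R).
have eta0 : 0 < eta by rewrite divr_gt0// mulr_gt0.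
have [s s0 sP] := koopman_almost_period mX (@measurable_shift n) muXfin inv SX Eb Eeig mG GC eta0.
exists s => // N.
have [->|N0] := posnP N; first by exists 0%N; rewrite big_ord0 mulr0.
pose W (x : borel_words n) : R := \sum_a dev x a s ^+ 2.
have mdev2 a : measurable_fun X (fun x => (dev x a s ^+ 2)%:E).
  by apply/measurable_EFinP; apply: measurable_funX; exact: measurable_dev.
have mW : measurable_fun X (fun x => (W x)%:E).
  apply/measurable_EFinP; apply: measurable_sum => a.
  by apply: measurable_funX; exact: measurable_dev.
have W0 x : 0 <= W x by apply: sumr_ge0 => a _; exact: sqr_ge0.
have intW : (\int[mu]_(x in X) (W x)%:E <= (eps / 2)%:E)%E.
  under eq_integral do rewrite /W -sumEFin.
  rewrite (ge0_integral_sum mu mX mdev2); last by move=> a x _; rewrite lee_fin sqr_ge0.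
  apply: (@le_trans _ _ (\sum_(a : 'I_n.+1) eta%:E)%E).
    apply: lee_sum => a _; have := sP a; congr (_ <= _)%E.
    apply: eq_integral => x; rewrite inE => Xx; rewrite transfer_shift//; congr EFin.
    by rewrite addrAC subrr add0r sqrrN.
  rewrite sumEFin sumr_const card_ord lee_fin /eta -mulr_natr.
  by rewrite le_eqVlt; apply/orP; left; apply/eqP; field; rewrite addrC natr1 pnatr_eq0.
have [x Xx xN] : exists2 x : borel_words n, X x & \sum_(i < N) W (iter i (@Defs.shift n) x) <= eps * N%:R.
  apply: contrapT => nx.
  have big_W x : X x -> eps * N%:R <= \sum_(i < N) W (iter i (@Defs.shift n) x).
    by move=> Xx; rewrite leNgt; apply/negP => /ltW h; apply: nx; exists x.
  have miter i : measurable_fun X (fun x => (W (iter i (@Defs.shift n) x))%:E).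
    exact: (measurable_fun_shift mX (@measurable_shift n) SX i mW).
  have : ((eps * N%:R)%:E <= N%:R%:E * (eps / 2)%:E)%E.
    apply: (@le_trans _ _ (\int[mu]_(x in X) (\sum_(i < N) (W (iter i (@Defs.shift n) x))%:E))%E).
      rewrite -[leLHS]mule1 -muX -integral_cst//.
      apply: ge0_le_integral => //.
      - by move=> x _; rewrite lee_fin mulr_ge0// ltW.
      - by apply: emeasurable_sum => i.
      - by move=> x Xx; rewrite sumEFin lee_fin big_W.
    rewrite (ge0_integral_sum mu mX (fun i : 'I_N => miter i)); last by move=> i x _; rewrite lee_fin.
    apply: (@le_trans _ _ (\sum_(i < N) (eps / 2)%:E)%E); last first.
      by rewrite sumEFin sumr_const card_ord -EFinM mulr_natl.
    apply: lee_sum => i _.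
    rewrite (integral_iter mX (@measurable_shift n) muXfin inv SX i mW)//.
    by move=> x _; rewrite lee_fin.
  rewrite -EFinM lee_fin mulrC ler_pM2l ?ltr0n//; lra.
have [k xk] := orbit_closure_prefix (N + s) Xx; exists k.
apply: le_trans xN; rewrite le_eqVlt; apply/orP; left; apply/eqP; apply: eq_bigr => i _; apply: eq_bigr => a _.
congr (_ ^+ 2); rewrite devE; congr (_ - _); congr (_%:R).
congr count; apply/eq_in_map => j; rewrite mem_iota add0n => /andP[_ js].
by rewrite iter_shiftE add0n xk ?(addnC j) ?addnA//; have := ltn_ord i; lia.
Qed.

End AlmostPeriod.

(** Two occurrences of every letter in every image give positivity and blocks longer than 1 at
    once. *)
Lemma pisot_power n (phi : seq 'I_n.+1 -> seq 'I_n.+1) : irreducible_pisot phi ->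
  exists2 k, (0 < k)%N &
    (forall a c, c \in iter k phi [:: a]) /\ (forall a, (1 < size (iter k phi [:: a]))%N).
Proof.
move=> [phiM irr pisot]; have [k0 growth] := letter_growth phiM irr pisot 2.
exists k0.+1 => //; split=> [a c|a].
  by rewrite -has_pred1 has_count (leq_trans _ (growth _ (leqnSn k0) a c)).
by rewrite (leq_trans (growth _ (leqnSn k0) a ord0))// count_size.
Qed.

Theorem theorem7 (R : realType) (b : nat) (phi : seq 'I_b -> seq 'I_b)
    (u : nat -> 'I_b) (irr_pisot_phi : irreducible_pisot phi)
    (fix_u : fixed_point phi u) :
  (pisot_conjecture R -> echoing R u) /\ (b = 2%N -> echoing R u).
Proof.
case: b phi u irr_pisot_phi fix_u => [|n] phi u ip fix_u; first by case: (u 0%N).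
have [phiM irr pisot] := ip; have phi_u := fixed_point_stable phiM fix_u.
have [k k0 [pos long]] := pisot_power ip.
have psiM := word_morphism_iter k phiM; have psi_u := prefix_stable_iter k phi_u.
split=> [conj|[n1]]; apply: (echoing_of_coincidences psiM psi_u pos long).
  have [C bal] := pisot_balanced phiM phi_u irr pisot.
  have [f fP] := balanced_frequency R bal.
  apply: (coincidences_of_counts psiM psi_u pos long).
  exact: (almost_periodic_counts fP (conj _ _ _ ip fix_u)).
subst n; have [K recK] := uniform_recurrence psiM psi_u pos.
(* Searching from index 1 gives a return of the letter [u 0] at a positive index, which makes the
   shift nontrivial. *)
have [q /andP[q0 _] uq] := recK 1%N (u 0%N).
have [lam [beta [E [T [[E_eigen T_eigen [lam1 beta1]] [E0 E1 T0 E_inj T_inj]]]]]] :=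
  binary_weights irr pisot R.
have iter_eigen (F : 'I_2 -> R) m : (forall a, weight F (phi [:: a]) = m * F a) ->
    forall a, weight F (iter k phi [:: a]) = m ^+ k * F a.
  by move=> F_eigen a; rewrite (weight_iter phiM F_eigen) weight1.
have lamk : `|lam ^+ k| < 1 by rewrite normrX exprn_ilt1// -lt0n.
have betak : 1 < beta ^+ k by rewrite exprn_egt1// -lt0n.
move=> x x0; exact: (binary_coincidences psiM psi_u pos long (iter_eigen _ _ E_eigen)
  (iter_eigen _ _ T_eigen) lamk betak E0 E1 T0 E_inj T_inj q0 uq).
Qed.
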